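(* Let $k$ be an algebraically closed field of characteristic $p>0$, let $e\ge 1$ with $p^e>2$, let $c\in k\setminus\{0\}$, and for $i=1,2$ let $L_i(T)=\alpha_{i,e}T^{p^e}+\alpha_{i,e-1}T^{p^{e-1}}+\cdots+\alpha_{i,0}T\in k[T]$ with $\alpha_{i,e}\alpha_{i,0}\neq 0$. Let $X$ be the smooth model of the plane curve over $k$ defined by $L_1(x)\cdot L_2(y)+c=0$. Then there exists an injective group homomorphism $$\mathrm{Aut}(X)\hookrightarrow PGL(4,k).$$
   Context: $\mathrm{Aut}(X)$ is the group of automorphisms over $k$ of the smooth projective curve $X$. *)

(* Defs.v *)
From HB Require Import structures.
From mathcomp Require Import all_boot all_order all_algebra.
From mathcomp Require Import boolp classical_sets.
From mathcomp Require Import mpoly.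

Set Implicit Arguments.
Unset Strict Implicit.
Unset Printing Implicit Defensive.

Import GRing.Theory.
Local Open Scope ring_scope.
Local Open Scope classical_set_scope.
Local Open Scope quotient_scope.

Section Projective.
Variable k : fieldType.

(* P^n(k) is the set of lines of k^(n+1). *)
Definition pspace (n : nat) := {U : {vspace 'rV[k]_n.+1} | \dim U == 1%N}.

Definition line_of n (v : 'rV[k]_n.+1) : {vspace 'rV[k]_n.+1} := <[v]>%VS.

(* One choice of homogeneous coordinates.  They are only plugged into families
   of forms of a common degree (or derivatives of a form), so that nothing below
   depends on the choice. *)
Definition hcoord n (P : pspace n) : 'rV[k]_n.+1 := vpick (val P).

Definition peval n (F : {mpoly k[n.+1]}) (P : pspace n) : k :=
  F.@[hcoord P 0].

Definition zclosed n (Z : set (pspace n)) : Prop :=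
  exists S : set {mpoly k[n.+1]},
    (forall F, S F -> exists d : nat, F \is d.-homog) /\
    Z = [set P | forall F, S F -> peval F P = 0].

Definition zopen n (U : set (pspace n)) : Prop := zclosed (~` U).

Definition zirreducible n (Z : set (pspace n)) : Prop :=
  Z !=set0 /\
  forall A B : set (pspace n), zclosed A -> zclosed B ->
    Z `<=` A `|` B -> Z `<=` A \/ Z `<=` B.

Definition has_chain n (X : set (pspace n)) (d : nat) : Prop :=
  exists Z : nat -> set (pspace n),
    (forall i, (i <= d)%N ->
       [/\ zclosed (Z i), zirreducible (Z i) & Z i `<=` X]) /\
    (forall i, (i < d)%N -> Z i `<` Z i.+1).

(* Krull dimension of a closed set *)
Definition zdim n (X : set (pspace n)) (d : nat) : Prop :=
  has_chain X d /\ ~ has_chain X d.+1.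

(* The common kernel at (a representative of) P of the differentials of all
   forms vanishing on X, i.e. the Zariski tangent space of the affine cone
   over X; its dimension is that of the tangent space of X at P plus one. *)
Definition cone_tangent n (X : set (pspace n)) (P : pspace n) :
    set 'rV[k]_n.+1 :=
  [set w | forall (d : nat) (F : {mpoly k[n.+1]}), F \is d.-homog ->
     (forall Q, X Q -> peval F Q = 0) ->
     \sum_(j < n.+1) peval (F^`M(j)) P * w 0 j = 0].

Definition smooth_of_dim n (X : set (pspace n)) (d : nat) : Prop :=
  forall P, X P -> exists U : {vspace 'rV[k]_n.+1},
    [set` U] = cone_tangent X P /\ \dim U = d.+1.

(* Maps which are locally given by forms of the same degree. The equation
   forces these forms not to vanish simultaneously, as lines have dimension 1. *)
Definition regular_map n m (Y : set (pspace n)) (Z : set (pspace m))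
    (f : Y -> Z) : Prop :=
  forall x : Y, exists (U : set (pspace n)) (d : nat)
      (F : 'I_m.+1 -> {mpoly k[n.+1]}),
    [/\ zopen U, U (val x), (forall i, F i \is d.-homog) &
        forall y : Y, U (val y) ->
          val (val (f y)) = line_of (\row_i peval (F i) (val y))].

Definition isomorphic n m (Y : set (pspace n)) (Z : set (pspace m)) : Prop :=
  exists (f : Y -> Z) (g : Z -> Y),
    [/\ regular_map f, regular_map g, cancel f g & cancel g f].

Definition birational n m (Y : set (pspace n)) (Z : set (pspace m)) : Prop :=
  exists (U : set (pspace n)) (V : set (pspace m)),
    [/\ zopen U, zopen V, Y `&` U !=set0, Z `&` V !=set0 &
        isomorphic (Y `&` U) (Z `&` V)].

Definition smooth_projective_curve n (X : set (pspace n)) : Prop :=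
  [/\ zclosed X, zirreducible X, zdim X 1 & smooth_of_dim X 1].

(* C need not be closed: it is meant to be a locally closed irreducible curve. *)
Definition smooth_model n m (X : set (pspace n)) (C : set (pspace m)) : Prop :=
  smooth_projective_curve X /\ birational X C.

(* The affine plane curve f = 0, with A^2 embedded in P^2 by
   (a, b) |-> [1 : a : b]. *)
Definition plane_curve (f : k -> k -> k) : set (pspace 2) :=
  [set P | exists a b : k,
     f a b = 0 /\ val P = line_of (\row_(i < 3) [:: 1; a; b]`_i)].

End Projective.

Arguments pspace : clear implicits.

Section RegularMapTheory.
Variable k : fieldType.

Lemma line_ofZ n (a : k) (v : 'rV[k]_n.+1) :
  a != 0 -> line_of (a *: v) = line_of v.
Proof.
move=> a0; apply/eqP; rewrite eqEsubv -!memvE memvZ ?memv_line //=.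
by apply/vlineP; exists a^-1; rewrite scalerA mulVf // scale1r.
Qed.

Lemma line_hcoord n (P : pspace k n) : line_of (hcoord P) = val P.
Proof.
case: P => U /= dU; rewrite /hcoord /line_of /=.
have U0 : U != 0%VS by rewrite -dimv_eq0 (eqP dU).
apply/eqP; rewrite eqEdim -memvE memv_pick /= (eqP dU) dim_vline.
by rewrite vpick0 U0.
Qed.

Lemma hcoord_neq0 n (P : pspace k n) : hcoord P != 0.
Proof.
case: P => U /= dU; rewrite /hcoord /= vpick0.
by rewrite -dimv_eq0 (eqP dU).
Qed.

Lemma hcoordE n (P : pspace k n) v :
  val P = line_of v -> exists2 a : k, a != 0 & hcoord P = a *: v.
Proof.
move=> Pv; have : hcoord P \in line_of v by rewrite -Pv /hcoord memv_pick.
case/vlineP=> a Pa; exists a => //; apply: contraNneq (hcoord_neq0 P) => a0.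
by rewrite Pa a0 scale0r.
Qed.

Lemma mevalZ_homog n d (F : {mpoly k[n.+1]}) (a : k) (v : 'rV[k]_n.+1) :
  F \is d.-homog -> F.@[(a *: v) 0] = a ^+ d * F.@[v 0].
Proof.
move=> /dhomogP hF; rewrite !mevalE big_distrr /= big_seq [RHS]big_seq.
apply: eq_bigr => m /hF /= <-; rewrite mulrCA; congr (_ * _).
rewrite /= mdegE -prodrXr -big_split /=; apply: eq_bigr => i _.
by rewrite mxE exprMn.
Qed.

Lemma dhomog_comp n m d e (H : {mpoly k[m.+1]}) (F : 'I_m.+1 -> {mpoly k[n.+1]}) :
  H \is d.-homog -> (forall i, F i \is e.-homog) ->
  H \mPo [tuple F i | i < m.+1] \is (e * d).-homog.
Proof.
move=> /dhomogP hH hF; rewrite comp_mpolyEX big_seq; apply: rpred_sum => M /hH /= <-.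
apply: rpredZ; rewrite /= comp_mpolyX mdegE big_distrr /=.
elim/big_ind2: _ => [|p a q b|i _]; first exact: dhomog1.
- by apply: dhomogM.
- by rewrite tnth_mktuple; apply: dhomogMn.
Qed.

Lemma zopen_basicP n (U : set (pspace k n)) (P : pspace k n) : zopen U -> U P ->
  exists (d : nat) (G : {mpoly k[n.+1]}),
    [/\ G \is d.-homog, peval G P != 0 & [set Q | peval G Q != 0] `<=` U].
Proof.
case=> S [hS eU] UP.
have : ~ (forall F, S F -> peval F P = 0).
  by move=> h; have : (~` U) P by rewrite eU.
move=> /existsNP[G /not_implyP[SG /eqP GP]].
have [d Gd] := hS _ SG; exists d, G; split=> // Q /eqP GQ.
apply: contrapT => UQ; have : (~` U) Q by [].
by rewrite eU => /(_ G SG).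
Qed.

Lemma zopen_basic n d (G : {mpoly k[n.+1]}) :
  G \is d.-homog -> zopen [set Q : pspace k n | peval G Q != 0].
Proof.
move=> Gd; exists [set G]; split; first by move=> _ ->; exists d.
apply/seteqP; split => Q /=.
  by move=> h _ ->; apply/eqP/negPn/negP.
by move=> /(_ G erefl) ->; rewrite eqxx.
Qed.

Lemma zopenI n (U V : set (pspace k n)) : zopen U -> zopen V -> zopen (U `&` V).
Proof.
move=> [S [hS eU]] [T [hT eV]].
exists [set F | exists G H, [/\ S G, T H & F = G * H]]; split.
  move=> _ [G [H [/hS[a Ga] /hT[b Hb] ->]]].
  by exists (a + b)%N; apply: dhomogM.
rewrite setCI eU eV; apply/seteqP; split => Q /=.
  move=> [h|h] _ [G [H [SG TH ->]]]; rewrite /peval mevalM.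
    by rewrite -/(peval G Q) h // mul0r.
  by rewrite mulrC -/(peval H Q) h // mul0r.
move=> h; apply: contrapT => /not_orP[/existsNP[G /not_implyP[SG GQ]]].
move=> /existsNP[H /not_implyP[TH HQ]].
have /eqP := h _ (ex_intro _ G (ex_intro _ H (And3 SG TH erefl))).
by rewrite /peval mevalM mulf_eq0 => /orP[] /eqP.
Qed.

Lemma regular_id n (Y : set (pspace k n)) : regular_map (@idfun Y).
Proof.
move=> x; exists setT, 1%N, (fun i => 'X_i); split=> //.
- exists [set 1]; split; first by move=> _ ->; exists 0%N; exact: dhomog1.
  rewrite setCT; apply/seteqP; split => Q //= /(_ 1 erefl) /eqP.
  by rewrite /peval meval1 oner_eq0.
- by move=> i; rewrite dhomogX /= mdeg1.
move=> y _; rewrite -line_hcoord; congr line_of.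
by apply/rowP => i; rewrite mxE /peval mevalXU.
Qed.

Lemma regular_comp n m l (Y : set (pspace k n)) (Z : set (pspace k m))
    (W : set (pspace k l)) (f : Y -> Z) (g : Z -> W) :
  regular_map f -> regular_map g -> regular_map (g \o f).
Proof.
move=> hf hg x.
have [U [d [F [oU Ux Fd fE]]]] := hf x.
have [V [e [G [oV Vx Ge gE]]]] := hg (f x).
have [b [H [Hb Hx HV]]] := zopen_basicP oV Vx.
pose pull (K : {mpoly k[m.+1]}) := K \mPo [tuple F i | i < m.+1].
have pullE K c : K \is c.-homog -> forall y : Y, U (val y) ->
    exists2 a, a != 0 & peval K (val (f y)) = a ^+ c * peval (pull K) (val y).
  move=> Kc y Uy; have [a a0 fy] := hcoordE (fE y Uy); exists a => //.
  rewrite /peval fy (mevalZ_homog _ _ Kc) comp_mpoly_meval; congr (_ * _).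
  by apply: meval_eq => i; rewrite mxE tnth_mktuple.
exists (U `&` [set Q | peval (pull H) Q != 0]), (d * e)%N, (fun i => pull (G i)).
split.
- by apply: zopenI => //; apply: zopen_basic (dhomog_comp Hb Fd).
- split=> //=; have [a a0 E] := pullE _ _ Hb x Ux.
  by apply: contraNneq Hx => h; rewrite E h mulr0.
- by move=> i; apply: dhomog_comp.
move=> y [Uy Hy] /=; rewrite gE; last first.
  apply: HV => /=; have [a a0 ->] := pullE _ _ Hb y Uy.
  by rewrite mulf_neq0 // expf_neq0.
have [a a0 fy] := hcoordE (fE y Uy).
rewrite -[RHS](line_ofZ _ (expf_neq0 e a0)); congr line_of; apply/rowP => i.
rewrite !mxE /peval fy (mevalZ_homog _ _ (Ge i)) comp_mpoly_meval; congr (_ * _).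
by apply: meval_eq => j; rewrite mxE tnth_mktuple.
Qed.
End RegularMapTheory.

Section Automorphisms.
Variables (k : fieldType) (n : nat) (X : set (pspace k n)).

Definition is_automorphism (f : X -> X) : Prop :=
  regular_map f /\
  exists g : X -> X, [/\ regular_map g, cancel f g & cancel g f].

Record Aut := MkAut { aut_fun :> X -> X; autP : is_automorphism aut_fun }.

HB.instance Definition _ := gen_eqMixin Aut.
HB.instance Definition _ := gen_choiceMixin Aut.

Lemma aut_ext (f g : Aut) : aut_fun f =1 g -> f = g.
Proof.
case: f g => [f fP] [g gP] /= /funext fg; case: _ / fg gP => gP.
by congr MkAut; apply: Prop_irrelevance.
Qed.

Lemma aut_one_subproof : is_automorphism idfun.
Proof. by split; [|exists idfun; split=> //]; exact: regular_id. Qed.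

Lemma aut_mul_subproof (f g : Aut) : is_automorphism (f \o g).
Proof.
case: f g => [f [fr [f' [f'r fK f'K]]]] [g [gr [g' [g'r gK g'K]]]] /=.
split; first exact: regular_comp.
exists (g' \o f'); split; first exact: regular_comp.
  exact: can_comp.
exact: can_comp.
Qed.

Lemma aut_inv_subproof (f : Aut) :
  {g : X -> X | is_automorphism g /\ cancel f g /\ cancel g f}.
Proof.
apply: cid; case: f => [f [fr [g [gr fK gK]]]] /=.
by exists g; do 2![split=> //]; exists f.
Qed.

Definition aut_one : Aut := MkAut aut_one_subproof.
Definition aut_mul (f g : Aut) : Aut := MkAut (aut_mul_subproof f g).
Definition aut_inv (f : Aut) : Aut := MkAut (svalP (aut_inv_subproof f)).1.

Lemma aut_mulA : associative aut_mul.
Proof. by move=> f g h; apply: aut_ext. Qed.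

Lemma aut_mul1 : left_id aut_one aut_mul.
Proof. by move=> f; apply: aut_ext. Qed.

Lemma aut_1mul : right_id aut_one aut_mul.
Proof. by move=> f; apply: aut_ext. Qed.

Lemma aut_mulV : left_inverse aut_one aut_inv aut_mul.
Proof. by move=> f; apply: aut_ext => x; apply: (svalP (aut_inv_subproof f)).2.1. Qed.

Lemma aut_Vmul : right_inverse aut_one aut_inv aut_mul.
Proof. by move=> f; apply: aut_ext => x; apply: (svalP (aut_inv_subproof f)).2.2. Qed.

HB.instance Definition _ := isGroup.Build Aut
  aut_mulA aut_mul1 aut_1mul aut_mulV aut_Vmul.
End Automorphisms.

Section PGL.
Variables (n : nat) (k : fieldType).

Definition GL := {A : 'M[k]_n | A \in unitmx}.

Definition proportional (A B : GL) : bool :=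
  `[< exists2 a : k, a != 0 & val A = a *: val B >].

Lemma proportional_equiv : equiv_class_of proportional.
Proof.
split.
- by move=> A; apply/asboolP; exists 1; rewrite ?oner_eq0 // scale1r.
- have sym A B : proportional A B -> proportional B A.
    move=> /asboolP[a a0 e]; apply/asboolP; exists a^-1; rewrite ?invr_eq0 //.
    by rewrite e scalerA mulVf // scale1r.
  by move=> A B; apply/idP/idP; apply: sym.
- move=> B A C /asboolP[a a0 e] /asboolP[b b0 e']; apply/asboolP.
  by exists (a * b); rewrite ?mulf_neq0 // e e' scalerA.
Qed.

Canonical proportional_rel := EquivRelPack proportional_equiv.

Definition PGL := {eq_quot proportional_rel}.
HB.instance Definition _ := Choice.on PGL.
HB.instance Definition _ := EqQuotient.on PGL.

Definition mkGL (A : 'M[k]_n) (uA : A \in unitmx) : GL := exist _ A uA.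

Definition gl_one : GL := mkGL (unitmx1 k n).

Lemma gl_mul_subproof (A B : GL) : val A *m val B \in unitmx.
Proof. by rewrite unitmx_mul (valP A) (valP B). Qed.

Definition gl_mul (A B : GL) : GL := mkGL (gl_mul_subproof A B).

Lemma gl_inv_subproof (A : GL) : invmx (val A) \in unitmx.
Proof. by rewrite unitmx_inv (valP A). Qed.

Definition gl_inv (A : GL) : GL := mkGL (gl_inv_subproof A).

Definition to_PGL (A : GL) : PGL := \pi_PGL A.

Lemma to_PGLP (A B : GL) :
  reflect (exists2 a : k, a != 0 & val A = a *: val B) (to_PGL A == to_PGL B).
Proof. by rewrite /to_PGL eqmodE; apply: asboolP. Qed.

Lemma to_PGLK (u : PGL) : to_PGL (repr u) = u.
Proof. exact: reprK. Qed.

Definition pgl_one : PGL := to_PGL gl_one.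
Definition pgl_mul (u v : PGL) : PGL := to_PGL (gl_mul (repr u) (repr v)).
Definition pgl_inv (u : PGL) : PGL := to_PGL (gl_inv (repr u)).

Lemma repr_to_PGL (A : GL) :
  exists2 a : k, a != 0 & val (repr (to_PGL A)) = a *: val A.
Proof. by apply/to_PGLP; rewrite to_PGLK. Qed.

Lemma pgl_mulE (A B : GL) : pgl_mul (to_PGL A) (to_PGL B) = to_PGL (gl_mul A B).
Proof.
apply/eqP/to_PGLP; have [a a0 eA] := repr_to_PGL A.
have [b b0 eB] := repr_to_PGL B; exists (a * b); first by rewrite mulf_neq0.
by rewrite /= eA eB -scalemxAl -scalemxAr scalerA.
Qed.

Lemma pgl_mulA : associative pgl_mul.
Proof.
move=> u v w; rewrite -[u]to_PGLK -[v]to_PGLK -[w]to_PGLK !pgl_mulE.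
by congr to_PGL; apply: val_inj; rewrite /= mulmxA.
Qed.

Lemma pgl_mul1 : left_id pgl_one pgl_mul.
Proof.
move=> u; rewrite -[u]to_PGLK pgl_mulE.
by congr to_PGL; apply: val_inj; rewrite /= mul1mx.
Qed.

Lemma pgl_1mul : right_id pgl_one pgl_mul.
Proof.
move=> u; rewrite -[u]to_PGLK pgl_mulE.
by congr to_PGL; apply: val_inj; rewrite /= mulmx1.
Qed.

Lemma pgl_mulV : left_inverse pgl_one pgl_inv pgl_mul.
Proof.
move=> u; rewrite /pgl_inv -{2}[u]to_PGLK pgl_mulE.
by congr to_PGL; apply: val_inj; rewrite /= mulVmx // (valP (repr u)).
Qed.

Lemma pgl_Vmul : right_inverse pgl_one pgl_inv pgl_mul.
Proof.
move=> u; rewrite /pgl_inv -{1}[u]to_PGLK pgl_mulE.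
by congr to_PGL; apply: val_inj; rewrite /= mulmxV // (valP (repr u)).
Qed.

HB.instance Definition _ := isGroup.Build PGL
  pgl_mulA pgl_mul1 pgl_1mul pgl_mulV pgl_Vmul.
End PGL.

Definition additive_poly (k : fieldType) (p e : nat) (a : 'I_e.+1 -> k) :
    {poly k} :=
  \sum_(j < e.+1) a j *: 'X^(p ^ j).

(* Main.v *)
(* Let K be the function field of A(x) B(y) + c = 0, where A and B have degree q and constant
   derivative. Places of K correspond to the points of the closure of the curve in P^1 x P^1,
   which is smooth and totally ramified over the roots of A and B. An automorphism of X
   carries (x, y) to another pair (x', y') that generates K and satisfies the same equation.
   For generic t the function z = 1 / (x' - t) has exactly q poles, all simple and at finite
   points. Let E be the product of the x - a over the distinct abscissas a of these poles;
   local analysis at the finite points and at infinity gives E(x) z = s(x) + A(x) y m(y) with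
   m = 0 unless there are q distinct abscissas. In the first case z = s(x) / (x - a); in the
   second case the missing coefficient of degree q - 1 of B forces all poles to have the same
   ordinate, and the roles of x and y are exchanged. Hence x' and y' are homographic functions
   of x and y, or of y and x, so that the automorphism acts linearly on (1, x, y, xy). The
   matrix is unique up to a scalar since 1, x, y, xy and the other monomials of bidegree at most
   (2, 2) are linearly independent, q being at least 3. *)

Require Import Defs.
From HB Require Import structures.
From mathcomp Require Import all_boot all_order all_algebra all_field.
From mathcomp Require Import boolp classical_sets.
From mathcomp Require Import mpoly ring zify.

Set Implicit Arguments.
Unset Strict Implicit.
Unset Printing Implicit Defensive.

Import GRing.Theory.
Local Open Scope ring_scope.

(** * Evaluation of polynomials *)

(** The vector (1, x, y, xy) is the Segre embedding of P^1 x P^1 in P^3, and linear maps of P^3 can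
    exchange the two factors; this is why both cases, x' in k(x) and x' in k(y), end in the same
    group. An automorphism of the smooth model induces only a rational self-map of the plane curve,
    since the open sets of the birational equivalence need not be stable under it. The geometry of
    [X] therefore enters through irreducibility: nonempty open sets meet, and a property that holds
    on one of them becomes a property of all points of the plane curve outside the zeros of one
    nonzero function. The field [K] is constructed from the equation alone. Divisor theory is
    replaced by explicit computation: a place is a valuation ring given as a predicate, every
    element of [K] is a polynomial in x and y, of degree less than q in y, divided by a polynomial
    in x, and regularity allows the denominator to be cancelled root by root. *)

Section Evaluation.
Variables (k : fieldType) (L : comNzRingType) (f : {rmorphism k -> L}).

Definition ev1 (x : L) (p : {poly k}) : L := (map_poly f p).[x].

Fact ev1_is_zmod_morphism x : zmod_morphism (ev1 x).
Proof. by move=> p q; rewrite /ev1 rmorphB hornerD hornerN. Qed.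

Fact ev1_is_monoid_morphism x : monoid_morphism (ev1 x).
Proof. by split=> [|p q]; rewrite /ev1 ?rmorph1 ?hornerC // rmorphM hornerM. Qed.

HB.instance Definition _ x :=
  GRing.isZmodMorphism.Build _ _ (ev1 x) (ev1_is_zmod_morphism x).
HB.instance Definition _ x :=
  GRing.isMonoidMorphism.Build _ _ (ev1 x) (ev1_is_monoid_morphism x).

(* In [{poly {poly k}}] the inner variable is evaluated at [x] and the outer one at [y]. *)
Definition ev2 (x y : L) (P : {poly {poly k}}) : L := (map_poly (ev1 x) P).[y].

Fact ev2_is_zmod_morphism x y : zmod_morphism (ev2 x y).
Proof. by move=> p q; rewrite /ev2 rmorphB hornerD hornerN. Qed.

Fact ev2_is_monoid_morphism x y : monoid_morphism (ev2 x y).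
Proof. by split=> [|p q]; rewrite /ev2 ?rmorph1 ?hornerC // rmorphM hornerM. Qed.

HB.instance Definition _ x y :=
  GRing.isZmodMorphism.Build _ _ (ev2 x y) (ev2_is_zmod_morphism x y).
HB.instance Definition _ x y :=
  GRing.isMonoidMorphism.Build _ _ (ev2 x y) (ev2_is_monoid_morphism x y).

Lemma ev1D x : {morph ev1 x : p q / p + q}. Proof. exact: rmorphD. Qed.
Lemma ev1B x : {morph ev1 x : p q / p - q}. Proof. exact: rmorphB. Qed.
Lemma ev1M x : {morph ev1 x : p q / p * q}. Proof. exact: rmorphM. Qed.
Lemma ev1_0 x : ev1 x 0 = 0. Proof. exact: rmorph0. Qed.
Lemma ev1_1 x : ev1 x 1 = 1. Proof. exact: rmorph1. Qed.
Lemma ev1Xn x n : {morph ev1 x : p / p ^+ n}. Proof. exact: rmorphXn. Qed.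

Lemma ev2D x y : {morph ev2 x y : p q / p + q}. Proof. exact: rmorphD. Qed.
Lemma ev2B x y : {morph ev2 x y : p q / p - q}. Proof. exact: rmorphB. Qed.
Lemma ev2M x y : {morph ev2 x y : p q / p * q}. Proof. exact: rmorphM. Qed.
Lemma ev2_0 x y : ev2 x y 0 = 0. Proof. exact: rmorph0. Qed.
Lemma ev2_1 x y : ev2 x y 1 = 1. Proof. exact: rmorph1. Qed.
Lemma ev2Xn x y n : {morph ev2 x y : p / p ^+ n}. Proof. exact: rmorphXn. Qed.

Lemma ev1C x a : ev1 x a%:P = f a.
Proof. by rewrite /ev1 map_polyC hornerC. Qed.

Lemma ev1X x : ev1 x 'X = x.
Proof. by rewrite /ev1 map_polyX hornerX. Qed.

Lemma ev1Z x a p : ev1 x (a *: p) = f a * ev1 x p.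
Proof. by rewrite -mul_polyC ev1M ev1C. Qed.

Lemma ev1_XsubC x a : ev1 x ('X - a%:P) = x - f a.
Proof. by rewrite ev1B ev1X ev1C. Qed.

Lemma ev2C x y p : ev2 x y p%:P = ev1 x p.
Proof. by rewrite /ev2 map_polyC hornerC. Qed.

Lemma ev2X x y : ev2 x y 'X = y.
Proof. by rewrite /ev2 map_polyX hornerX. Qed.

Lemma ev2Z x y p P : ev2 x y (p *: P) = ev1 x p * ev2 x y P.
Proof. by rewrite -mul_polyC ev2M ev2C. Qed.

Lemma ev2_lift x y p : ev2 x y (map_poly polyC p) = ev1 y p.
Proof.
rewrite /ev2 -map_poly_comp /ev1; congr (_.[_]).
by apply: eq_map_poly => a /=; rewrite ev1C.
Qed.

Lemma ev2_sum x y (P : {poly {poly k}}) n : (size P <= n)%N ->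
  ev2 x y P = \sum_(i < n) ev1 x P`_i * y ^+ i.
Proof.
move=> sP; rewrite /ev2 (@horner_coef_wide _ n) ?(leq_trans (size_poly _ _) sP) //.
by apply: eq_bigr => i _; rewrite coef_map.
Qed.

End Evaluation.

Lemma ev1_id (k : fieldType) (a : k) p : ev1 idfun a p = p.[a].
Proof. by rewrite /ev1 map_poly_id. Qed.

Lemma ev1_rmorph (k : fieldType) (L : comNzRingType) (f : {rmorphism k -> L}) (a : k) p :
  ev1 f (f a) p = f p.[a].
Proof. by rewrite /ev1 horner_map. Qed.

(** Since [p] splits over [k], an element of [K] algebraic over [k] is a constant. *)
Lemma ev1_root (k : closedFieldType) (K : fieldType) (iota : {rmorphism k -> K})
    (z : K) (p : {poly k}) : p != 0 -> ev1 iota z p = 0 -> exists a, z = iota a.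
Proof.
move=> p0; have [rs pE] := closed_field_poly_normal p.
rewrite pE ev1Z => /eqP; rewrite mulf_eq0 fmorph_eq0 lead_coef_eq0 (negPf p0) /=.
elim: rs {pE} => [|b rs IH]; first by rewrite big_nil ev1_1 oner_eq0.
rewrite big_cons ev1M ev1_XsubC mulf_eq0 => /orP[|/IH //].
by rewrite subr_eq0 => /eqP ->; exists b.
Qed.

Definition fiber (k : fieldType) (a : k) (P : {poly {poly k}}) : {poly k} :=
  map_poly (ev1 idfun a) P.

Lemma coef_fiber (k : fieldType) (a : k) (P : {poly {poly k}}) i : (fiber a P)`_i = (P`_i).[a].
Proof. by rewrite coef_map /= ev1_id. Qed.

Lemma fiber_eq0 (k : fieldType) (a : k) P :
  fiber a P = 0 -> exists Q, P = ('X - a%:P)%:P * Q.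
Proof.
move=> Pa; exists (map_poly (fun p => p %/ ('X - a%:P)) P).
apply/polyP => i; rewrite coefCM coef_map_id0 ?div0p // mulrC divpK //.
by rewrite dvdp_XsubCl /root -coef_fiber Pa coef0.
Qed.

(** The ideal of the point (a, b) is generated by X - a and Y - b: divide by Y - b, then divide the
    remainder, a polynomial in X, by X - a. *)
Lemma ev2_id_eq0 (k : fieldType) (a b : k) P : ev2 idfun a b P = 0 ->
  exists P1 P2, P = ('X - a%:P)%:P * P1 + ('X - b%:P%:P) * P2.
Proof.
move=> Pab.
have /factor_theorem[P2 P2E] : root (P - P.[b%:P]%:P) b%:P.
  by rewrite /root hornerD hornerN hornerC subrr.
have [p1 p1E] : exists p1, P.[b%:P] = p1 * ('X - a%:P).
  apply/factor_theorem; rewrite /root -ev1_id.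
  have := congr1 (ev2 idfun a b) P2E.
  rewrite ev2M ev2B ev2C Pab sub0r.
  by rewrite ev2B ev2X ev2C ev1C subrr mulr0 => /eqP; rewrite oppr_eq0.
by exists p1%:P, P2; rewrite -[P in LHS](subrK P.[b%:P]%:P) P2E p1E polyCM; ring.
Qed.

(** * Places *)

Section Places.
Variables (k : closedFieldType) (K : fieldType) (iota : {rmorphism k -> K}).
Implicit Types (O : K -> Prop) (z : K) (a b : k).

(** A place is encoded by its valuation ring. The residue field is never formed: as it will be [k],
    the statement that z takes the value a is expressed by [mplace O (z - iota a)]. *)
Record place O : Prop := Place {
  place_const : forall a, O (iota a);
  placeD : forall z1 z2, O z1 -> O z2 -> O (z1 + z2);
  placeM : forall z1 z2, O z1 -> O z2 -> O (z1 * z2);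
  place_total : forall z, O z \/ O z^-1;
  place_proper : exists z, ~ O z }.

(* The maximal ideal of the valuation ring [O]. *)
Definition mplace O z := z = 0 \/ ~ O z^-1.

Section OnePlace.
Variables (O : K -> Prop) (plO : place O).

Lemma place0 : O 0. Proof. by rewrite -(rmorph0 iota); apply: (place_const plO). Qed.
Lemma place1 : O 1. Proof. by rewrite -(rmorph1 iota); apply: (place_const plO). Qed.

Lemma placeN z : O z -> O (- z).
Proof.
move=> Oz; rewrite -mulN1r; apply: (placeM plO) => //.
by rewrite -(rmorph1 iota) -rmorphN; apply: (place_const plO).
Qed.

Lemma placeB z1 z2 : O z1 -> O z2 -> O (z1 - z2).
Proof. by move=> O1 O2; apply: (placeD plO) => //; apply: placeN. Qed.

Lemma placeXn z n : O z -> O (z ^+ n).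
Proof.
move=> Oz; elim: n => [|n IH]; first by rewrite expr0; apply: place1.
by rewrite exprS; apply: (placeM plO).
Qed.

Lemma place_ev1 z p : O z -> O (ev1 iota z p).
Proof.
move=> Oz; elim/poly_ind: p => [|p a IH]; first by rewrite ev1_0; apply: place0.
by rewrite ev1D ev1M ev1X ev1C; apply: (placeD plO); [apply: (placeM plO)|apply: (place_const plO)].
Qed.

Lemma place_ev2 z1 z2 P : O z1 -> O z2 -> O (ev2 iota z1 z2 P).
Proof.
move=> O1 O2; elim/poly_ind: P => [|P p IH]; first by rewrite ev2_0; apply: place0.
by rewrite ev2D ev2M ev2X ev2C; apply: (placeD plO); [apply: (placeM plO)|apply: place_ev1].
Qed.

Lemma mplaceW z : mplace O z -> O z.
Proof.
case=> [->|Oz]; first exact: place0.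
by case: (place_total plO z).
Qed.

Lemma mplace0 : mplace O 0. Proof. by left. Qed.

Lemma mplaceM z1 z2 : O z1 -> mplace O z2 -> mplace O (z1 * z2).
Proof.
move=> O1 [->|O2]; first by rewrite mulr0; left.
have [->|z10] := eqVneq z1 0; first by rewrite mul0r; left.
right=> O12; apply: O2; have : O (z1 * (z1 * z2)^-1) by apply: (placeM plO).
by rewrite invfM mulrA mulfV // mul1r.
Qed.

Lemma mplaceMr z1 z2 : mplace O z1 -> O z2 -> mplace O (z1 * z2).
Proof. by move=> m1 O2; rewrite mulrC; apply: mplaceM. Qed.

Lemma mplaceN z : mplace O z -> mplace O (- z).
Proof.
by move=> mz; rewrite -mulN1r; apply: mplaceM => //; apply/placeN/place1.
Qed.

Lemma mplaceD z1 z2 : mplace O z1 -> mplace O z2 -> mplace O (z1 + z2).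
Proof.
move=> m1 m2; have [->|z10] := eqVneq z1 0; first by rewrite add0r.
have [->|z20] := eqVneq z2 0; first by rewrite addr0.
case: (place_total plO (z1 / z2)) => [O12|].
  have -> : z1 + z2 = (z1 / z2 + 1) * z2 by rewrite mulrDl mul1r divfK.
  by apply: mplaceM => //; apply: (placeD plO) => //; apply: place1.
rewrite invf_div => O21.
have -> : z1 + z2 = (1 + z2 / z1) * z1 by rewrite mulrDl mul1r divfK.
by apply: mplaceM => //; apply: (placeD plO) => //; apply: place1.
Qed.

Lemma mplaceB z1 z2 : mplace O z1 -> mplace O z2 -> mplace O (z1 - z2).
Proof. by move=> m1 m2; apply/mplaceD/mplaceN. Qed.

Lemma mplace1 : ~ mplace O 1.
Proof.
case=> [/eqP|]; first by rewrite oner_eq0.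
by rewrite invr1 => /(_ place1).
Qed.

Lemma mplace_unit z1 z2 : z1 * z2 = 1 -> mplace O z1 -> O z2 -> False.
Proof. by move=> z12 m1 O2; apply: mplace1; rewrite -z12; apply: mplaceMr. Qed.

Lemma mplaceV z : z != 0 -> ~ O z -> mplace O z^-1.
Proof. by move=> z0 Oz; right; rewrite invrK. Qed.

Lemma place_unitV z : O z -> ~ mplace O z -> O z^-1.
Proof. by move=> Oz mz; apply: contrapT => Ozi; apply: mz; right. Qed.

Lemma mplace_const a : mplace O (iota a) -> a = 0.
Proof.
move=> ma; apply/eqP/negPn/negP => a0.
apply: (@mplace_unit (iota a) (iota a^-1)) => //; last exact: (place_const plO).
by rewrite -rmorphM mulfV // rmorph1.
Qed.

Lemma mplace_mul z1 z2 : O z1 -> O z2 -> mplace O (z1 * z2) ->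
  mplace O z1 \/ mplace O z2.
Proof.
move=> O1 O2 m12; have [m1|m1] := pselect (mplace O z1); [by left|right].
have z10 : z1 != 0 by apply/eqP => z10; apply: m1; left.
by rewrite -(mulKf z10 z2); apply: mplaceM => //; apply: place_unitV.
Qed.

Lemma mplace_uniq z a b : mplace O (z - iota a) -> mplace O (z - iota b) -> a = b.
Proof.
move=> ma mb; apply/eqP; rewrite -subr_eq0; apply/eqP/mplace_const.
suff -> : iota (a - b) = (z - iota b) - (z - iota a) by apply: mplaceB.
by rewrite rmorphB /=; ring.
Qed.

Lemma placeBC z a : O (z - iota a) -> O z.
Proof.
by move=> Oz; rewrite -[z](subrK (iota a)); apply: (placeD plO) => //; apply: (place_const plO).
Qed.

Lemma mplace_ev1 z a p : mplace O (z - iota a) ->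
  mplace O (ev1 iota z p - iota p.[a]).
Proof.
move=> mz; have Oz : O z := placeBC (mplaceW mz).
have /factor_theorem[r rE] : root (p - p.[a]%:P) a.
  by rewrite /root hornerD hornerN hornerC subrr.
rewrite -(ev1C iota z) -ev1B rE ev1M ev1_XsubC.
by apply: mplaceM => //; apply: place_ev1.
Qed.

(** The polynomial splits and the maximal ideal is prime, so some linear factor vanishes at the
    place. This is how a place acquires its coordinates. *)
Lemma mplace_root z p : O z -> p != 0 -> mplace O (ev1 iota z p) ->
  exists2 a, root p a & mplace O (z - iota a).
Proof.
move=> Oz p0; have [rs pE] := closed_field_poly_normal p.
have l0 : lead_coef p != 0 by rewrite lead_coef_eq0.
have -> : ev1 iota z p =
    iota (lead_coef p) * ev1 iota z (\prod_(a <- rs) ('X - a%:P)).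
  by rewrite {1}pE ev1Z.
case/mplace_mul; [exact: (place_const plO)|exact: place_ev1| |].
  by move/mplace_const/eqP; rewrite (negPf l0).
move=> mrs; suff [a ars ma] : exists2 a, a \in rs & mplace O (z - iota a).
  by exists a => //; rewrite pE rootZ // root_prod_XsubC.
elim: rs mrs {pE} => [|a rs IH]; first by rewrite big_nil ev1_1 => /mplace1.
rewrite big_cons ev1M ev1_XsubC => /mplace_mul[||ma|/IH[b brs mb]].
- by apply: placeB => //; apply: (place_const plO).
- exact: place_ev1.
- by exists a => //; rewrite mem_head.
- by exists b => //; rewrite inE brs orbT.
Qed.

End OnePlace.

Record subfield_pred (S : K -> Prop) : Prop := SubfieldPred {
  subfield_const : forall a, S (iota a);
  subfieldD : forall z1 z2, S z1 -> S z2 -> S (z1 + z2);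
  subfieldM : forall z1 z2, S z1 -> S z2 -> S (z1 * z2);
  subfieldV : forall z, S z -> S z^-1 }.

(** Quantifying over all subfields makes generation an induction principle on the elements of
    [K]. *)
Definition generates u v := forall S : K -> Prop,
  subfield_pred S -> S u -> S v -> forall z, S z.

Lemma generates_swap u v : generates u v -> generates v u.
Proof. by move=> g S sS Su Sv; apply: g. Qed.

Lemma generatesV u v : generates u v -> generates u^-1 v.
Proof. by move=> g S sS Su Sv; apply: g => //; rewrite -[u]invrK; apply: (subfieldV sS). Qed.

Lemma subfield_ev1 S z p : subfield_pred S -> S z -> S (ev1 iota z p).
Proof.
move=> sS Sz; elim/poly_ind: p => [|p a IH].
  by rewrite ev1_0 -(rmorph0 iota); apply: (subfield_const sS).
rewrite ev1D ev1M ev1X ev1C.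
by apply: (subfieldD sS); [apply: (subfieldM sS)|apply: (subfield_const sS)].
Qed.

Lemma subfield_ev2 S z1 z2 P : subfield_pred S -> S z1 -> S z2 -> S (ev2 iota z1 z2 P).
Proof.
move=> sS S1 S2; elim/poly_ind: P => [|P p IH].
  by rewrite ev2_0 -(rmorph0 iota); apply: (subfield_const sS).
by rewrite ev2D ev2M ev2X ev2C; apply: (subfieldD sS); [apply: (subfieldM sS)|apply: subfield_ev1].
Qed.

Lemma generates_fraction u v z : generates u v ->
  exists P Q, ev2 iota u v Q != 0 /\ z = ev2 iota u v P / ev2 iota u v Q.
Proof.
move=> g; apply: (g (fun z => exists P Q, ev2 iota u v Q != 0 /\
  z = ev2 iota u v P / ev2 iota u v Q)); first split.
- move=> a; exists a%:P%:P, 1; rewrite ev2_1 oner_eq0 ev2C ev1C; split=> //.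
  by rewrite divr1.
- move=> _ _ [P1 [Q1 [Q10 ->]]] [P2 [Q2 [Q20 ->]]].
  exists (P1 * Q2 + P2 * Q1), (Q1 * Q2); rewrite ev2D !ev2M mulf_neq0 //; split=> //.
  by rewrite addf_div.
- move=> _ _ [P1 [Q1 [Q10 ->]]] [P2 [Q2 [Q20 ->]]].
  exists (P1 * P2), (Q1 * Q2); rewrite !ev2M mulf_neq0 //; split=> //.
  by rewrite mulf_div.
- move=> _ [P [Q [Q0 ->]]]; have [P0|P0] := eqVneq (ev2 iota u v P) 0.
    exists 0, 1; rewrite ev2_1 ev2_0 oner_eq0 P0; split=> //.
    by rewrite !mul0r invr0.
  by exists Q, P; split=> //; rewrite invf_div.
- exists 'X%:P, 1; rewrite ev2_1 oner_eq0 ev2C ev1X; split=> //.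
  by rewrite divr1.
- exists 'X, 1; rewrite ev2_1 oner_eq0 ev2X; split=> //.
  by rewrite divr1.
Qed.

End Places.

(** * The affine curve in a chart *)

(** A nonzero constant derivative is coprime to [p], so [p] is separable. *)
Lemma roots_of_const_deriv (k : closedFieldType) (p : {poly k}) q (d : k) :
    size p = q.+1 -> d != 0 -> p^`() = d%:P ->
  exists rs : seq k, [/\ uniq rs, size rs = q,
    p = lead_coef p *: \prod_(b <- rs) ('X - b%:P) & forall b, root p b = (b \in rs)].
Proof.
move=> sp d0 dp; have [rs pE] := closed_field_poly_normal p.
have p0 : p != 0 by rewrite -size_poly_gt0 sp.
have l0 : lead_coef p != 0 by rewrite lead_coef_eq0.
exists rs; split=> //.
- rewrite -separable_prod_XsubC unlock; set r := \prod_(b <- rs) _.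
  have -> : r^`() = (d / lead_coef p) *: 1.
    rewrite mulrC -scalerA [d *: 1]alg_polyC -dp {2}pE derivZ scalerA.
    by rewrite mulVf // scale1r.
  by rewrite coprimepZr ?coprimep1 // mulf_neq0 ?invr_neq0.
- by move: sp; rewrite pE size_scale // size_prod_XsubC => -[].
- by move=> b; rewrite pE rootZ // root_prod_XsubC.
Qed.

Section ChartPoly.
Variables (k : fieldType) (B al ga : {poly k}).

Definition chart_poly : {poly {poly k}} := al *: map_poly polyC B + ga%:P.

Lemma ev2_chart_poly (L : comNzRingType) (f : {rmorphism k -> L}) x y :
  ev2 f x y chart_poly = ev1 f x al * ev1 f y B + ev1 f x ga.
Proof. by rewrite ev2D ev2Z ev2_lift ev2C. Qed.

Lemma size_chart_poly q : al != 0 -> (0 < q)%N -> size B = q.+1 -> size chart_poly = q.+1.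
Proof.
move=> al0 q0 sB.
have sA : size (al *: map_poly polyC B) = q.+1 by rewrite size_scale // size_map_polyC.
by rewrite size_polyDl sA // (leq_ltn_trans (size_polyC_leq1 _)) // ltnS.
Qed.

Lemma lead_coef_chart_poly q : al != 0 -> (0 < q)%N -> size B = q.+1 ->
  lead_coef chart_poly = lead_coef B *: al.
Proof.
move=> al0 q0 sB; rewrite lead_coefE (size_chart_poly al0 q0 sB) /= coefD coefZ.
by rewrite coef_map /= coefC gtn_eqF // addr0 mulrC mul_polyC lead_coefE sB.
Qed.

End ChartPoly.

Section Chart.
Variables (k : closedFieldType) (K : fieldType) (iota : {rmorphism k -> K}).
Variables (q : nat) (B al ga : {poly k}) (u v : K).

(** General [al] and [ga] let one theory serve both the affine curve, with [al] = A and [ga] = c,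
    and the chart (1/x, y) around the points with x infinite. [chart_indep] says that v has degree q
    over k(u), with denominators cleared. *)
Record chart : Prop := Chart {
  chart_size : size B = q.+1;
  chart_deriv : exists2 d, d != 0 & B^`() = d%:P;
  chart_al : al != 0;
  chart_eqn : ev1 iota u al * ev1 iota v B + ev1 iota u ga = 0;
  chart_indep : forall R : {poly {poly k}}, (size R <= q)%N -> ev2 iota u v R = 0 -> R = 0;
  chart_gen : generates iota u v }.

Hypothesis ch : chart.

Local Notation chart_poly := (chart_poly B al ga).

(** The condition on [al] guarantees q distinct points over a and makes u - a a local parameter at
    each of them. *)
Definition chart_point a b := al.[a] != 0 /\ al.[a] * B.[b] + ga.[a] = 0.

Lemma ev2_chart_poly_point a b : chart_point a b -> ev2 idfun a b chart_poly = 0.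
Proof. by case=> _ e; rewrite ev2_chart_poly !ev1_id. Qed.

Lemma ev2_chart_poly_eq0 : ev2 iota u v chart_poly = 0.
Proof. by rewrite ev2_chart_poly (chart_eqn ch). Qed.

Lemma chart_gt0 : (0 < q)%N.
Proof.
case: (chart_deriv ch) => d d0 dB; case: q (chart_size ch) => // sB.
move: dB; rewrite [B]size1_polyC ?sB // derivC => /polyC_inj/esym/eqP.
by rewrite (negPf d0).
Qed.

Let size_chart_poly : size chart_poly = q.+1.
Proof. exact: size_chart_poly (chart_al ch) chart_gt0 (chart_size ch). Qed.

Lemma lead_coefB_neq0 : lead_coef B != 0.
Proof. by rewrite lead_coef_eq0 -size_poly_gt0 (chart_size ch). Qed.

Lemma chart_transcendental p : ev1 iota u p = 0 -> p = 0.
Proof.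
move=> p0; apply/eqP; rewrite -polyC_eq0; apply/eqP; apply: (chart_indep ch).
  exact: leq_trans (size_polyC_leq1 _) chart_gt0.
by rewrite ev2C.
Qed.

Lemma ev1_eq0 p : (ev1 iota u p == 0) = (p == 0).
Proof. by apply/eqP/eqP => [/chart_transcendental //|->]; rewrite ev1_0. Qed.

(** Polynomials in u do not form a field, so division by the equation costs a power of its leading
    coefficient, a constant multiple of [al], which is nonzero at every chart point. *)
Lemma chart_pseudo_division P : exists n S (R : {poly {poly k}}), (size R <= q)%N /\
  (lead_coef B *: al) ^+ n *: P = S * chart_poly + R.
Proof.
exists (scalp P chart_poly), (P %/ chart_poly), (P %% chart_poly); split.
  by rewrite -ltnS -size_chart_poly Pdiv.Idomain.ltn_modp -size_poly_gt0 size_chart_poly.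
by rewrite -(lead_coef_chart_poly ga (chart_al ch) chart_gt0 (chart_size ch)) Pdiv.Idomain.divp_eq.
Qed.

(** A relation between u and v is a multiple of the equation up to a factor that is nonzero at the
    point. Hence evaluation at a chart point is well defined on functions. *)
Lemma ev2_point_eq0 P a b : ev2 iota u v P = 0 -> chart_point a b ->
  ev2 idfun a b P = 0.
Proof.
move=> P0 ptab; have [n [S [R [sR E]]]] := chart_pseudo_division P.
have R0 : R = 0.
  apply: (chart_indep ch) => //; have := congr1 (ev2 iota u v) E.
  by rewrite ev2Z P0 mulr0 ev2D ev2M ev2_chart_poly_eq0 mulr0 add0r.
have /eqP := congr1 (ev2 idfun a b) E.
rewrite R0 addr0 ev2M ev2_chart_poly_point // mulr0 ev2Z ev1Xn ev1_id hornerZ.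
rewrite mulf_eq0 => /orP[|/eqP //]; rewrite expf_eq0 mulf_eq0.
by rewrite (negPf lead_coefB_neq0) (negPf ptab.1) andbF.
Qed.

Lemma chart_roots a : al.[a] != 0 -> exists rs : seq k,
  [/\ uniq rs, size rs = q & forall b, (b \in rs) = (al.[a] * B.[b] + ga.[a] == 0)].
Proof.
move=> ala; have [d d0 dB] := chart_deriv ch.
pose p := al.[a] *: B + ga.[a]%:P.
have sp : size p = q.+1.
  have sA : size (al.[a] *: B) = q.+1 by rewrite size_scale // (chart_size ch).
  by rewrite size_polyDl sA // (leq_ltn_trans (size_polyC_leq1 _)) // ltnS chart_gt0.
have [||rs [Urs srs _ rsE]] := @roots_of_const_deriv _ p q (al.[a] * d) sp.
- by rewrite mulf_neq0.
- by rewrite derivD derivC addr0 derivZ dB polyCM mul_polyC.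
exists rs; split=> // b; rewrite -rsE /root /p.
by rewrite hornerD hornerZ hornerC.
Qed.

Lemma fiber_eq0_points a (R : {poly {poly k}}) : al.[a] != 0 -> (size R <= q)%N ->
  (forall b, chart_point a b -> ev2 idfun a b R = 0) -> fiber a R = 0.
Proof.
move=> ala sR R0; have [rs [Urs srs rsE]] := chart_roots ala.
apply: (@roots_geq_poly_eq0 _ _ rs) => //; last first.
  by rewrite srs (leq_trans (size_poly _ _)).
apply/allP => b; rewrite rsE => /eqP e.
by rewrite /root; apply/eqP/(R0 b).
Qed.

(** A Nullstellensatz for the chart: the remainder of [P] modulo the equation has degree less than q
    in v and vanishes at the q points over every a with al(a) nonzero, so its coefficients vanish at
    all these a. *)
Lemma ev2_eq0_points P : (forall a b, chart_point a b -> ev2 idfun a b P = 0) ->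
  ev2 iota u v P = 0.
Proof.
move=> P0; have [n [S [R [sR E]]]] := chart_pseudo_division P.
have R0 : R = 0.
  apply/polyP => i; rewrite coef0; apply/eqP/negPn/negP => Ri.
  have /closed_nonrootP[a] : R`_i * al != 0 by rewrite mulf_neq0 ?(chart_al ch).
  rewrite rootM negb_or => /andP[Ria ala].
  case/negP: Ria; rewrite /root -coef_fiber fiber_eq0_points ?coef0 // => b ptab.
  have := congr1 (ev2 idfun a b) E.
  by rewrite ev2Z P0 // mulr0 ev2D ev2M ev2_chart_poly_point // mulr0 add0r.
have /eqP := congr1 (ev2 iota u v) E.
rewrite R0 addr0 ev2M ev2_chart_poly_eq0 mulr0 ev2Z ev1Xn mulf_eq0 expf_eq0 => /orP[|/eqP//].
rewrite ev1_eq0 scaler_eq0 (negPf lead_coefB_neq0) (negPf (chart_al ch)).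
by rewrite andbF.
Qed.

(** A Bezout relation between [P] and the equation yields a multiple of [P] that is a polynomial in
    u; it plays the role of the norm from [K] to k(u). *)
Lemma chart_norm P : ev2 iota u v P != 0 -> exists N U,
  N != 0 /\ ev1 iota u N = ev2 iota u v U * ev2 iota u v P.
Proof.
move=> P0; have cop : coprimep P chart_poly.
  rewrite /coprimep; set G := gcdp P chart_poly.
  have /Pdiv.Idomain.dvdpP[[c1 S] /= c10 PE] : G %| P by apply: Pdiv.Idomain.dvdp_gcdl.
  have /Pdiv.Idomain.dvdpP[[c2 T] /= c20 FE] : G %| chart_poly by apply: Pdiv.Idomain.dvdp_gcdr.
  have G0 : ev2 iota u v G != 0.
    apply/eqP => G0; have := congr1 (ev2 iota u v) PE.
    rewrite ev2Z ev2M G0 mulr0 => /eqP.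
    by rewrite mulf_eq0 (negPf P0) ev1_eq0 (negPf c10).
  have Gn0 : G != 0 by apply: contraNneq G0 => ->; rewrite ev2_0.
  have T0 : T != 0.
    apply/eqP => T0; have := congr1 (size \o polyseq) FE.
    by rewrite /= T0 mul0r size_poly0 size_scale // size_chart_poly.
  (* The cofactor [T] vanishes at (u, v), so it has degree at least q in v, which leaves degree 0
     for the common factor [G]. *)
  have sT : (q < size T)%N.
    rewrite ltnNge; apply/negP => sT; case/negP: T0; apply/eqP.
    apply: (chart_indep ch) => //; have := congr1 (ev2 iota u v) FE.
    rewrite ev2Z ev2_chart_poly_eq0 mulr0 ev2M => /esym/eqP.
    by rewrite mulf_eq0 (negPf G0) orbF => /eqP.
  have := congr1 (size \o polyseq) FE.
  rewrite /= size_scale // size_chart_poly size_mul // => /esym e.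
  rewrite eqn_leq size_poly_gt0 Gn0 andbT; move: e sT.
  by case: (size G) => // n; lia.
have [[U V] /=] := Pdiv.Idomain.Bezout_coprimepP _ _ cop.
move=> /Pdiv.Idomain.eqpP[[c1 c2] /= /andP[c10 c20] E].
exists c2, (c1 *: U); split=> //; have := congr1 (ev2 iota u v) E.
rewrite !ev2Z ev2_1 mulr1 => <-.
by rewrite ev2D !ev2M ev2_chart_poly_eq0 mulr0 addr0 mulrA.
Qed.

Lemma chart_span z : exists d (S : {poly {poly k}}), [/\ d != 0, (size S <= q)%N &
  ev1 iota u d * z = ev2 iota u v S].
Proof.
have [P [Q [Q0 zE]]] := generates_fraction z (chart_gen ch).
have [N [U [N0 NE]]] := chart_norm Q0.
have [n [S [R [sR E]]]] := chart_pseudo_division (U * P).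
exists ((lead_coef B *: al) ^+ n * N), R; split=> //.
  by rewrite mulf_neq0 // expf_neq0 // scaler_eq0 (negPf lead_coefB_neq0) (chart_al ch).
have := congr1 (ev2 iota u v) E.
rewrite ev2Z ev2D !ev2M ev2_chart_poly_eq0 mulr0 add0r => <-.
by rewrite ev1M NE zE -!mulrA; congr (_ * (_ * _)); rewrite mulrC divfK.
Qed.

End Chart.

(** * Values and local rings at a point of a chart *)

Section ChartPoint.
Variables (k : closedFieldType) (K : fieldType) (iota : {rmorphism k -> K}).
Variables (q : nat) (B al ga : {poly k}) (u v : K).
Hypothesis ch : chart iota q B al ga u v.
Variables (a b : k).

(** The fraction P / Q is written without division, with Q nonzero at (a, b). It is a relation
    because a value exists only on the local ring; uniqueness comes from (a, b) lying on the chart,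
    see [value_uniq]. *)
Definition has_value (z : K) (w : k) := exists P Q : {poly {poly k}},
  [/\ ev2 idfun a b Q != 0, z * ev2 iota u v Q = ev2 iota u v P &
      w * ev2 idfun a b Q = ev2 idfun a b P].

Definition local_ring z := exists w, has_value z w.

Hypothesis pt : chart_point B al ga a b.

Lemma ev2_point_neq0 Q : ev2 idfun a b Q != 0 -> ev2 iota u v Q != 0.
Proof. by apply: contraNneq => /(ev2_point_eq0 ch) ->. Qed.

Lemma value_ev2 P : has_value (ev2 iota u v P) (ev2 idfun a b P).
Proof. by exists P, 1; rewrite !ev2_1 oner_eq0 !mulr1. Qed.

Lemma value_const c : has_value (iota c) c.
Proof. by have := value_ev2 c%:P%:P; rewrite !ev2C !ev1C. Qed.

Lemma value_ev1 p : has_value (ev1 iota u p) p.[a].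
Proof. by have := value_ev2 p%:P; rewrite !ev2C !ev1_id. Qed.

Lemma value_u : has_value u a.
Proof. by have := value_ev1 'X; rewrite ev1X hornerX. Qed.

Lemma value_v : has_value v b.
Proof. by have := value_ev2 'X; rewrite !ev2X. Qed.

Lemma valueD z1 z2 w1 w2 : has_value z1 w1 -> has_value z2 w2 ->
  has_value (z1 + z2) (w1 + w2).
Proof.
move=> [P1 [Q1 [Q10 E1 e1]]] [P2 [Q2 [Q20 E2 e2]]].
exists (P1 * Q2 + P2 * Q1), (Q1 * Q2).
rewrite !ev2D !ev2M mulf_neq0 // -E1 -e1 -E2 -e2; split=> //; ring.
Qed.

Lemma valueM z1 z2 w1 w2 : has_value z1 w1 -> has_value z2 w2 ->
  has_value (z1 * z2) (w1 * w2).
Proof.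
move=> [P1 [Q1 [Q10 E1 e1]]] [P2 [Q2 [Q20 E2 e2]]].
exists (P1 * P2), (Q1 * Q2).
rewrite !ev2M mulf_neq0 // -E1 -e1 -E2 -e2; split=> //; ring.
Qed.

Lemma valueV z w : has_value z w -> w != 0 -> has_value z^-1 w^-1.
Proof.
move=> [P [Q [Q0 E e]]] w0; exists Q, P.
have P0 : ev2 idfun a b P != 0 by rewrite -e mulf_neq0.
have z0 : z != 0.
  by apply: contraNneq (ev2_point_neq0 P0) => z0; rewrite -E z0 mul0r.
by rewrite -E -e !mulKf // mulf_neq0.
Qed.

Lemma value_uniq z w1 w2 : has_value z w1 -> has_value z w2 -> w1 = w2.
Proof.
move=> [P1 [Q1 [Q10 E1 e1]]] [P2 [Q2 [Q20 E2 e2]]].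
have : ev2 idfun a b (P1 * Q2 - P2 * Q1) = 0.
  apply: (ev2_point_eq0 ch) => //; rewrite ev2B !ev2M -E1 -E2; ring.
rewrite ev2B !ev2M -e1 -e2 => /eqP.
have -> : w1 * ev2 idfun a b Q1 * ev2 idfun a b Q2 -
    w2 * ev2 idfun a b Q2 * ev2 idfun a b Q1 =
    (w1 - w2) * (ev2 idfun a b Q1 * ev2 idfun a b Q2) by ring.
by rewrite mulf_eq0 mulf_eq0 (negPf Q10) (negPf Q20) !orbF subr_eq0 => /eqP.
Qed.

Lemma value_ev2_comp z1 z2 w1 w2 P : has_value z1 w1 -> has_value z2 w2 ->
  has_value (ev2 iota z1 z2 P) (ev2 idfun w1 w2 P).
Proof.
move=> h1 h2.
have hc p : has_value (ev1 iota z1 p) (ev1 idfun w1 p).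
  elim/poly_ind: p => [|p c IH].
    by rewrite !ev1_0 -(rmorph0 iota); apply: value_const.
  by rewrite !ev1D !ev1M !ev1X !ev1C; apply: valueD; [apply: valueM|apply: value_const].
elim/poly_ind: P => [|P p IH].
  by rewrite !ev2_0 -(rmorph0 iota); apply: value_const.
by rewrite !ev2D !ev2M !ev2X !ev2C; apply: valueD; [apply: valueM|].
Qed.

(* The curve is smooth at the point, and [u - a] is a local parameter. *)
Lemma value0_div z : has_value z 0 -> exists2 z1, local_ring z1 & z = (u - iota a) * z1.
Proof.
move=> [P [Q [Q0 E /esym]]]; rewrite mul0r => /ev2_id_eq0[P1 [P2 PE]].
have [al0 e0] := pt.
have [B1 B1E] : exists r, B - B.[b]%:P = r * ('X - b%:P).
  by apply/factor_theorem; rewrite /root hornerD hornerN hornerC subrr.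
have [g gE] : exists r, B.[b] *: al + ga = r * ('X - a%:P).
  by apply/factor_theorem; rewrite /root hornerD hornerZ mulrC e0.
have B1b : B1.[b] != 0.
  have [d d0 dB] := chart_deriv ch.
  have := congr1 (fun p : {poly k} => p^`().[b]) B1E.
  rewrite /= derivB derivC subr0 dB hornerC derivM derivXsubC.
  by rewrite hornerD hornerM hornerXsubC subrr mulr0 add0r mulr1 => <-.
(* As B1(b) = B'(b) is nonzero, [H] is a unit at the point, and the equation turns (v - b) [H] into
   a multiple of u - a. *)
pose H : {poly {poly k}} := al *: map_poly polyC B1.
have Hab : ev2 idfun a b H != 0 by rewrite ev2Z ev2_lift !ev1_id mulf_neq0.
have vE : (v - iota b) * ev2 iota u v H = - (u - iota a) * ev1 iota u g.
  have E1 := congr1 (ev1 iota v) B1E; have E2 := congr1 (ev1 iota u) gE.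
  rewrite ev1B ev1M ev1C ev1_XsubC in E1; rewrite ev1D ev1Z ev1M ev1_XsubC in E2.
  have E3 := chart_eqn ch; rewrite ev2Z ev2_lift.
  have -> : (v - iota b) * (ev1 iota u al * ev1 iota v B1) =
      ev1 iota u al * (ev1 iota v B1 * (v - iota b)) by ring.
  rewrite -E1 mulrBr mulNr [_ * ev1 iota u g]mulrC -E2.
  by rewrite opprD [iota _ * _]mulrC -(addr0_eq E3) opprK addrC.
exists (ev2 iota u v (P1 * H - P2 * g%:P) / ev2 iota u v (Q * H)).
  exists (ev2 idfun a b (P1 * H - P2 * g%:P) / ev2 idfun a b (Q * H)).
  apply: valueM; first exact: value_ev2.
  by apply: valueV; [exact: value_ev2|rewrite ev2M mulf_neq0].
have QH0 : ev2 iota u v (Q * H) != 0 by apply: ev2_point_neq0; rewrite ev2M mulf_neq0.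
rewrite mulrA; apply: canRL (mulfK QH0) _.
rewrite ev2M mulrA E PE ev2B ev2D !ev2M !ev2C !ev2B !ev2C !ev1_XsubC ev1C ev2X.
set t := u - iota a in vE *; set h := ev2 iota u v H in vE *.
transitivity (t * ev2 iota u v P1 * h + (v - iota b) * h * ev2 iota u v P2); first by ring.
by rewrite vE; ring.
Qed.

(** For z = P(u, v), a multiple of z in the local ring is its norm, t^m p(u) with t = u - a and p(a)
    nonzero; hence z can be divided by t at most m times before its value becomes nonzero. The
    second alternative describes poles without negative exponents. *)
Lemma local_order z : z != 0 -> exists n e w, [/\ has_value e w, w != 0 &
  z = (u - iota a) ^+ n * e \/ z * (u - iota a) ^+ n = e].
Proof.
pose t := u - iota a.
have t0 : t != 0.
  by rewrite /t -ev1_XsubC (ev1_eq0 ch) polyXsubC_eq0.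
have descent m p z1 z2 w : p.[a] != 0 -> has_value z1 w -> local_ring z2 ->
    z1 * z2 = t ^+ m * ev1 iota u p ->
    exists n e w, [/\ has_value e w, w != 0 & z1 = t ^+ n * e].
  elim: m z1 w => [|m IH] z1 w pa h1 [w2 h2] E.
    exists 0%N, z1, w; rewrite expr0 mul1r; split=> //.
    apply: contraNneq pa => w0; rewrite expr0 mul1r in E.
    have h12 := valueM h1 h2; rewrite E in h12.
    by rewrite -(value_uniq h12 (value_ev1 p)) w0 mul0r.
  have [w0|w0] := eqVneq w 0; last by exists 0%N, z1, w; rewrite expr0 mul1r.
  rewrite w0 in h1; have [z3 [w3 h3] z1E] := value0_div h1.
  have [||n [e [w' [he w'0 z3E]]]] := IH z3 w3 pa h3; first by exists w2.
    by apply: (mulfI t0); rewrite mulrA /t -z1E E exprS mulrA.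
  by exists n.+1, e, w'; rewrite exprS -mulrA -z3E.
have orderP P : ev2 iota u v P != 0 ->
    exists n e w, [/\ has_value e w, w != 0 & ev2 iota u v P = t ^+ n * e].
  move=> P0; have [N [U [N0 NE]]] := chart_norm ch P0.
  have [m [p /implyP/(_ N0) pa Np]] := multiplicity_XsubC N a.
  apply: (@descent m p _ (ev2 iota u v U)) (value_ev2 P) _ _; first exact: pa.
    by exists (ev2 idfun a b U); apply: value_ev2.
  by rewrite mulrC -NE Np ev1M ev1Xn ev1_XsubC mulrC.
move=> z0; have [P [Q [Q0 zE]]] := generates_fraction z (chart_gen ch).
have P0 : ev2 iota u v P != 0 by apply: contraNneq z0 => P0; rewrite zE P0 mul0r.
have [n1 [e1 [w1 [h1 w10 E1]]]] := orderP P P0.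
have [n2 [e2 [w2 [h2 w20 E2]]]] := orderP Q Q0.
have e0 e w : has_value e w -> w != 0 -> e != 0.
  move=> he; apply: contraNneq => ee; rewrite ee in he.
  by rewrite (value_uniq he (w2 := 0)) // -(rmorph0 iota); apply: value_const.
have [le|/ltnW le] := leqP n2 n1.
- exists (n1 - n2)%N, (e1 / e2), (w1 / w2); split; last left.
  + by apply: valueM => //; apply: valueV.
  + by rewrite mulf_neq0 // invr_neq0.
  rewrite zE E1 E2 -{1}(subnK le) exprD.
  by rewrite invfM mulrACA -!mulrA [t ^+ n2 * _]mulrA mulfV ?expf_neq0 // mul1r.
- exists (n2 - n1)%N, (e1 / e2), (w1 / w2); split; last right.
  + by apply: valueM => //; apply: valueV.
  + by rewrite mulf_neq0 // invr_neq0.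
  rewrite zE E1 E2 -{1}(subnK le) exprD.
  have := e0 _ _ h2 w20; have tn n : t ^+ n != 0 by rewrite expf_neq0.
  move: (tn (n2 - n1)%N) (tn n1); rewrite -/t => ? ? ?; field; exact/and3P.
Qed.

End ChartPoint.

(** * The place of a point of a chart *)

Section LocalPlace.
Variables (k : closedFieldType) (K : fieldType) (iota : {rmorphism k -> K}).
Variables (q : nat) (B al ga : {poly k}) (u v : K).
Hypothesis ch : chart iota q B al ga u v.
Variables (a b : k).
Hypothesis pt : chart_point B al ga a b.

Local Notation O := (local_ring iota u v a b).
Local Notation t := (u - iota a).

Lemma local_param_neq0 : t != 0.
Proof. by rewrite -ev1_XsubC (ev1_eq0 ch) polyXsubC_eq0. Qed.

Lemma value_param : has_value iota u v a b t 0.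
Proof.
rewrite -ev1_XsubC; have := value_ev1 iota u v a b ('X - a%:P).
by rewrite hornerXsubC subrr.
Qed.

Lemma value_paramX n : has_value iota u v a b (t ^+ n.+1) 0.
Proof.
elim: n => [|n IH]; first by rewrite expr1; apply: value_param.
by rewrite exprS -(mul0r 0); apply: valueM => //; apply: value_param.
Qed.

Lemma value_neq0 z w : has_value iota u v a b z w -> w != 0 -> z != 0.
Proof.
move=> h; apply: contraNneq => z0; rewrite z0 in h; apply/eqP.
apply: (value_uniq ch pt h); rewrite -(rmorph0 iota); exact: value_const.
Qed.

Lemma local_ringD z1 z2 : O z1 -> O z2 -> O (z1 + z2).
Proof. by move=> [w1 h1] [w2 h2]; exists (w1 + w2); apply: valueD. Qed.

Lemma local_ringM z1 z2 : O z1 -> O z2 -> O (z1 * z2).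
Proof. by move=> [w1 h1] [w2 h2]; exists (w1 * w2); apply: valueM. Qed.

Lemma local_place : place iota O.
Proof.
split.
- by move=> c; exists c; apply: value_const.
- exact: local_ringD.
- exact: local_ringM.
- have tO n : O (t ^+ n).
    case: n => [|n]; last by exists 0; apply: value_paramX.
    by exists 1; rewrite expr0 -(rmorph1 iota); apply: value_const.
  move=> z; have [->|z0] := eqVneq z 0.
    by left; exists 0; rewrite -(rmorph0 iota); apply: value_const.
  have [n [e [w [he w0 [->|E]]]]] := local_order ch pt z0; [left|right].
    by apply: local_ringM => //; exists w.
  have -> : z^-1 = t ^+ n * e^-1.
    by rewrite -E invfM mulrCA mulfV ?mulr1 // expf_neq0 // local_param_neq0.
  by apply: local_ringM => //; exists w^-1; apply: (valueV ch pt).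
- exists t^-1 => -[w h]; have := valueM value_param h.
  rewrite mulfV ?local_param_neq0 // mul0r => h0.
  have h1 := value_const iota u v a b 1; rewrite rmorph1 in h1.
  by have /eqP := value_uniq ch pt h1 h0; rewrite oner_eq0.
Qed.

Lemma mplace_localP z : mplace O z <-> has_value iota u v a b z 0.
Proof.
split=> [mz|h0].
  have [w h] := mplaceW local_place mz; case: (eqVneq w 0) => [<- //|w0].
  case: mz => [z0|[]]; first by move: (value_neq0 h w0); rewrite z0 eqxx.
  by exists w^-1; apply: (valueV ch pt).
have [->|z0] := eqVneq z 0; first by left.
right=> -[w h]; have := valueM h0 h; rewrite mulfV // mul0r => h2.
have h1 := value_const iota u v a b 1; rewrite rmorph1 in h1.
by have /eqP := value_uniq ch pt h1 h2; rewrite oner_eq0.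
Qed.

Lemma local_div z : mplace O z -> O (z / t).
Proof.
move=> /mplace_localP/(value0_div ch pt)[z1 O1 ->].
by rewrite mulrAC mulfV ?mul1r // local_param_neq0.
Qed.

(** Modulo the maximal ideal of [O'], every polynomial in u and v agrees with its value at (a, b),
    so the denominator of z is a unit of [O']. *)
Lemma center_has_value O' z w : place iota O' -> mplace O' t -> mplace O' (v - iota b) ->
  has_value iota u v a b z w -> mplace O' (z - iota w).
Proof.
move=> plO mu mv [P [Q [Q0 E e]]].
have hP (R : {poly {poly k}}) : mplace O' (ev2 iota u v R - iota (ev2 idfun a b R)).
  have [P1 [P2 RE]] : exists P1 P2, R - (ev2 idfun a b R)%:P%:P =
      ('X - a%:P)%:P * P1 + ('X - b%:P%:P) * P2.
    by apply: ev2_id_eq0; rewrite ev2B ev2C ev1C subrr.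
  have := congr1 (ev2 iota u v) RE.
  rewrite ev2B ev2C ev1C ev2D !ev2M ev2C ev1_XsubC ev2B ev2X ev2C ev1C => ->.
  have Ou := placeBC plO (mplaceW plO mu); have Ov := placeBC plO (mplaceW plO mv).
  by apply: (mplaceD plO); apply: (mplaceMr plO) => //; apply: (place_ev2 plO).
have QK0 := ev2_point_neq0 ch pt Q0.
have -> : z - iota w =
  ((ev2 iota u v P - iota (ev2 idfun a b P))
   - iota w * (ev2 iota u v Q - iota (ev2 idfun a b Q))) * (ev2 iota u v Q)^-1.
  by apply: canRL (mulfK QK0) _; rewrite mulrBl -e E rmorphM /=; ring.
apply: (mplaceMr plO).
  by apply: (mplaceB plO) => //; apply: (mplaceM plO) => //; apply: (place_const plO).
have OQ : O' (ev2 iota u v Q).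
  by apply: (placeBC plO (a := ev2 idfun a b Q)); apply: (mplaceW plO); apply: hP.
apply: place_unitV => //.
move=> mQ; case/eqP: Q0; apply: (mplace_const plO).
by rewrite -[iota _]opprK -[- iota _](addKr (ev2 iota u v Q)); apply/(mplaceN plO);
  rewrite addrC; apply: (mplaceB plO).
Qed.

(** A smooth point is the centre of only one place: an element outside the local ring is e / t^n
    with n > 0 and e of nonzero value, and if it were in [O'] then e would vanish at [O']. *)
Lemma center_place O' : place iota O' -> mplace O' t -> mplace O' (v - iota b) ->
  forall z, O' z <-> O z.
Proof.
move=> plO mu mv z; have cv z' w := @center_has_value O' z' w plO mu mv.
split=> [Oz|[w /cv/(mplaceW plO)/(placeBC plO)] //].
have [->|z0] := eqVneq z 0; first exact: (place0 local_place).
have [n [e [w [he w0 [->|E]]]]] := local_order ch pt z0.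
  apply: local_ringM; last by exists w.
  by apply: (placeXn local_place); exists 0; apply: value_param.
case: n E => [|n] E; first by exists w; rewrite -[z]mulr1 -(expr0 t) E.
have me : mplace O' e.
  rewrite -E; apply: (mplaceM plO) => //; rewrite exprS; apply: (mplaceMr plO) => //.
  exact/(placeXn plO)/(mplaceW plO).
case/eqP: w0; apply: (mplace_const plO).
rewrite -[iota w](subKr e); apply: (mplaceB plO) => //; exact: cv.
Qed.

End LocalPlace.

Section ChartRegular.
Variables (k : closedFieldType) (K : fieldType) (iota : {rmorphism k -> K}).
Variables (q : nat) (B al ga : {poly k}) (u v : K).
Hypothesis ch : chart iota q B al ga u v.

(** At a root a of the denominator, the numerator must vanish at the q points over a; being of
    degree less than q in v, it vanishes on the whole line u = a, so u - a can be cancelled. *)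
Lemma regular_fiber_eq0 a (d : {poly k}) (S : {poly {poly k}}) z :
    al.[a] != 0 -> d.[a] = 0 -> (size S <= q)%N ->
    ev1 iota u d * z = ev2 iota u v S ->
    (forall b, chart_point B al ga a b -> local_ring iota u v a b z) ->
  fiber a S = 0.
Proof.
move=> al0 da sS E reg; apply: (fiber_eq0_points ch) => // b pt.
have [w h] := reg b pt; have := valueM (value_ev1 iota u v a b d) h.
rewrite da mul0r E => h0; exact: (value_uniq ch pt (value_ev2 _ _ _ _ _ _)).
Qed.

End ChartRegular.

(** * Irreducibility and coordinates *)

(** What is retained of an additive polynomial of degree q = p^e: simple roots, no term of degree q
    - 1, and q at least 3. *)
Record admissible (k : fieldType) (q : nat) (A : {poly k}) : Prop := Admissible {
  adm_size : size A = q.+1;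
  adm_deriv : exists2 d, d != 0 & A^`() = d%:P;
  adm_coef : A`_q.-1 = 0;
  adm_gt2 : (2 < q)%N }.

Lemma adm_gt0 (k : fieldType) q (A : {poly k}) : admissible q A -> (0 < q)%N.
Proof. by move=> /adm_gt2/ltnW/ltnW. Qed.

Lemma adm_neq0 (k : fieldType) q (A : {poly k}) : admissible q A -> A != 0.
Proof. by move=> aA; rewrite -size_poly_gt0 (adm_size aA). Qed.

Lemma adm_root (k : closedFieldType) q (A : {poly k}) :
  admissible q A -> exists a, A.[a] = 0.
Proof.
move=> aA; have /closed_rootP[a /rootP ra] : size A != 1%N; last by exists a.
by rewrite (adm_size aA) eqSS gtn_eqF // (adm_gt0 aA).
Qed.

Section Eisenstein.
Variables (k : closedFieldType) (q : nat) (A B : {poly k}) (c a : k).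
Hypotheses (aA : admissible q A) (aB : admissible q B) (c0 : c != 0) (Aa : A.[a] = 0).

Local Notation f := (chart_poly B A c%:P).

Let lf : lead_coef f = lead_coef B *: A.
Proof. exact: lead_coef_chart_poly (adm_neq0 aA) (adm_gt0 aA) (adm_size aB). Qed.

Let sf : size f = q.+1.
Proof. exact: size_chart_poly (adm_neq0 aA) (adm_gt0 aA) (adm_size aB). Qed.

Lemma fiberM (P Q : {poly {poly k}}) : fiber a (P * Q) = fiber a P * fiber a Q.
Proof. exact: rmorphM. Qed.

Lemma fiberZ p (P : {poly {poly k}}) : fiber a (p *: P) = p.[a] *: fiber a P.
Proof. by apply/polyP => i; rewrite coef_fiber !coefZ coef_fiber hornerM. Qed.

(* Eisenstein's criterion at a root of the leading coefficient: modulo [X - a]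
   the polynomial is the nonzero constant [c]. *)
Lemma chart_poly_irreducible (l : {poly k}) (R S : {poly {poly k}}) :
  l != 0 -> l *: f = R * S -> (size R <= 1)%N \/ (size S <= 1)%N.
Proof.
have [n] := ubnP (size l); elim: n => // n IH in l R S *; rewrite ltnS => sl l0 E.
have Ea : (l.[a] * c)%:P = fiber a R * fiber a S.
  rewrite -fiberM -E fiberZ polyCM -mul_polyC; congr (_ * _).
  apply/polyP => i; rewrite coef_fiber coefD coefZ coef_map /= coefC.
  by rewrite hornerD hornerM Aa mul0r add0r coefC; case: eqP; rewrite hornerC.
(* If l(a) = 0 then X - a divides [R] or [S] and is cancelled, as in Gauss's lemma at the prime X -
   a. *)
have [la|la] := eqVneq l.[a] 0.
  have [l1 l1E] : exists r, l = ('X - a%:P) * r.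
    by have /factor_theorem[r ->] : root l a := introT eqP la; exists r; rewrite mulrC.
  have l10 : l1 != 0 by apply: contraNneq l0 => l10; rewrite l1E l10 mulr0.
  have sl1 : (size l1 < n)%N.
    by move: sl; rewrite l1E size_mul ?polyXsubC_eq0 // size_XsubC.
  have X0 : ('X - a%:P)%:P != 0 :> {poly {poly k}} by rewrite polyC_eq0 polyXsubC_eq0.
  have cancel Q1 Q2 (Q : {poly {poly k}}) : Q1 = ('X - a%:P)%:P * Q2 ->
      size Q1 = size Q2 by move=> ->; rewrite mul_polyC size_scale // polyXsubC_eq0.
  move/eqP: Ea; rewrite la mul0r polyC0 eq_sym mulf_eq0 => /orP[] /eqP/fiber_eq0[Q QE].
    rewrite (cancel _ _ 0 QE); apply: (IH l1) => //; apply: (mulfI X0).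
    by rewrite mulrA -QE -E l1E -scalerA mul_polyC.
  rewrite (cancel _ _ 0 QE); apply: (IH l1) => //; apply: (mulfI X0).
  by rewrite mulrCA -QE -E l1E -scalerA mul_polyC.
have lc0 : l.[a] * c != 0 by rewrite mulf_neq0.
apply/orP; apply: contraT; rewrite negb_or -!ltnNge => /andP[sR sS].
have {Ea} [sRa sSa] : size (fiber a R) = 1%N /\ size (fiber a S) = 1%N.
  have := congr1 (fun p : {poly k} => size p) Ea; rewrite /= size_polyC lc0 /=.
  have nz : fiber a R * fiber a S != 0 by rewrite -Ea polyC_eq0.
  have Ra0 : fiber a R != 0 by apply: contraNneq nz => ->; rewrite mul0r.
  have Sa0 : fiber a S != 0 by apply: contraNneq nz => ->; rewrite mulr0.
  rewrite size_mul //; move: Ra0 Sa0; rewrite -!size_poly_gt0.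
  have sz1 m m' : (0 < m)%N -> (0 < m')%N -> 1%N = (m + m').-1 -> m = 1%N /\ m' = 1%N.
    by lia.
  by move=> R1 S1 /sz1[].
(* Both leading coefficients vanish at a, so a is a multiple root of [l] times [A]; this contradicts
   l(a) and A'(a) being nonzero. *)
have lead0 (Q : {poly {poly k}}) : (1 < size Q)%N -> size (fiber a Q) = 1%N ->
    (lead_coef Q).[a] = 0.
  move=> sQ sQa; rewrite lead_coefE -coef_fiber nth_default // sQa.
  by case: (size Q) sQ => [|[]].
have lE : l * (lead_coef B *: A) = lead_coef R * lead_coef S.
  by rewrite -lf -lead_coefM -E lead_coefZ.
have [d d0 dA] := adm_deriv aA.
have := congr1 (fun p : {poly k} => p^`().[a]) lE.
rewrite /= !derivM derivZ dA. rewrite !hornerD !hornerM !hornerZ hornerC Aa. rewrite !lead0 //.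
rewrite mulr0 mul0r !mulr0 add0r addr0 => /eqP.
rewrite !mulf_eq0 (negPf la) (negPf d0) lead_coef_eq0 -size_poly_eq0 (adm_size aB).
by [].
Qed.

End Eisenstein.

Section Coordinates.
Variables (k : closedFieldType) (K : fieldType) (iota : {rmorphism k -> K}) (q : nat).

Record coordinates (A B : {poly k}) (c : k) (x y : K) : Prop := Coordinates {
  coord_eqn : ev1 iota x A * ev1 iota y B + iota c = 0;
  coord_tr : forall p, ev1 iota x p = 0 -> p = 0;
  coord_gen : generates iota x y }.

Variables (A B : {poly k}) (c : k) (x y : K).
Hypotheses (aA : admissible q A) (aB : admissible q B) (c0 : c != 0).

(** If y were algebraic, it would be a constant b; by transcendence of x the polynomial B(b) A + c
    would be zero, although its value at a root of A is c. *)
Lemma coordinates_swap : coordinates A B c x y -> coordinates B A c y x.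
Proof.
case=> e tr g; split; [by rewrite mulrC| |exact: generates_swap].
move=> p py; apply/eqP/negPn/negP => p0.
have [b yb] := ev1_root p0 py.
have E : B.[b] *: A + c%:P = 0.
  by apply: tr; rewrite ev1D ev1Z ev1C -e yb ev1_rmorph mulrC.
have [a Aa] := adm_root aA; have := congr1 (horner^~ a) E.
by rewrite hornerD hornerZ Aa mulr0 add0r hornerC horner0 => /eqP; rewrite (negPf c0).
Qed.

Hypothesis co : coordinates A B c x y.

(** A nonzero relation [Q] of least degree in y divides the equation up to a factor in x. By
    irreducibility the quotient has degree 0 in y, so [Q] has degree q. *)
Lemma coord_indep (R : {poly {poly k}}) : (size R <= q)%N -> ev2 iota x y R = 0 -> R = 0.
Proof.
move=> sR R0; apply/eqP/negPn/negP => Rn0.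
pose P n := `[< exists Q : {poly {poly k}}, [/\ Q != 0, ev2 iota x y Q = 0 & size Q = n] >].
have exP : exists n, P n by exists (size R); apply/asboolP; exists R.
case: (ex_minnP exP) => n /asboolP[Q [Q0 Qxy sQ]] minQ.
have sQq : (size Q <= q)%N.
  by rewrite sQ; apply: leq_trans sR; apply: minQ; apply/asboolP; exists R.
have sQ1 : (1 < size Q)%N.
  rewrite ltnNge; apply/negP => /size1_polyC QE; move: Qxy; rewrite QE ev2C.
  by move/(coord_tr co) => Q00; move: Q0; rewrite QE Q00 eqxx.
pose f := chart_poly B A c%:P.
have fxy : ev2 iota x y f = 0 by rewrite ev2_chart_poly ev1C (coord_eqn co).
have E := Pdiv.Idomain.divp_eq f Q.
have T0 : f %% Q = 0.
  apply/eqP/negPn/negP => T0.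
  have : (n <= size (f %% Q)%R)%N.
    apply: minQ; apply/asboolP; exists (f %% Q); split=> //.
    have := congr1 (ev2 iota x y) E.
    by rewrite ev2Z fxy mulr0 ev2D ev2M Qxy mulr0 add0r.
  by rewrite leqNgt -sQ Pdiv.Idomain.ltn_modp Q0.
have [a Aa] := adm_root aA; rewrite T0 addr0 in E.
have l0 : lead_coef Q ^+ scalp f Q != 0 by rewrite expf_neq0 // lead_coef_eq0.
have sf : size f = q.+1 := size_chart_poly _ (adm_neq0 aA) (adm_gt0 aA) (adm_size aB).
have [s1|] := chart_poly_irreducible aA aB c0 Aa l0 E; last by rewrite leqNgt sQ1.
have := congr1 (fun p : {poly {poly k}} => size p) E.
rewrite /= size_scale // -/f sf => e.
have := size_polyMleq (f %/ Q) Q; rewrite -e; move: sQq s1.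
have hn m n' : (n' <= q)%N -> (m <= 1)%N -> (q < (m + n').-1)%N -> False by lia.
by move=> h1 h2 h3; apply: (hn _ _ h1 h2 h3).
Qed.

Lemma coord_chart : chart iota q B A c%:P x y.
Proof.
split; [exact: adm_size aB|exact: adm_deriv aB|exact: adm_neq0 aA| | |exact: coord_gen co].
  by rewrite ev1C (coord_eqn co).
exact: coord_indep.
Qed.

End Coordinates.

(** * Points at infinity *)

Section Reversal.
Variable k : fieldType.

(** The reciprocal polynomial X^m p(1/X), where m may exceed the degree of [p]. *)
Definition rev_poly m (p : {poly k}) : {poly k} := \poly_(i < m.+1) p`_(m - i).

Lemma ev1_wide (L : comNzRingType) (f : {rmorphism k -> L}) x (p : {poly k}) n :
  (size p <= n)%N -> ev1 f x p = \sum_(i < n) f p`_i * x ^+ i.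
Proof.
move=> sp; rewrite /ev1 (@horner_coef_wide _ n) ?(leq_trans (size_poly _ _) sp) //.
by apply: eq_bigr => i _; rewrite coef_map.
Qed.

Lemma ev1_rev_poly (L : fieldType) (f : {rmorphism k -> L}) x (p : {poly k}) m :
  x != 0 -> (size p <= m.+1)%N -> ev1 f x^-1 (rev_poly m p) = x ^- m * ev1 f x p.
Proof.
move=> x0 sp; rewrite (ev1_wide _ _ sp) (ev1_wide _ _ (size_poly _ _)).
rewrite (reindex_inj rev_ord_inj) mulr_sumr; apply: eq_bigr => i _ /=.
have lim : (i <= m)%N by rewrite -ltnS.
rewrite subSS coef_poly ltnS leq_subr subKn // mulrCA; congr (_ * _).
have e : x ^+ m = x ^+ (m - i) * x ^+ i by rewrite -exprD subnK.
by rewrite exprVn e invfM mulfVK // expf_neq0.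
Qed.

Lemma rev_poly0 m (p : {poly k}) : (rev_poly m p).[0] = p`_m.
Proof. by rewrite horner_coef0 coef_poly /= subn0. Qed.

Lemma rev_polyK m (p : {poly k}) : (size p <= m.+1)%N -> rev_poly m (rev_poly m p) = p.
Proof.
move=> sp; apply/polyP => i; rewrite coef_poly; case: ltnP => [|im].
  by rewrite ltnS => im; rewrite coef_poly ltnS leq_subr subKn.
by rewrite nth_default // (leq_trans sp).
Qed.

Lemma rev_poly_eq0 m (p : {poly k}) : (size p <= m.+1)%N -> rev_poly m p = 0 -> p = 0.
Proof.
move=> sp r0; rewrite -(rev_polyK sp) r0.
by apply/polyP => i; rewrite coef_poly !coef0 if_same.
Qed.

Definition rev_poly2 m q (P : {poly {poly k}}) : {poly {poly k}} :=
  \poly_(j < q) rev_poly m P`_j.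

Lemma ev2_rev_poly2 (L : fieldType) (f : {rmorphism k -> L}) x y
    (P : {poly {poly k}}) m q :
    x != 0 -> (size P <= q)%N -> (forall j, size (P`_j)%R <= m.+1)%N ->
  ev2 f x^-1 y (rev_poly2 m q P) = x ^- m * ev2 f x y P.
Proof.
move=> x0 sP sj; rewrite (ev2_sum _ _ _ sP) (ev2_sum _ _ _ (size_poly _ _)).
rewrite mulr_sumr; apply: eq_bigr => j _.
by rewrite coef_poly ltn_ord ev1_rev_poly // mulrA.
Qed.

Lemma coef_size_bound (P : {poly {poly k}}) : exists m, forall j, (size (P`_j)%R <= m.+1)%N.
Proof.
exists (\max_(j < size P) size (P`_j)%R) => j; case: (ltnP j (size P)) => jP.
  by apply: leqW; apply: (leq_bigmax (Ordinal jP)).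
by rewrite nth_default // size_poly0.
Qed.

End Reversal.

Section Infinity.
Variables (k : closedFieldType) (K : fieldType) (iota : {rmorphism k -> K}) (q : nat).
Variables (A B : {poly k}) (c : k) (x y : K).
Hypotheses (aA : admissible q A) (aB : admissible q B) (c0 : c != 0).
Hypothesis co : coordinates iota A B c x y.

Let ch := coord_chart aA aB c0 co.

Lemma coord_x_neq0 : x != 0.
Proof. by rewrite -(ev1X iota x) (ev1_eq0 ch) polyX_eq0. Qed.

(** The equation divided by x^q, in terms of u = 1/x. *)
Lemma chart_infinity : chart iota q B (rev_poly q A) (c *: 'X^q) x^-1 y.
Proof.
have x0 := coord_x_neq0; have sA : (size A <= q.+1)%N by rewrite (adm_size aA).
split; [exact: adm_size aB|exact: adm_deriv aB| | | |exact: generatesV (coord_gen co)].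
- by apply: contraNneq (adm_neq0 aA) => /(rev_poly_eq0 sA) ->.
- rewrite ev1_rev_poly // ev1Z ev1Xn ev1X exprVn -mulrA [iota c * _]mulrC -mulrDr.
  by rewrite (coord_eqn co) mulr0.
move=> R sR R0; have [m sm] := coef_size_bound R.
have E : ev2 iota x y (rev_poly2 m q R) = 0.
  by rewrite -[x]invrK ev2_rev_poly2 ?invr_eq0 // R0 mulr0.
have /polyP R'0 := chart_indep ch (size_poly _ _) E.
apply/polyP => j; rewrite coef0; case: (ltnP j q) => jq; last first.
  by rewrite nth_default // (leq_trans sR).
by apply: (rev_poly_eq0 (sm j)); have := R'0 j; rewrite coef_poly jq coef0.
Qed.

Lemma infinity_point b : B.[b] = 0 -> chart_point B (rev_poly q A) (c *: 'X^q) 0 b.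
Proof.
move=> Bb; split; last first.
  by rewrite Bb mulr0 add0r hornerZ hornerXn expr0n gtn_eqF ?mulr0 // (adm_gt0 aA).
by rewrite rev_poly0 -[q]/(q.+1.-1) -(adm_size aA) -lead_coefE lead_coef_eq0 (adm_neq0 aA).
Qed.

Lemma degree_at_infinity r (T : {poly {poly k}}) : (size T <= q)%N ->
    (forall b, B.[b] = 0 -> local_ring iota x^-1 y 0 b (x ^- r * ev2 iota x y T)) ->
  forall j, (size (T`_j)%R <= r.+1)%N.
Proof.
move=> sT reg; have [m] := coef_size_bound T.
elim: m => [|m IH] sm; first by move=> j; apply: leq_trans (sm j) _.
have [rm j|mr] := leqP m.+1 r; first exact: leq_trans (sm j) _.
apply: IH => j; have x0 := coord_x_neq0.
have E : ev1 iota x^-1 'X^(m.+1 - r) * (x ^- r * ev2 iota x y T) =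
    ev2 iota x^-1 y (rev_poly2 m.+1 q T).
  rewrite ev2_rev_poly2 // ev1Xn ev1X exprVn mulrA -invfM -exprD subnK //.
  exact: ltnW.
have F : fiber 0 (rev_poly2 m.+1 q T) = 0.
  apply: (regular_fiber_eq0 chart_infinity _ _ (size_poly _ _) E).
  - by have [b Bb] := adm_root aB; have [] := infinity_point Bb.
  - by rewrite hornerXn expr0n subn_eq0 leqNgt mr.
  move=> b [_]; rewrite hornerZ hornerXn expr0n gtn_eqF ?(adm_gt0 aA) // mulr0 addr0.
  move=> /eqP; rewrite mulf_eq0 rev_poly0 => /orP[/eqP A0|/eqP/reg //].
  have := adm_neq0 aA; rewrite -lead_coef_eq0 lead_coefE (adm_size aA).
  by rewrite A0 eqxx.
case: (ltnP j q) => jq; last by rewrite nth_default ?size_poly0 // (leq_trans sT).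
have := congr1 (fun p : {poly k} => p`_j) F.
rewrite coef_fiber coef_poly jq rev_poly0 coef0 => Tjm.
move: (sm j); rewrite leq_eqVlt => /orP[/eqP sTj|]; last by rewrite ltnS.
have : lead_coef T`_j = 0 by rewrite lead_coefE sTj.
by move/eqP; rewrite lead_coef_eq0 => /eqP ->; rewrite size_poly0.
Qed.

(** * Total ramification over the roots of A *)

Section Ramification.
Variables (O : K -> Prop) (a : k).
Hypotheses (plO : place iota O) (Aa : A.[a] = 0) (mx : mplace O (x - iota a))
  (my : mplace O y^-1).

Let Ox : O x := placeBC plO (mplaceW plO mx).
Let Oy : O y^-1 := mplaceW plO my.

Lemma coord_y_neq0 : y != 0.
Proof.
apply/eqP => y0; have := chart_indep ch (R := 'X).
rewrite size_polyX ev2X y0 => /(_ (ltnW (adm_gt2 aA)) erefl)/eqP.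
by rewrite polyX_eq0.
Qed.

(* [y^-1] is a local parameter at [O], and [x - a] vanishes there to order [q]. *)
Lemma ramification : exists e, [/\ O e, ~ mplace O e & ev1 iota x A = e * y ^- q].
Proof.
have y0 := coord_y_neq0.
pose h := ev1 iota y^-1 (rev_poly q B).
have Oh : O h by apply: (place_ev1 plO).
have hE : h = y ^- q * ev1 iota y B by rewrite /h ev1_rev_poly // (adm_size aB).
have uh : ~ mplace O h.
  move=> mh; have my0 : mplace O (y^-1 - iota 0) by rewrite rmorph0 subr0.
  have := mplaceB plO mh (mplace_ev1 plO (rev_poly q B) my0).
  rewrite opprB addrC subrK => /(mplace_const plO)/eqP; rewrite rev_poly0.
  by rewrite -[q]/(q.+1.-1) -(adm_size aB) -lead_coefE lead_coef_eq0 (negPf (adm_neq0 aB)).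
have h0 : h != 0 by apply/eqP => h0; apply: uh; left.
exists (- iota c * h^-1); split.
- apply: (placeM plO); last exact: place_unitV.
  by apply/(placeN plO)/(place_const plO).
- move=> m; apply: (mplace_unit plO _ m (z2 := - iota c^-1 * h)).
    by rewrite fmorphV mulrACA mulrNN mulfV ?fmorph_eq0 // mul1r mulVf.
  by apply: (placeM plO) => //; apply/(placeN plO)/(place_const plO).
have /eqP := coord_eqn co; rewrite addr_eq0 => /eqP E.
have By : ev1 iota y B != 0 by apply: contraNneq h0 => By; rewrite hE By mulr0.
by rewrite hE -E invfM invrK; field; rewrite By expf_neq0.
Qed.

(** Since a is a simple root of A, any polynomial in x vanishing at a is a regular multiple of
    A(x). *)
Lemma ramification_order (p : {poly k}) : p.[a] = 0 ->
  exists2 e, O e & ev1 iota x p = e * y ^- q.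
Proof.
move=> pa; have [e [Oe _ E]] := ramification.
have [A1 A1E] : exists r, A = r * ('X - a%:P) by apply/factor_theorem; rewrite /root Aa.
have [r ->] : exists r, p = r * ('X - a%:P) by apply/factor_theorem; rewrite /root pa.
have A1a : A1.[a] != 0.
  have [d d0 dA] := adm_deriv aA; have := congr1 (fun p : {poly k} => p^`().[a]) A1E.
  rewrite /= dA hornerC derivM derivXsubC hornerD hornerM hornerXsubC subrr mulr0 add0r.
  by rewrite mulr1 => <-.
have u1 : ~ mplace O (ev1 iota x A1).
  move=> m1; have := mplaceB plO m1 (mplace_ev1 plO A1 mx).
  by rewrite opprB addrC subrK => /(mplace_const plO)/eqP; rewrite (negPf A1a).
have n1 : ev1 iota x A1 != 0 by apply/eqP => z1; apply: u1; left.
exists (ev1 iota x r * ((ev1 iota x A1)^-1 * e)).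
  apply: (placeM plO); first exact: (place_ev1 plO).
  by apply: (placeM plO) => //; apply: place_unitV => //; apply: (place_ev1 plO).
rewrite ev1M ev1_XsubC -!mulrA -E A1E ev1M ev1_XsubC; congr (_ * _).
by rewrite mulrA mulVf ?mul1r.
Qed.

Let vanish (p : {poly k}) : mplace O (ev1 iota x p) -> p.[a] = 0.
Proof.
move=> mp; apply: (mplace_const plO); rewrite -[iota _](subKr (ev1 iota x p)).
by apply: (mplaceB plO) => //; apply: (mplace_ev1 plO).
Qed.

Let yVM n m : (m <= n)%N -> y ^- n * y ^+ m = y ^- (n - m).
Proof.
move=> mn; have y0 := coord_y_neq0; rewrite -{1}(subnK mn) exprD invfM -mulrA.
by rewrite mulVf ?mulr1 // expf_neq0.
Qed.

(** If M_j(a) is nonzero, the term of index j has a pole of order exactly j + 1; otherwise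
    [ramification_order] makes it regular, because j + 1 < q. So the terms are removed from the top
    without any cancellation between poles. *)
Lemma ramified_sum n (M : nat -> {poly k}) : (n < q)%N ->
    O (\sum_(j < n) ev1 iota x (M j) * y ^+ j.+1) ->
  forall j, (j < n)%N -> (M j).[a] = 0.
Proof.
elim: n => // n IH nq; rewrite big_ord_recr /= => OS.
have y0 := coord_y_neq0.
have OyX m : O (y ^- m) by rewrite -exprVn; apply: (placeXn plO).
have myX m : mplace O (y ^- m.+1).
  by rewrite -exprVn exprS; apply: (mplaceMr plO) => //; apply: (placeXn plO).
have Mn : (M n).[a] = 0.
  apply: vanish.
  set S := \sum_(j < n) _ in OS.
  have mS : mplace O (y ^- n.+1 * S).
    rewrite mulr_sumr; elim/big_ind: _ => [|z1 z2|i _]; first exact: mplace0.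
      exact: (mplaceD plO).
    rewrite mulrCA; apply: (mplaceM plO); first exact: (place_ev1 plO).
    by rewrite yVM ?ltnS 1?ltnW // subSS; have := ltn_ord i; rewrite -subn_gt0;
       case: (n - i)%N.
  have := mplaceB plO (mplaceMr plO (myX n) OS) mS.
  by rewrite mulrDr addrAC subrr add0r mulrCA yVM // subnn expr0 invr1 mulr1.
have [e Oe E] := ramification_order Mn.
have OT : O (ev1 iota x (M n) * y ^+ n.+1).
  by rewrite E -mulrA yVM ?(ltnW nq) //; apply: (placeM plO).
move=> j; rewrite ltnS leq_eqVlt => /orP[/eqP -> //|]; apply: IH; first exact: ltnW.
by have := placeB plO OS OT; rewrite addrK.
Qed.

(** The counterpart of [regular_fiber_eq0] at a root of A. Here D(x) has order at least q and A(x) y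
    M has positive order, M having degree at most q - 2 in y; so s(a) = 0, hence s(x) also has order
    at least q. Dividing by A(x) then shows y M to be regular, and [ramified_sum] applies. *)
Lemma ramified_vanishing (D s : {poly k}) (M : {poly {poly k}}) z :
    D.[a] = 0 -> (size M < q)%N -> O z ->
    ev1 iota x D * z = ev1 iota x s + ev1 iota x A * (y * ev2 iota x y M) ->
  s.[a] = 0 /\ fiber a M = 0.
Proof.
move=> Da sM Oz E; have y0 := coord_y_neq0.
have [e [Oe ue AE]] := ramification.
have [eD OeD DE] := ramification_order Da.
have e0 : e != 0 by apply/eqP => e0; apply: ue; left.
pose W := \sum_(j < size M) ev1 iota x M`_j * y ^+ j.+1.
have WE : y * ev2 iota x y M = W.
  rewrite (ev2_sum _ _ _ (leqnn _)) mulr_sumr; apply: eq_bigr => j _.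
  by rewrite mulrCA -exprS.
rewrite WE in E.
have myX m : mplace O (y ^- m.+1).
  rewrite -exprVn exprS; apply: (mplaceMr plO) => //; exact: (placeXn plO).
have myq : mplace O (y ^- q) by case: (q) (adm_gt0 aA).
have mW : mplace O (y ^- q * W).
  rewrite mulr_sumr; elim/big_ind: _ => [|z1 z2|i _]; first exact: mplace0.
    exact: (mplaceD plO).
  have iq : (i.+1 < q)%N by apply: leq_ltn_trans sM.
  rewrite mulrCA; apply: (mplaceM plO); first exact: (place_ev1 plO).
  by rewrite yVM 1?ltnW //; move: iq; rewrite -subn_gt0; case: (q - i.+1)%N.
have sa : s.[a] = 0.
  apply: vanish; have -> : ev1 iota x s = ev1 iota x D * z - e * (y ^- q * W).
    by rewrite E AE; ring.
  apply: (mplaceB plO); last exact: (mplaceM plO).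
  by apply: (mplaceMr plO) => //; rewrite DE; apply: (mplaceM plO).
have [es Oes sE] := ramification_order sa.
have OW : O W.
  have -> : W = e^-1 * (eD * z - es).
    have yq : y ^+ q != 0 by rewrite expf_neq0.
    apply: (mulfI e0); rewrite mulVKf //; apply: (mulIf (invr_neq0 yq)).
    have := E; rewrite AE DE sE => E'.
    have -> : (eD * z - es) * y ^- q = eD * y ^- q * z - es * y ^- q by ring.
    by rewrite E'; ring.
  apply: (placeM plO); first exact: place_unitV.
  by apply: (placeB plO) => //; apply: (placeM plO).
split=> //; apply/polyP => j; rewrite coef_fiber coef0.
case: (ltnP j (size M)) => jM; last by rewrite nth_default // horner0.
exact: (ramified_sum (n := size M) sM OW).
Qed.

End Ramification.

(** The factor A(x) of the y-part reflects regularity at the points with x a root of A and y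
    infinite: it vanishes there to order q and absorbs the poles of y^j for j < q. *)
Lemma regular_form z :
    (forall a b, chart_point B A c%:P a b -> local_ring iota x y a b z) ->
    (forall a, A.[a] = 0 -> exists O, [/\ place iota O, mplace O (x - iota a),
       mplace O y^-1 & O z]) ->
  exists s (M : {poly {poly k}}), (size M < q)%N /\
    z = ev1 iota x s + ev1 iota x A * (y * ev2 iota x y M).
Proof.
move=> regf regi.
have [d [S [d0 sS E0]]] := chart_span ch z.
suff strip n (D s : {poly k}) (M : {poly {poly k}}) : (size D <= n)%N -> D != 0 ->
    (size M < q)%N ->
    ev1 iota x D * z = ev1 iota x s + ev1 iota x A * (y * ev2 iota x y M) ->
    exists s (M : {poly {poly k}}), (size M < q)%N /\
      z = ev1 iota x s + ev1 iota x A * (y * ev2 iota x y M).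
  have q0 := adm_gt0 aA.
  pose M := \poly_(j < q.-1) S`_j.+1.
  have sM : (size M < q)%N by rewrite -[q]prednK // ltnS size_poly.
  (* Multiplying numerator and denominator by [A] gives the y-part its factor [A]; the roots thereby
     added to the denominator are cancelled with the others. *)
  apply: (strip _ (A * d) (A * S`_0) M (leqnn _)) => //.
    by rewrite mulf_neq0 // (adm_neq0 aA).
  rewrite !ev1M -mulrA E0 -mulrDr; congr (_ * _).
  have sS' : (size S <= q.-1.+1)%N by rewrite prednK.
  rewrite (ev2_sum _ _ _ sS') (ev2_sum _ _ _ (size_poly _ _)) big_ord_recl.
  rewrite expr0 mulr1; congr (_ + _).
  rewrite mulr_sumr; apply: eq_bigr => j _; rewrite coef_poly ltn_ord.
  by rewrite mulrCA -exprS.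
elim: n D s M => [|n IH] D s M sD D0 sM E.
  by move: D0; rewrite -size_poly_gt0 ltnNge sD.
have [/size1_polyC De|sD1] := leqP (size D) 1%N.
  have d00 : D`_0 != 0 by rewrite -polyC_eq0 -De.
  have i0 : iota D`_0 != 0 by rewrite fmorph_eq0.
  exists ((D`_0)^-1 *: s), ((D`_0)^-1%:P *: M); split.
    by rewrite size_scale // polyC_eq0 invr_eq0.
  apply: (mulfI i0); rewrite -[iota _ in LHS](ev1C iota x) -De E.
  by rewrite ev1Z ev2Z ev1C fmorphV; field.
have [a /rootP Da] : exists a, root D a.
  by apply/closed_rootP; rewrite gtn_eqF.
have [sa Ma] : s.[a] = 0 /\ fiber a M = 0.
  have [Aa|Aa] := eqVneq A.[a] 0.
    have [O [plO mx my Oz]] := regi a Aa.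
    exact: (ramified_vanishing plO Aa mx my Da sM Oz E).
  pose T : {poly {poly k}} := s%:P + A *: ('X * M).
  have sT : (size T <= q)%N.
    rewrite (leq_trans (size_polyD _ _)) // geq_max.
    rewrite (leq_trans (size_polyC_leq1 _)) ?(adm_gt0 aA) //=.
    rewrite (leq_trans (size_scale_leq _ _)) // (leq_trans (size_polyMleq _ _)) //.
    by rewrite size_polyX.
  have E' : ev1 iota x D * z = ev2 iota x y T.
    by rewrite E ev2D ev2C ev2Z ev2M ev2X.
  have F := regular_fiber_eq0 ch Aa Da sT E' (regf a).
  have TE j : (fiber a T)`_j = 0 by rewrite F coef0.
  split.
    by have := TE 0%N; rewrite coef_fiber coefD coefC coefZ coefXM /= mulr0 addr0.
  apply/polyP => j; rewrite coef0; have := TE j.+1.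
  rewrite !coef_fiber coefD coefC coefZ coefXM /= add0r hornerM => /eqP.
  by rewrite mulf_eq0 (negPf Aa) => /eqP.
have [D1 D1E] : exists r, D = r * ('X - a%:P) by apply/factor_theorem; rewrite /root Da.
have [s1 s1E] : exists r, s = r * ('X - a%:P) by apply/factor_theorem; rewrite /root sa.
have [M1 M1E] := fiber_eq0 Ma.
have D10 : D1 != 0 by apply: contraNneq D0 => D10; rewrite D1E D10 mul0r.
apply: (IH D1 s1 M1) => //.
- by move: sD; rewrite D1E size_mul ?polyXsubC_eq0 // size_XsubC addn2.
- by move: sM; rewrite M1E mul_polyC size_scale // polyXsubC_eq0.
have t0 := local_param_neq0 ch a.
apply: (mulIf t0); move: E; rewrite D1E s1E M1E !ev1M ev2M ev2C !ev1_XsubC.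
set t := x - _ => E; transitivity (ev1 iota x D1 * t * z); first by ring.
by rewrite E; ring.
Qed.

End Infinity.

(** * Functions with few poles *)

Lemma map_uniq_inj (T1 T2 : eqType) (f : T1 -> T2) (s : seq T1) :
  uniq (map f s) -> {in s &, injective f}.
Proof.
elim: s => //= a s IH /andP[fa /IH{}IH] b b'; rewrite !inE.
move=> /predU1P[->|bs] /predU1P[->|b's] // E; [| |exact: IH].
- by move: fa; rewrite E map_f.
- by move: fa; rewrite -E map_f.
Qed.

Lemma coefXsubCM (R : comNzRingType) (b : R) (p : {poly R}) i :
  (('X - b%:P) * p)`_i.+1 = p`_i - b * p`_i.+1.
Proof. by rewrite mulrBl coefB coefXM coefCM. Qed.

Section PoleShape.
Variables (k : closedFieldType) (K : fieldType) (iota : {rmorphism k -> K}) (q : nat).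
Variables (A B : {poly k}) (c : k) (x y : K).
Hypotheses (aA : admissible q A) (aB : admissible q B) (c0 : c != 0).
Hypothesis co : coordinates iota A B c x y.

Let ch := coord_chart aA aB c0 co.

Variables (z : K) (poles : seq (k * k)).
Hypothesis size_poles : size poles = q.
Hypothesis point_poles : forall p, p \in poles -> chart_point B A c%:P p.1 p.2.
Hypothesis regular : forall a b, chart_point B A c%:P a b -> (a, b) \notin poles ->
  local_ring iota x y a b z.
Hypothesis simple : forall p, p \in poles ->
  exists2 w, w != 0 & has_value iota x y p.1 p.2 ((x - iota p.1) * z) w.
Hypothesis regular_x : forall b, B.[b] = 0 -> local_ring iota x^-1 y 0 b z.
Hypothesis regular_y : forall a, A.[a] = 0 -> exists O, [/\ place iota O,
  mplace O (x - iota a), mplace O y^-1 & O z].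

Let xs := undup [seq p.1 | p <- poles].
Let E := \prod_(a <- xs) ('X - a%:P).

Let E_factor p : p \in poles -> exists2 r, E = r * ('X - p.1%:P) & r.[p.1] != 0.
Proof.
move=> pP; have pxs : p.1 \in xs by rewrite mem_undup map_f.
exists (\prod_(a <- xs | a != p.1) ('X - a%:P)).
  by rewrite mulrC /E (bigD1_seq p.1) ?undup_uniq.
rewrite horner_prod prodf_seq_neq0; apply/allP => a _; apply/implyP => ap.
by rewrite hornerXsubC subr_eq0 eq_sym.
Qed.

Let Ez_pole p : p \in poles ->
  exists2 w, w != 0 & has_value iota x y p.1 p.2 (ev1 iota x E * z) w.
Proof.
move=> pP; have [r -> rp] := E_factor pP; have [w w0 h] := simple pP.
exists (r.[p.1] * w); first by rewrite mulf_neq0.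
by rewrite ev1M ev1_XsubC -mulrA; apply: valueM => //; apply: value_ev1.
Qed.

Let Ez_other a b : a \in xs -> chart_point B A c%:P a b -> (a, b) \notin poles ->
  has_value iota x y a b (ev1 iota x E * z) 0.
Proof.
move=> axs pt ab; have [w h] := regular pt ab.
have := valueM (value_ev1 iota x y a b E) h.
suff -> : E.[a] = 0 by rewrite mul0r.
by apply/rootP; rewrite root_prod_XsubC.
Qed.

Let Ez_regular a b : chart_point B A c%:P a b ->
  local_ring iota x y a b (ev1 iota x E * z).
Proof.
move=> pt; have [abP|abP] := boolP ((a, b) \in poles).
  by have [w _ h] := Ez_pole abP; exists w.
by apply: local_ringM; [exists E.[a]; exact: value_ev1|exact: regular].
Qed.

Let sE : size E = (size xs).+1.
Proof. by rewrite /E size_prod_XsubC. Qed.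

Let Ez_form : exists (s : {poly k}) (M : {poly {poly k}}),
  [/\ (size s <= (size xs).+1)%N, (size M < q)%N,
      forall j, (size (A * M`_j)%R <= (size xs).+1)%N &
      ev1 iota x E * z = ev2 iota x y (s%:P + A *: ('X * M))].
Proof.
have [a Aa|s [M [sM Ez]]] := regular_form aA aB c0 co Ez_regular.
  have [O [plO mx my Oz]] := regular_y Aa; exists O; split=> //.
  by apply: (placeM plO) => //; apply: (place_ev1 plO); exact: (placeBC plO (mplaceW plO mx)).
pose T : {poly {poly k}} := s%:P + A *: ('X * M).
have TE : ev1 iota x E * z = ev2 iota x y T by rewrite Ez ev2D ev2C ev2Z ev2M ev2X.
have sT : (size T <= q)%N.
  rewrite (leq_trans (size_polyD _ _)) // geq_max.
  rewrite (leq_trans (size_polyC_leq1 _)) ?(adm_gt0 aA) //=.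
  rewrite (leq_trans (size_scale_leq _ _)) // (leq_trans (size_polyMleq _ _)) //.
  by rewrite size_polyX.
(* At the points with x infinite z is regular, and x^-r E(x) is too when r is the number of
   abscissas; this bounds the degree in x of every coefficient. *)
have T_deg : forall j, (size (T`_j)%R <= (size xs).+1)%N.
  apply: (degree_at_infinity aA aB c0 co sT) => b Bb; rewrite -TE mulrA.
  rewrite -(ev1_rev_poly iota (coord_x_neq0 aA aB c0 co)) ?sE //.
  apply: local_ringM; last exact: regular_x.
  by eexists; exact: value_ev1.
exists s, M; split=> //.
  by have := T_deg 0%N; rewrite coefD coefC coefZ coefXM /= mulr0 addr0.
by move=> j; have := T_deg j.+1; rewrite coefD coefC coefZ coefXM /= add0r.
Qed.

Let size_xs : (size xs <= q)%N.
Proof. by rewrite -size_poles -(size_map fst) size_undup. Qed.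

(** The degree of A plus that of a nonzero coefficient of [M] is at most the number of distinct
    abscissas. So [M] is zero when there are fewer than q of them and has constant coefficients when
    there are q. *)
Lemma pole_shape :
  (exists a (s : {poly k}), (size s <= 2)%N /\ (x - iota a) * z = ev1 iota x s) \/
  (exists b, forall p, p \in poles -> p.2 = b).
Proof.
have [s [M [ss sM sAM Ez]]] := Ez_form.
have xs_pole p : p \in poles -> p.1 \in xs by move=> pP; rewrite mem_undup map_f.
have value_T p w : p \in poles ->
    has_value iota x y p.1 p.2 (ev1 iota x E * z) w ->
    w = ev2 idfun p.1 p.2 (s%:P + A *: ('X * M)).
  move=> /point_poles pt h; rewrite Ez in h.
  exact: (value_uniq ch pt h (value_ev2 _ _ _ _ _ _)).
have [xsq|qxs] := ltnP (size xs) q.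
  left.
  have M0 : M = 0.
    apply/polyP => j; rewrite coef0; apply/eqP/negPn/negP => Mj.
    have := sAM j; rewrite size_mul ?(adm_neq0 aA) // (adm_size aA) addSn /= leqNgt.
    by rewrite (leq_ltn_trans xsq) // -{1}[q]addn0 ltn_add2l size_poly_gt0.
  have Ezs : ev1 iota x E * z = ev1 iota x s.
    by rewrite Ez M0 mulr0 scaler0 addr0 ev2C.
  have [p pP] : exists p, p \in poles.
    move: (adm_gt0 aA); rewrite -size_poles; case: (poles) => // p l _.
    by exists p; rewrite mem_head.
  have [al0 _] := point_poles pP.
  have sp : s.[p.1] != 0.
    have [w w0 h] := Ez_pole pP; apply: contraNneq w0 => sp.
    rewrite (value_T _ _ pP h) M0 mulr0 scaler0 addr0 ev2C ev1_id sp; exact/eqP.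
  have [rs [Urs srs rsE]] := chart_roots ch al0.
  (* The function s(x) takes the same nonzero value at all points over p.1, so all q of them are
     poles; hence the poles are exactly this fibre and only one abscissa occurs. *)
  have sub : {subset [seq (p.1, b) | b <- rs] <= poles}.
    move=> _ /mapP[b brs ->]; apply/negPn/negP => nP.
    have pt : chart_point B A c%:P p.1 b by split=> //; apply/eqP; rewrite -rsE.
    have := Ez_other (xs_pole _ pP) pt nP; rewrite Ezs => h.
    have := value_uniq ch pt h (value_ev1 _ _ _ _ _ _).
    by move/esym/eqP; rewrite (negPf sp).
  have Um : uniq [seq (p.1, b) | b <- rs] by rewrite map_inj_uniq // => b b' [].
  have [|_ eqP] := uniq_min_size Um sub; first by rewrite size_map srs size_poles.
  have xsE : xs = [:: p.1].
    have all1 a : a \in xs -> a = p.1.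
      by rewrite mem_undup => /mapP[p' p'P ->]; move: p'P; rewrite -eqP => /mapP[b _ ->].
    have := undup_uniq [seq p.1 | p <- poles]; rewrite -/xs.
    move: all1 (xs_pole p pP); case: (xs) => [|a1 [|a2 l]] //= h _.
      by rewrite (h a1) ?mem_head.
    by rewrite (h a1) ?mem_head // (h a2) ?inE ?eqxx ?orbT // eqxx.
  exists p.1, s; split; first by rewrite xsE in ss.
  by rewrite -Ezs /E xsE big_seq1 ev1_XsubC.
right.
have [n qE] : exists n, q = n.+3.
  by move: (adm_gt2 aA); case: (q) => [|[|[|n]]] // _; exists n.
have xs_size : size xs = size poles by apply/eqP; rewrite size_poles eqn_leq size_xs qxs.
have Uxs : uniq [seq p.1 | p <- poles].
  by rewrite -[uniq _]negbK -ltn_size_undup size_map -xs_size ltnn.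
(* The coefficients of [M] being constants, specialising x to 0 merely reads them. *)
pose m := fiber 0 M.
have Mm a j : (M`_j).[a] = m`_j.
  rewrite coef_fiber; have [->|Mj] := eqVneq M`_j 0; first by rewrite !horner0.
  have : (size (M`_j)%R <= 1)%N.
    have := sAM j; rewrite size_mul ?(adm_neq0 aA) // (adm_size aA) addSn /=.
    by rewrite xs_size size_poles -{2}[q]addn0 -addnS leq_add2l.
  by move/size1_polyC => ->; rewrite !hornerC.
(* As [B] has no term of degree [q - 1], comparing coefficients of degrees [q] and [q - 1]
   yields the ordinate of a pole from the leading coefficients of [m] alone. *)
exists (m`_n / m`_n.+1) => p pP.
have [al0 pt0] := point_poles pP.
pose T := s.[p.1]%:P + A.[p.1] *: ('X * m).
have sm : (size m < q)%N by apply: leq_ltn_trans sM; apply: size_poly.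
have TE b : T.[b] = ev2 idfun p.1 b (s%:P + A *: ('X * M)).
  rewrite ev2D ev2C ev2Z ev2M ev2X !ev1_id hornerD hornerC hornerZ hornerM hornerX.
  congr (_ + _ * (_ * _)); rewrite /ev2; congr (_.[_]).
  apply/polyP => j. by rewrite [RHS]coef_map /= ev1_id Mm.
have Tp : T.[p.2] != 0.
  by have [w w0 h] := Ez_pole pP; rewrite TE -(value_T _ _ pP h).
have [rs [Urs srs rsE]] := chart_roots ch al0.
have T0 b : b \in rs -> b != p.2 -> T.[b] = 0.
  rewrite rsE => /eqP pt bp; have {}pt : chart_point B A c%:P p.1 b by split.
  have nP : (p.1, b) \notin poles.
    apply/negP => bP; case/eqP: bp.
    by have <- := map_uniq_inj Uxs bP pP erefl.
  have := Ez_other (xs_pole _ pP) pt nP; rewrite Ez TE => h.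
  exact: (value_uniq ch pt (value_ev2 _ _ _ _ _ _) h).
have sT : (size T <= q)%N.
  rewrite (leq_trans (size_polyD _ _)) // geq_max.
  rewrite (leq_trans (size_polyC_leq1 _)) ?(adm_gt0 aA) //=.
  rewrite (leq_trans (size_scale_leq _ _)) // (leq_trans (size_polyMleq _ _)) //.
  by rewrite size_polyX.
pose be := A.[p.1] * lead_coef B.
have be0 : be != 0 by rewrite mulf_neq0 // lead_coef_eq0 (adm_neq0 aB).
have Bq : B`_q = lead_coef B by rewrite lead_coefE (adm_size aB).
pose F := A.[p.1] *: B + c%:P.
(* The abscissas are distinct, so [T], of degree less than q, vanishes at the q - 1 other points of
   the fibre. Thus (y - p.2) [T] is proportional to [F], whose roots are the fibre and whose leading
   coefficient is [be]. *)
have eqF : be *: (('X - p.2%:P) * T) = T`_n.+2 *: F.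
  apply/eqP; rewrite -subr_eq0; apply/eqP.
  apply: (@roots_geq_poly_eq0 _ _ rs) => //.
    apply/allP => b brs; rewrite /root hornerD hornerN !hornerZ hornerM hornerXsubC.
    have -> : F.[b] = 0.
      by move: brs; rewrite rsE hornerC => /eqP e; rewrite hornerD hornerZ hornerC.
    rewrite mulr0 subr0; have [->|bp] := eqVneq b p.2; first by rewrite subrr mul0r mulr0.
    by rewrite T0 // !mulr0.
  rewrite srs; apply/leq_sizeP => j; rewrite leq_eqVlt => /orP[/eqP <-|qj].
    have Tq : (('X - p.2%:P) * T)`_q = T`_n.+2.
      by rewrite qE coefXsubCM (@nth_default _ _ T n.+3) -?qE // mulr0 subr0.
    have Fq : F`_q = be.
      by rewrite coefD coefZ coefC Bq gtn_eqF ?(adm_gt0 aA) // addr0.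
    by rewrite coefB !coefZ Tq Fq mulrC subrr.
  rewrite coefB !coefZ; case: j qj => // j qj; rewrite coefXsubCM.
  have qj1 : (q <= j.+1)%N by apply: leqW.
  rewrite (@nth_default _ _ T j) ?(leq_trans sT) // (@nth_default _ _ T j.+1) ?(leq_trans sT) //.
  have Fj : F`_j.+1 = 0.
    by rewrite coefD coefZ coefC /= (@nth_default _ _ B) ?(adm_size aB) // mulr0 addr0.
  by rewrite Fj !mulr0 !subr0 mulr0.
have Tn0 : T`_n.+2 != 0.
  apply: contraNneq Tp => Tn; move: eqF; rewrite Tn scale0r => /eqP.
  by rewrite scaler_eq0 (negPf be0) mulf_eq0 polyXsubC_eq0 /= => /eqP ->; rewrite horner0.
have Tj j : T`_j.+1 = A.[p.1] * m`_j.
  by rewrite coefD coefC coefZ coefXM /= add0r.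
have Fn : F`_n.+2 = 0.
  by have := adm_coef aB; rewrite qE /= coefD coefZ coefC /= => ->; rewrite mulr0 addr0.
have := congr1 (fun r : {poly k} => r`_n.+2) eqF.
rewrite /= !coefZ coefXsubCM Fn mulr0 => /eqP.
rewrite mulf_eq0 (negPf be0) /= subr_eq0 !Tj mulrCA => /eqP/(mulfI al0) ->.
by rewrite mulfK //; move: Tn0; rewrite Tj mulf_eq0 negb_or => /andP[].
Qed.

End PoleShape.

(** * Change of coordinates *)

Section Centers.
Variables (k : closedFieldType) (K : fieldType) (iota : {rmorphism k -> K}) (q : nat).
Variables (A B : {poly k}) (c : k) (x y : K).
Hypotheses (aA : admissible q A) (aB : admissible q B) (c0 : c != 0).
Hypothesis co : coordinates iota A B c x y.
Variable O : K -> Prop.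
Hypothesis plO : place iota O.

Lemma mplace_inv_ev1 : mplace O x^-1 -> mplace O (ev1 iota x A)^-1.
Proof.
move=> mx; have x0 := coord_x_neq0 aA aB c0 co.
pose h := ev1 iota x^-1 (rev_poly q A).
have hE : h = x ^- q * ev1 iota x A by rewrite /h ev1_rev_poly // (adm_size aA).
have uh : ~ mplace O h.
  move=> mh; have mx0 : mplace O (x^-1 - iota 0) by rewrite rmorph0 subr0.
  have := mplaceB plO mh (mplace_ev1 plO (rev_poly q A) mx0).
  rewrite opprB addrC subrK => /(mplace_const plO)/eqP; rewrite rev_poly0.
  by rewrite -[q]/(q.+1.-1) -(adm_size aA) -lead_coefE lead_coef_eq0 (negPf (adm_neq0 aA)).
have Oh : O h by apply: (place_ev1 plO); exact: (mplaceW plO).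
have -> : (ev1 iota x A)^-1 = x ^- q * h^-1.
  by rewrite hE invfM invrK mulrA mulVf ?mul1r // expf_neq0.
apply: (mplaceMr plO); last exact: place_unitV.
rewrite -exprVn; case: (q) (adm_gt0 aA) => // n _; rewrite exprS.
by apply: (mplaceMr plO) => //; apply/(placeXn plO)/(mplaceW plO).
Qed.

End Centers.

Section CenterCases.
Variables (k : closedFieldType) (K : fieldType) (iota : {rmorphism k -> K}) (q : nat).

(** When x is infinite so is A(x), hence B(y) = - c / A(x) vanishes; y is then finite, since
    otherwise B(y) would be infinite. *)
Lemma center_infinite (A B : {poly k}) c x y O :
    admissible q A -> admissible q B -> c != 0 -> coordinates iota A B c x y ->
    place iota O -> mplace O x^-1 ->
  exists2 b, B.[b] = 0 & mplace O (y - iota b).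
Proof.
move=> aA aB c0 co plO mx; have co' := coordinates_swap aA c0 co.
have mA := mplace_inv_ev1 aA aB c0 co plO mx.
have E : ev1 iota y B = - iota c * (ev1 iota x A)^-1.
  have /eqP := coord_eqn co; rewrite addr_eq0 => /eqP <-.
  by rewrite mulrAC mulfV ?mul1r // (ev1_eq0 (coord_chart aA aB c0 co)) (adm_neq0 aA).
have mB : mplace O (ev1 iota y B).
  by rewrite E; apply: (mplaceM plO) => //; apply/(placeN plO)/(place_const plO).
have Oy : O y.
  apply: contrapT => Oy; have y0 := coord_x_neq0 aB aA c0 co'.
  have mBV := mplace_inv_ev1 aB aA c0 co' plO (mplaceV y0 Oy).
  apply: (mplace_unit plO _ mB (mplaceW plO mBV)).
  by rewrite mulfV // (ev1_eq0 (coord_chart aB aA c0 co')) (adm_neq0 aB).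
by have [b /rootP] := mplace_root plO Oy (adm_neq0 aB) mB; exists b.
Qed.

(** If no nonzero polynomial in x vanished at the place, the denominators in [chart_span] would all
    be units and [O] would be the whole of [K]. So x has a value, and the equation provides that of
    y. *)
Lemma center_finite (A B : {poly k}) c x y O :
    admissible q A -> admissible q B -> c != 0 -> coordinates iota A B c x y ->
    place iota O -> ~ mplace O x^-1 -> ~ mplace O y^-1 ->
  exists a b, [/\ chart_point B A c%:P a b, mplace O (x - iota a) & mplace O (y - iota b)].
Proof.
move=> aA aB c0 co plO nx ny; have co' := coordinates_swap aA c0 co.
have ch := coord_chart aA aB c0 co.
have Ox : O x.
  by apply: contrapT => Ox; apply: nx; apply: mplaceV => //; exact: coord_x_neq0 aA aB c0 co.
have Oy : O y.
  by apply: contrapT => Oy; apply: ny; apply: mplaceV => //; exact: coord_x_neq0 aB aA c0 co'.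
have [p [p0 mp]] : exists p, p != 0 /\ mplace O (ev1 iota x p).
  apply: contrapT => np; have [z nz] := place_proper plO; apply: nz.
  have [d [S [d0 _ E]]] := chart_span ch z.
  have dx : ev1 iota x d != 0 by rewrite (ev1_eq0 ch).
  have -> : z = (ev1 iota x d)^-1 * ev2 iota x y S by rewrite -E mulKf.
  apply: (placeM plO); last exact: (place_ev2 plO).
  apply: place_unitV; first exact: (place_ev1 plO).
  by move=> md; apply: np; exists d.
have [a _ ma] := mplace_root plO Ox p0 mp.
pose G := A.[a] *: B + c%:P.
have mG : mplace O (ev1 iota y G).
  have -> : ev1 iota y G = - ((ev1 iota x A - iota A.[a]) * ev1 iota y B).
    have /eqP := coord_eqn co; rewrite addr_eq0 => /eqP E.
    by rewrite ev1D ev1Z ev1C mulrBl E opprB opprK.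
  by apply/(mplaceN plO)/(mplaceMr plO); [exact: mplace_ev1|exact: place_ev1].
have Aa : A.[a] != 0.
  apply: contraNneq c0 => Aa; apply/eqP/(mplace_const plO).
  by move: mG; rewrite /G Aa scale0r add0r ev1C.
have G0 : G != 0.
  rewrite -size_poly_gt0 (size_polyDl) size_scale ?(adm_size aB) //.
  by rewrite (leq_ltn_trans (size_polyC_leq1 _)) // ltnS (adm_gt0 aB).
have [b /rootP Gb mb] := mplace_root plO Oy G0 mG.
exists a, b; split=> //; split=> //.
by move: Gb; rewrite hornerD hornerZ !hornerC.
Qed.

(** There is one place with x infinite for each root of B, by [center_place], and [w] takes at most
    one value at each; [p] collects these values. *)
Lemma residues_at_infinity (A B : {poly k}) c x y w :
    admissible q A -> admissible q B -> c != 0 -> coordinates iota A B c x y ->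
  exists p : {poly k}, p != 0 /\
    forall O t, place iota O -> mplace O x^-1 -> mplace O (w - iota t) -> root p t.
Proof.
move=> aA aB c0 co; have [rs BE] := closed_field_poly_normal B.
have chi := chart_infinity aA aB c0 co.
have zero O : mplace O x^-1 -> mplace O (x^-1 - iota 0) by rewrite rmorph0 subr0.
suff [p [p0 H]] : exists p : {poly k}, p != 0 /\ forall O t b, b \in rs -> B.[b] = 0 ->
    place iota O -> mplace O x^-1 -> mplace O (y - iota b) ->
    mplace O (w - iota t) -> root p t.
  exists p; split=> // O t plO mx mw.
  have [b Bb mb] := center_infinite aA aB c0 co plO mx; apply: (H O t b) => //.
  move/rootP: Bb; rewrite BE rootZ ?lead_coef_eq0 ?(adm_neq0 aB) //.
  by rewrite root_prod_XsubC.
elim: rs {BE} => [|b rs [p [p0 H]]]; first by exists 1; rewrite oner_eq0.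
have [[O [t [Bb plO mx mb mw]]]|no] := pselect (exists O t, [/\ B.[b] = 0, place iota O,
    mplace O x^-1, mplace O (y - iota b) & mplace O (w - iota t)]); last first.
  exists p; split=> // O t b'; rewrite inE => /predU1P[->|]; last exact: H.
  by move=> Bb plO mx mb mw; case: no; exists O, t.
exists (p * ('X - t%:P)); split; first by rewrite mulf_neq0 // polyXsubC_eq0.
move=> O' t' b'; rewrite inE => /predU1P[->|b'rs] Bb' plO' mx' mb' mw'; last first.
  by rewrite rootM (H O' t' b').
have pt := infinity_point c aA Bb.
have OE := center_place chi pt plO (zero _ mx) mb.
have OE' := center_place chi pt plO' (zero _ mx') mb'.
have mwt' : mplace O (w - iota t').
  by case: mw' => [|h]; [left|right => /OE/OE'].
by rewrite rootM root_XsubC (mplace_uniq plO mwt' mw) eqxx orbT.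
Qed.

End CenterCases.

(** * New coordinates as homographic functions of the old ones *)

Section Moebius.
Variables (k : closedFieldType) (K : fieldType) (iota : {rmorphism k -> K}) (q : nat).
Variables (A' B' : {poly k}) (c' : k) (x' y' : K).
Hypotheses (aA' : admissible q A') (aB' : admissible q B') (c'0 : c' != 0).
Hypothesis co' : coordinates iota A' B' c' x' y'.

Let ch' := coord_chart aA' aB' c'0 co'.

(** The zeros of x' - t are the q points (t, b) in the coordinates (x', y'); [g] gives the
    coordinates of the same places with respect to (x, y), where [pole_shape] is applied to 1 / (x'
    - t). *)
Lemma fraction_poles (A B : {poly k}) c x y t (rs : seq k) (g : k -> k * k) :
    admissible q A -> admissible q B -> c != 0 -> coordinates iota A B c x y ->
    (forall O, place iota O -> mplace O x^-1 \/ mplace O y^-1 -> ~ mplace O (x' - iota t)) ->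
    uniq rs -> size rs = q -> (forall b, b \in rs <-> chart_point B' A' c'%:P t b) ->
    (forall b, b \in rs -> [/\ chart_point B A c%:P (g b).1 (g b).2,
      mplace (local_ring iota x' y' t b) (x - iota (g b).1) &
      mplace (local_ring iota x' y' t b) (y - iota (g b).2)]) ->
  (exists a (s : {poly k}), (size s <= 2)%N /\
      (x - iota a) * (x' - iota t)^-1 = ev1 iota x s) \/
  (exists b, forall p, p \in map g rs -> p.2 = b).
Proof.
move=> aA aB c0 co good Urs srs rsE gP.
have ch := coord_chart aA aB c0 co.
have chi := chart_infinity aA aB c0 co.
have swp := coordinates_swap aA c0 co; have chj := chart_infinity aB aA c0 swp.
pose z := (x' - iota t)^-1.
have t0 : x' - iota t != 0 by exact: (local_param_neq0 ch').
have bad O : place iota O -> ~ O z -> mplace O (x' - iota t).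
  by move=> plO /(mplaceV (invr_neq0 t0)); rewrite invrK.
have OP b : b \in rs -> [/\ place iota (local_ring iota x' y' t b),
    mplace (local_ring iota x' y' t b) (x' - iota t) &
    mplace (local_ring iota x' y' t b) (y' - iota b)].
  move=> /rsE pt; split; first exact: (local_place ch' pt).
    by apply/(mplace_localP ch' pt); exact: value_param.
  apply/(mplace_localP ch' pt); rewrite -(subrr b) -rmorphN.
  by apply: valueD; [exact: value_v|exact: value_const].
have OE b : b \in rs -> forall w, local_ring iota x' y' t b w <->
    local_ring iota x y (g b).1 (g b).2 w.
  move=> brs; have [plO _ _] := OP b brs; have [pt mx my] := gP b brs.
  exact: (center_place ch pt plO mx my).
have mE b w : b \in rs -> mplace (local_ring iota x' y' t b) w <->
    mplace (local_ring iota x y (g b).1 (g b).2) w.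
  by move=> brs; split=> -[w0|h]; [left|right=> /(OE b brs)|left|right=> /(OE b brs)].
apply: (@pole_shape _ _ _ q A B c x y aA aB c0 co z (map g rs)).
- by rewrite size_map.
- by move=> _ /mapP[b brs ->]; have [] := gP b brs.
- move=> a b pt; apply: contraNP => nz.
  have plO := local_place ch pt; have mt := bad _ plO nz.
  have Ox' := placeBC plO (mplaceW plO mt).
  have mxa : mplace (local_ring iota x y a b) (x - iota a).
    by apply/(mplace_localP ch pt); exact: value_param.
  have myb : mplace (local_ring iota x y a b) (y - iota b).
    apply/(mplace_localP ch pt); rewrite -(subrr b) -rmorphN.
    by apply: valueD; [exact: value_v|exact: value_const].
  have x'0 := coord_x_neq0 aA' aB' c'0 co'.
  have y'0 := coord_x_neq0 aB' aA' c'0 (coordinates_swap aA' c'0 co').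
  have ay0 : A'.[t] != 0.
    have [n qn] : exists n, q = n.+1 by case: (q) (adm_gt0 aA) => // n; exists n.
    move: srs rsE; rewrite qn; case: (rs) => // b' l _ /(_ b').
    by rewrite mem_head => -[/(_ isT)[]].
  have nx' : ~ mplace (local_ring iota x y a b) x'^-1.
    by move=> m; exact: (mplace_unit plO (mulVf x'0) m Ox').
  (* An infinite y' would force x' to be a root of A', whereas A'(t) is nonzero. *)
  have ny' : ~ mplace (local_ring iota x y a b) y'^-1.
    move=> m; have swp' := coordinates_swap aA' c'0 co'.
    have [a' Aa' ma'] := center_infinite aB' aA' c'0 swp' plO m.
    by case/eqP: ay0; rewrite (mplace_uniq plO mt ma').
  have [a' [b' [pt' mx' my']]] := center_finite aA' aB' c'0 co' plO nx' ny'.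
  have ta := mplace_uniq plO mx' mt; rewrite ta in pt' mx'.
  have b'rs : b' \in rs by apply/rsE.
  have EE := center_place ch' pt' plO mx' my'.
  have mEE w : mplace (local_ring iota x' y' t b') w -> mplace (local_ring iota x y a b) w.
    by case=> [->|h]; [left|right=> /EE].
  have [_ gx gy] := gP b' b'rs.
  apply/mapP; exists b' => //.
  by rewrite [g b']surjective_pairing (mplace_uniq plO mxa (mEE _ gx))
     (mplace_uniq plO myb (mEE _ gy)).
(* The poles are simple because x' - t and the difference of x with the abscissa of the pole are
   both local parameters of the same place, each a regular multiple of the other. *)
- move=> _ /mapP[b brs ->]; have [plO mt _] := OP b brs; have [pt mx my] := gP b brs.
  have pt' : chart_point B' A' c'%:P t b by apply/rsE.
  have /(OE b brs)[w h] := local_div ch' pt' mx; exists w => //.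
  apply: contraPneq h => w0 h; rewrite w0 in h.
  have := local_div ch pt (iffLR (mE b _ brs) mt).
  have /(mplace_localP ch pt) mh := h.
  have plx := local_place ch pt; move=> Oi; apply: (mplace_unit plx _ mh Oi).
  have x0 := local_param_neq0 ch (g b).1.
  by field; rewrite x0.
- move=> b Bb; apply: contrapT => nz; have pt := infinity_point c aA Bb.
  have plO := local_place chi pt; apply: (good _ plO _ (bad _ plO nz)); left.
  by apply/(mplace_localP chi pt); have := value_param iota x^-1 y 0 b; rewrite rmorph0 subr0.
move=> a Aa; have pt := infinity_point c aB Aa; have plO := local_place chj pt.
have my : mplace (local_ring iota y^-1 x 0 a) y^-1.
  by apply/(mplace_localP chj pt); have := value_param iota y^-1 x 0 a; rewrite rmorph0 subr0.
exists (local_ring iota y^-1 x 0 a); split=> //.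
  apply/(mplace_localP chj pt); rewrite -(subrr a) -rmorphN.
  by apply: valueD; [exact: value_v|exact: value_const].
apply: contrapT => nz; apply: (good _ plO _ (bad _ plO nz)); by right.
Qed.

Lemma fraction_moebius (A B : {poly k}) c x y :
    admissible q A -> admissible q B -> c != 0 -> coordinates iota A B c x y ->
  exists p r : {poly k}, [/\ (size p <= 2)%N, (size r <= 2)%N &
    (ev1 iota x r != 0 /\ x' * ev1 iota x r = ev1 iota x p) \/
    (ev1 iota y r != 0 /\ x' * ev1 iota y r = ev1 iota y p)].
Proof.
move=> aA aB c0 co; have swp := coordinates_swap aA c0 co.
have [p1 [p10 H1]] := residues_at_infinity x' aA aB c0 co.
have [p2 [p20 H2]] := residues_at_infinity x' aB aA c0 swp.
(* The constant t avoids the values of x' at the points where x or y is infinite, and also the roots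
   of A', over which y' is infinite. *)
have /closed_nonrootP[t] : p1 * p2 * A' != 0 by rewrite !mulf_neq0 // (adm_neq0 aA').
rewrite !rootM !negb_or => /andP[/andP[n1 n2] At].
have good O : place iota O -> mplace O x^-1 \/ mplace O y^-1 -> ~ mplace O (x' - iota t).
  move=> plO [mx|my] mt; first by move: n1; rewrite (H1 O).
  by move: n2; rewrite (H2 O).
have [rs [Urs srs rsE]] := chart_roots ch' At.
have rsP b : b \in rs <-> chart_point B' A' c'%:P t b.
  by rewrite rsE; split=> [/eqP|[_ ->]] //; split.
have /choice[g gP] : forall b, exists p : k * k, b \in rs ->
    [/\ chart_point B A c%:P p.1 p.2,
      mplace (local_ring iota x' y' t b) (x - iota p.1) &
      mplace (local_ring iota x' y' t b) (y - iota p.2)].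
  move=> b; have [brs|_] := boolP (b \in rs); last by exists (0, 0).
  have pt' := iffLR (rsP b) brs; have plO := local_place ch' pt'.
  have mt : mplace (local_ring iota x' y' t b) (x' - iota t).
    by apply/(mplace_localP ch' pt'); exact: value_param.
  have [a [a' [pt mx my]]] := center_finite aA aB c0 co plO
    (fun m => good _ plO (or_introl m) mt) (fun m => good _ plO (or_intror m) mt).
  by exists (a, a').
have form X a (s : {poly k}) : X - iota a != 0 -> (size s <= 2)%N ->
    (X - iota a) * (x' - iota t)^-1 = ev1 iota X s ->
    exists p r : {poly k}, [/\ (size p <= 2)%N, (size r <= 2)%N,
      ev1 iota X r != 0 & x' * ev1 iota X r = ev1 iota X p].
  move=> Xa ss E; have t0 : x' - iota t != 0 by exact: (local_param_neq0 ch').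
  exists (t *: s + ('X - a%:P)), s; split=> //.
  - rewrite (leq_trans (size_polyD _ _)) // geq_max size_XsubC.
    by rewrite (leq_trans (size_scale_leq _ _)).
  - by rewrite -E mulf_neq0 // invr_neq0.
  by rewrite ev1D ev1Z ev1_XsubC -E; field.
have [[a [s [ss E]]]|[b xb]] := fraction_poles aA aB c0 co good Urs srs rsP gP.
  have [p [r [sp sr r0 e]]] := form x a s (local_param_neq0 (coord_chart aA aB c0 co) a) ss E.
  by exists p, r; split=> //; left.
have good' O : place iota O -> mplace O y^-1 \/ mplace O x^-1 -> ~ mplace O (x' - iota t).
  by move=> plO [m|m]; apply: good => //; [right|left].
have gP' b' : b' \in rs -> [/\ chart_point A B c%:P (g b').2 (g b').1,
      mplace (local_ring iota x' y' t b') (y - iota (g b').2) &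
      mplace (local_ring iota x' y' t b') (x - iota (g b').1)].
  move=> /gP[[al0 e] mx my]; split=> //; rewrite hornerC in e; split; last first.
    by rewrite hornerC mulrC.
  by apply: contraNneq c0 => B0; move: e; rewrite B0 mulr0 add0r => ->.
have [[a [s [ss E]]]|[a ya]] := fraction_poles (g := fun b => ((g b).2, (g b).1))
    aB aA c0 swp good' Urs srs rsP gP'.
  have [p [r [sp sr r0 e]]] := form y a s (local_param_neq0 (coord_chart aB aA c0 swp) a) ss E.
  by exists p, r; split=> //; right.
(* All poles have the same abscissa and the same ordinate. *)
exfalso.
have gE b' : b' \in rs -> g b' = (a, b).
  move=> b'rs; rewrite [g b']surjective_pairing (xb (g b')) ?map_f //.
  by have /= -> := ya _ (map_f (fun b => ((g b).2, (g b).1)) b'rs).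
(* Two distinct points of the fibre x' = t are separated by y', yet they would be the same place. *)
have [b1 [b2 [b1rs b2rs b12]]] : exists b1 b2, [/\ b1 \in rs, b2 \in rs & b1 != b2].
  move: srs (adm_gt2 aA) Urs; case: (rs) => [|b1 [|b2 l]] <- // _.
  rewrite /= inE negb_or => /andP[/andP[b12 _] _].
  by exists b1, b2; rewrite !inE !eqxx orbT.
case/eqP: b12.
have key b' : b' \in rs -> forall w, local_ring iota x' y' t b' w <-> local_ring iota x y a b w.
  move=> b'rs; have pt' := iffLR (rsP b') b'rs; have := gP b' b'rs.
  rewrite gE //= => -[pt mx my].
  exact: (center_place (coord_chart aA aB c0 co) pt (local_place ch' pt') mx my).
have my' b' : b' \in rs -> mplace (local_ring iota x' y' t b') (y' - iota b').
  move=> /rsP pt'; apply/(mplace_localP ch' pt'); rewrite -(subrr b') -rmorphN.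
  by apply: valueD; [exact: value_v|exact: value_const].
have pl1 := local_place ch' (iffLR (rsP b1) b1rs).
apply: (mplace_uniq pl1 (my' _ b1rs)).
by case: (my' _ b2rs) => [|h]; [left|right=> /(key _ b1rs)/(key _ b2rs)].
Qed.

End Moebius.

(** * Function field and linear representation *)

Section FunctionField.

Lemma frac_numden (R : idomainType) (f : {fraction R}) :
  exists n d, d != 0 /\ f * FracField.tofrac d = FracField.tofrac n.
Proof.
elim/quotW: f => r; exists (frac r).1, (frac r).2; split; first exact: denom_ratioP.
unlock FracField.tofrac; rewrite -[LHS]FracField.pi_mul; apply/eqmodP.
rewrite /= FracField.equivfE /FracField.mulf.
by rewrite !numden_Ratio ?mulf_neq0 ?oner_neq0 ?denom_ratioP // !mulr1 mulrC.
Qed.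

Lemma irreducible_factor (F : fieldType) (p : {poly F}) : (1 < size p)%N ->
  exists2 r, irreducible_poly r & r %| p.
Proof.
move=> sp; pose P n := `[< exists r : {poly F}, [/\ r %| p, (1 < size r)%N & size r = n] >].
have exP : exists n, P n by exists (size p); apply/asboolP; exists p.
case: (ex_minnP exP) => n /asboolP[r [rp sr srn]] minr.
exists r => //; split=> // s s1 sr'.
have r0 : r != 0 by rewrite -size_poly_gt0 (ltnW sr).
have s0 : s != 0 by apply: contraNneq r0 => s0; move: sr'; rewrite s0 dvd0p.
have ss : (1 < size s)%N by rewrite ltn_neqAle eq_sym s1 size_poly_gt0.
rewrite -dvdp_size_eqp // eqn_leq dvdp_leq //= srn; apply: minr; apply/asboolP.
by exists s; split=> //; exact: dvdp_trans rp.
Qed.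

(** A root y of any irreducible factor of the equation over k(X) is adjoined; that y has degree q
    over k(x) follows from [coordinates] alone, by [coord_indep]. *)
Lemma function_field_exists (k : closedFieldType) q (A B : {poly k}) c :
    admissible q A -> admissible q B ->
  exists (K : fieldType) (iota : {rmorphism k -> K}) (x y : K),
    coordinates iota A B c x y.
Proof.
move=> aA aB; pose F : fieldType := {fraction {poly k}}.
pose j : {rmorphism {poly k} -> F} := @FracField.tofrac {poly k}.
pose jk : {rmorphism k -> F} := j \o polyC.
pose f : {poly F} := j A *: map_poly jk B + (jk c)%:P.
have jA : j A != 0 by rewrite tofrac_eq0 (adm_neq0 aA).
have sf : (1 < size f)%N.
  have sjB : size (j A *: map_poly jk B) = q.+1.
    by rewrite size_scale // size_map_poly (adm_size aB).
  rewrite size_polyDl sjB ?ltnS ?(adm_gt0 aA) //.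
  by rewrite (leq_trans (size_polyC_leq1 _)) // (adm_gt0 aA).
have [r r_irr rf] := irreducible_factor sf.
have [L _ [y ry Ly]] := irredp_FAdjoin r_irr.
pose h : {rmorphism F -> L} := GRing.in_alg L.
pose iota : {rmorphism k -> L} := h \o jk.
pose x : L := h (j 'X).
have xE p : ev1 iota x p = h (j p).
  elim/poly_ind: p => [|p a IH]; first by rewrite ev1_0 !rmorph0.
  by rewrite ev1D ev1M ev1X ev1C IH /x /iota !rmorphD !rmorphM.
exists L, iota, x, y; split.
- have : root (map_poly h f) y.
    by have /dvdpP[s ->] := rf; rewrite rmorphM rootM ry orbT.
  rewrite /root rmorphD /= map_polyC hornerD hornerC linearZ /= hornerZ.
  by rewrite -map_poly_comp xE => /eqP.
- by move=> p; rewrite xE => /eqP; rewrite fmorph_eq0 tofrac_eq0 => /eqP.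
move=> S sS Sx Sy z.
have SF (u : F) : S (h u).
  have [n [d [d0 E]]] := frac_numden u.
  have jd : j d != 0 by rewrite tofrac_eq0.
  have -> : u = j n / j d by rewrite -[j n]E mulfK.
  rewrite fmorph_div -!xE; apply: (subfieldM sS); first exact: subfield_ev1.
  by apply: (subfieldV sS); apply: subfield_ev1.
have : z \in <<1; y>>%VS by rewrite Ly memvf.
case/Fadjoin_polyP => _ /polyOver1P[p ->] ->.
elim/poly_ind: p => [|p a IH].
  by rewrite rmorph0 horner0 -(rmorph0 iota); apply: (subfield_const sS).
rewrite rmorphD rmorphM /= map_polyX map_polyC hornerD hornerMX hornerC.
by apply: (subfieldD sS); [apply: (subfieldM sS)|apply: SF].
Qed.

End FunctionField.

Definition segre (L : nzRingType) (a b : L) : 'cV[L]_4 :=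
  \col_(i < 4) [:: 1; a; b; a * b]`_i.

Lemma scalemxE (R : nzRingType) m n (a : R) (M : 'M[R]_(m, n)) i j :
  (a *: M) i j = a * M i j.
Proof. by rewrite mxE. Qed.

(** * Generic points and linear independence *)

Section Generic.
Variables (k : closedFieldType) (K : fieldType) (iota : {rmorphism k -> K}) (q : nat).
Variables (A B : {poly k}) (c : k) (x y : K).
Hypotheses (aA : admissible q A) (aB : admissible q B) (c0 : c != 0).
Hypothesis co : coordinates iota A B c x y.

Let ch := coord_chart aA aB c0 co.

Definition on_curve a b := A.[a] * B.[b] + c = 0.

Lemma on_curve_chart a b : on_curve a b <-> chart_point B A c%:P a b.
Proof.
rewrite /chart_point hornerC; split=> [e|[]//]; split=> //.
by apply: contraNneq c0 => A0; move: e; rewrite /on_curve A0 mul0r add0r => ->.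
Qed.

(** Validity on a nonempty open subset of the plane curve, the complement of the zeros of a nonzero
    function. *)
Definition generic (D : k -> k -> Prop) := exists Q : {poly {poly k}},
  ev2 iota x y Q != 0 /\
  forall a b, on_curve a b -> ev2 idfun a b Q != 0 -> D a b.

Lemma generic_and D1 D2 : generic D1 -> generic D2 ->
  generic (fun a b => D1 a b /\ D2 a b).
Proof.
move=> [Q1 [Q10 H1]] [Q2 [Q20 H2]]; exists (Q1 * Q2).
rewrite ev2M mulf_neq0 //; split=> // a b ab; rewrite ev2M mulf_eq0 negb_or.
by case/andP=> h1 h2; split; [exact: H1|exact: H2].
Qed.

Lemma generic_imp (D1 D2 : k -> k -> Prop) :
  (forall a b, on_curve a b -> D1 a b -> D2 a b) -> generic D1 -> generic D2.
Proof. by move=> D12 [Q [Q0 H]]; exists Q; split=> // a b ab /(H a b ab); exact: D12. Qed.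

Lemma generic_neq0 Q : ev2 iota x y Q != 0 -> generic (fun a b => ev2 idfun a b Q != 0).
Proof. by exists Q. Qed.

Lemma generic_ex D : generic D -> exists a b, on_curve a b /\ D a b.
Proof.
move=> [Q [Q0 H]]; apply: contrapT => no; case/eqP: Q0; apply: (ev2_eq0_points ch).
move=> a b /on_curve_chart ab; apply/eqP/negPn/negP => Qab; apply: no.
by exists a, b; split=> //; apply: H.
Qed.

Lemma generic_eq0 P : generic (fun a b => ev2 idfun a b P = 0) -> ev2 iota x y P = 0.
Proof.
move=> [Q [Q0 H]]; have : ev2 iota x y (P * Q) = 0.
  apply: (ev2_eq0_points ch) => a b /on_curve_chart ab; rewrite ev2M.
  by have [->|/(H a b ab) ->] := eqVneq (ev2 idfun a b Q) 0; rewrite ?mulr0 ?mul0r.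
by rewrite ev2M => /eqP; rewrite mulf_eq0 (negPf Q0) orbF => /eqP.
Qed.

Definition poly2 (R : nzRingType) (a b d : R) : {poly R} := Poly [:: a; b; d].

Lemma coef_poly2 (R : nzRingType) (a b d : R) :
  [/\ (poly2 a b d)`_0 = a, (poly2 a b d)`_1 = b & (poly2 a b d)`_2 = d].
Proof. by rewrite /poly2 !coef_Poly. Qed.

Lemma ev1_poly2 (L : comNzRingType) (f : {rmorphism k -> L}) u (a b d : k) :
  ev1 f u (poly2 a b d) = f a + f b * u + f d * u ^+ 2.
Proof.
have s2 : (size (poly2 a b d) <= 3)%N by apply: (leq_trans (size_Poly _)).
rewrite (ev1_wide _ _ s2) !big_ord_recr big_ord0 /= expr0 mulr1 add0r expr1.
by have [-> -> ->] := coef_poly2 a b d.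
Qed.

Lemma ev2_poly2 (L : comNzRingType) (f : {rmorphism k -> L}) u v (p r s : {poly k}) :
  ev2 f u v (poly2 p r s) = ev1 f u p + ev1 f u r * v + ev1 f u s * v ^+ 2.
Proof.
have s2 : (size (poly2 p r s) <= 3)%N by apply: (leq_trans (size_Poly _)).
rewrite (ev2_sum _ _ _ s2) !big_ord_recr big_ord0 /= expr0 mulr1 add0r expr1.
by have [-> -> ->] := coef_poly2 p r s.
Qed.

Lemma biquadratic_indep (a0 a1 a2 b0 b1 b2 d0 d1 d2 : k) :
    iota a0 + iota a1 * x + iota a2 * x ^+ 2
    + (iota b0 + iota b1 * x + iota b2 * x ^+ 2) * y
    + (iota d0 + iota d1 * x + iota d2 * x ^+ 2) * y ^+ 2 = 0 ->
  [/\ [/\ a0 = 0, a1 = 0 & a2 = 0], [/\ b0 = 0, b1 = 0 & b2 = 0] &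
      [/\ d0 = 0, d1 = 0 & d2 = 0]].
Proof.
rewrite -!ev1_poly2 -ev2_poly2 => P0.
have /(chart_indep ch)/(_ P0) : (size (poly2 (poly2 a0 a1 a2) (poly2 b0 b1 b2)
    (poly2 d0 d1 d2)) <= q)%N.
  by apply: (leq_trans (size_Poly _)); exact: (adm_gt2 aA).
have z3 (R : nzRingType) (u v w : R) : poly2 u v w = 0 -> [/\ u = 0, v = 0 & w = 0].
  by move=> p0; have := coef_poly2 u v w; rewrite p0 !coef0 => -[-> -> ->].
by case/z3 => /z3[-> -> ->] /z3[-> -> ->] /z3[-> -> ->].
Qed.

Lemma segre_indep (v : 'rV[k]_4) : map_mx iota v *m segre x y = 0 -> v = 0.
Proof.
move/matrixP/(_ 0 0); rewrite !mxE !big_ord_recr big_ord0 /= !mxE /= => E.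
pose w i := v 0 (inord i).
have wE (i : 'I_4) : v 0 i = w i by rewrite /w inord_val.
have [] := @biquadratic_indep (w 0%N) (w 1%N) 0 (w 2%N) (w 3%N) 0 0 0 0.
  by apply: etrans E; rewrite !rmorph0 !wE /=; ring.
move=> [w0 w1 _] [w2 w3 _] _; apply/rowP => i; rewrite mxE wE.
by case: i => -[|[|[|[|]]]].
Qed.

(** The eigenvector condition says that each entry of N s(a, b) is its first entry times the
    matching entry of s(a, b). These become identities of bidegree at most (2, 2) in [K], and
    comparing coefficients determines [N]. *)
Lemma generic_eigen_scalar (N : 'M[k]_4) :
    generic (fun a b => exists l, N *m segre a b = l *: segre a b) ->
  exists nu, N = nu%:M.
Proof.
move=> gN; pose w i j := N (inord i) (inord j).
have wE (i j : 'I_4) : N i j = w i j by rewrite /w !inord_val.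
pose row i : {poly {poly k}} := poly2 (poly2 (w i 0%N) (w i 1%N) 0) (poly2 (w i 2%N) (w i 3%N) 0) 0.
have rowE (L : comNzRingType) (f : {rmorphism k -> L}) u v i :
    ev2 f u v (row i) = f (w i 0%N) + f (w i 1%N) * u + (f (w i 2%N) + f (w i 3%N) * u) * v.
  by rewrite /row ev2_poly2 ev1_0 !ev1_poly2 rmorph0; ring.
have rowP (i : 'I_4) a b : (N *m segre a b) i 0 = ev2 idfun a b (row i).
  by rewrite rowE mxE !big_ord_recr big_ord0 /= !mxE !wE /=; ring.
have ent (i : 'I_4) (S : {poly {poly k}}) : (forall a b, ev2 idfun a b S = segre a b i 0) ->
    ev2 iota x y (row i) = ev2 iota x y (row 0%N) * ev2 iota x y S.
  move=> SE; apply/eqP; rewrite -subr_eq0 -ev2M -ev2B; apply/eqP.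
  apply: generic_eq0; apply: generic_imp gN => a b _ [l E].
  rewrite ev2B ev2M SE -[0%N]/(val (0 : 'I_4)) -!rowP E !scalemxE.
  by rewrite [segre a b 0 0]mxE /= mulr1 subrr.
have E1 : ev2 iota x y (row 1%N) = ev2 iota x y (row 0%N) * x.
  have := ent (inord 1) 'X%:P; rewrite ev2C ev1X inordK // => -> // a b.
  by rewrite ev2C ev1X mxE inordK.
have E2 : ev2 iota x y (row 2%N) = ev2 iota x y (row 0%N) * y.
  have := ent (inord 2) 'X; rewrite ev2X inordK // => -> // a b.
  by rewrite ev2X mxE inordK.
have E3 : ev2 iota x y (row 3%N) = ev2 iota x y (row 0%N) * (x * y).
  have := ent (inord 3) ('X%:P * 'X); rewrite ev2M ev2C ev1X ev2X inordK // => -> // a b.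
  by rewrite ev2M ev2C ev1X ev2X mxE inordK.
rewrite !rowE in E1 E2 E3.
have [] := @biquadratic_indep (w 1%N 0%N) (w 1%N 1%N - w 0%N 0%N) (- w 0%N 1%N)
  (w 1%N 2%N) (w 1%N 3%N - w 0%N 2%N) (- w 0%N 3%N) 0 0 0.
  move/eqP: E1; rewrite -subr_eq0 => /eqP E1'.
  by apply: etrans E1'; rewrite ?rmorphB ?rmorphN ?rmorph0 /=; ring.
move=> [e10 e11 e01] [e12 _ e03] _.
have [] := @biquadratic_indep (w 2%N 0%N) (w 2%N 1%N) 0
  (w 2%N 2%N - w 0%N 0%N) (w 2%N 3%N - w 0%N 1%N) 0 (- w 0%N 2%N) (- w 0%N 3%N) 0.
  move/eqP: E2; rewrite -subr_eq0 => /eqP E2'.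
  by apply: etrans E2'; rewrite ?rmorphB ?rmorphN ?rmorph0 /=; ring.
move=> [e20 e21 _] [e22 e23 _] [e02 _ _].
have [] := @biquadratic_indep (w 3%N 0%N) (w 3%N 1%N) 0
  (w 3%N 2%N) (w 3%N 3%N - w 0%N 0%N) (- w 0%N 1%N) 0 (- w 0%N 2%N) (- w 0%N 3%N).
  move/eqP: E3; rewrite -subr_eq0 => /eqP E3'.
  by apply: etrans E3'; rewrite ?rmorphB ?rmorphN ?rmorph0 /=; ring.
move=> [e30 e31 _] [e32 e33 _] _.
move/eqP: e01; rewrite oppr_eq0 => /eqP e01; move/eqP: e02; rewrite oppr_eq0 => /eqP e02.
move/eqP: e03; rewrite oppr_eq0 => /eqP e03; rewrite e01 subr0 in e23.
(* With the other entries known, [E1] reduces to w13 x y = 0. *)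
have e13 : w 1%N 3%N = 0.
  have [] := @biquadratic_indep 0 0 0 0 (w 1%N 3%N) 0 0 0 0.
    move: E1; rewrite e10 e12 e01 e02 e03 !rmorph0 (subr0_eq e11) => E1.
    have {E1} -> : iota (w 1%N 3%N) = 0.
      have xy0 : x * y != 0.
        have y0 := coord_x_neq0 aB aA c0 (coordinates_swap aA c0 co).
        by rewrite mulf_neq0 // (coord_x_neq0 aA aB c0 co).
      apply: (mulIf xy0); move/eqP: E1; rewrite -subr_eq0 => /eqP E1.
      by rewrite mul0r -E1; ring.
    ring.
  by move=> _ [].
exists (w 0%N 0%N); apply/matrixP => i j; rewrite wE mxE.
case: i j => -[|[|[|[|]]]] // ? [[|[|[|[|]]]]] //= ?; rewrite ?mulr1n ?mulr0n //;
  exact: subr0_eq.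
Qed.

End Generic.

(** * The matrix of a change of coordinates *)

Section BirationalMatrix.
Variables (k : closedFieldType) (K : fieldType) (iota : {rmorphism k -> K}) (q : nat).
Variables (A B : {poly k}) (c : k) (x y x' y' : K).
Hypotheses (aA : admissible q A) (aB : admissible q B) (c0 : c != 0).
Hypotheses (co : coordinates iota A B c x y) (co' : coordinates iota A B c x' y').

(** Row i contains the coefficients of H1_i(x) H2_i(y) on 1, x, y, xy: the index j stands for the
    monomial x^(j mod 2) y^(j div 2). *)
Definition tensor_mx (H1 H2 : nat -> {poly k}) : 'M[k]_4 :=
  \matrix_(i, j) ((H1 i)`_(j %% 2) * (H2 i)`_(j %/ 2)).

Lemma tensor_mxE (H1 H2 : nat -> {poly k}) (i : 'I_4) :
    (size (H1 i) <= 2)%N -> (size (H2 i) <= 2)%N ->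
  (map_mx iota (tensor_mx H1 H2) *m segre x y) i 0 =
    ev1 iota x (H1 i) * ev1 iota y (H2 i).
Proof.
move=> s1 s2; rewrite mxE !big_ord_recr big_ord0 /= !mxE /=.
rewrite (ev1_wide _ _ s1) (ev1_wide _ _ s2) !big_ord_recr !big_ord0 /= !rmorphM /=.
by rewrite -[(0 %/ 2)%N]/0%N -[(1 %/ 2)%N]/0%N -[(2 %/ 2)%N]/1%N -[(3 %/ 2)%N]/1%N
  -[(0 %% 2)%N]/0%N -[(1 %% 2)%N]/1%N -[(2 %% 2)%N]/0%N -[(3 %% 2)%N]/1%N; ring.
Qed.

(** If x' and y' both lay in k(u), so would all of [K], whereas v has degree q > 1 over k(u). *)
Lemma not_both_rational (A1 B1 : {poly k}) (u v : K) (p1 r1 p2 r2 : {poly k}) :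
    admissible q A1 -> admissible q B1 -> coordinates iota A1 B1 c u v ->
    ev1 iota u r1 != 0 -> x' * ev1 iota u r1 = ev1 iota u p1 ->
    ev1 iota u r2 != 0 -> y' * ev1 iota u r2 = ev1 iota u p2 -> False.
Proof.
move=> a1 b1 co1 r10 e1 r20 e2; have ch := coord_chart a1 b1 c0 co1.
have [d [s [d0 E]]] : exists d s : {poly k}, d != 0 /\ v * ev1 iota u d = ev1 iota u s.
  apply: (coord_gen co' (S := fun z => exists d s : {poly k},
    d != 0 /\ z * ev1 iota u d = ev1 iota u s)).
  - split.
    + by move=> a; exists 1, a%:P; rewrite oner_eq0 ev1_1 mulr1 ev1C.
    + move=> z1 z2 [d1 [s1 [d10 E1]]] [d2 [s2 [d20 E2]]].
      exists (d1 * d2), (s1 * d2 + s2 * d1); rewrite mulf_neq0 //; split=> //.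
      by rewrite ev1D !ev1M -E1 -E2; ring.
    + move=> z1 z2 [d1 [s1 [d10 E1]]] [d2 [s2 [d20 E2]]].
      exists (d1 * d2), (s1 * s2); rewrite mulf_neq0 //; split=> //.
      by rewrite !ev1M -E1 -E2; ring.
    move=> z [d [s [d0 E]]]; have [->|z0] := eqVneq z 0.
      by exists 1, 0; rewrite oner_eq0 ev1_0 invr0 mul0r.
    exists s, d; split; last by rewrite -E mulKf.
    rewrite -(ev1_eq0 ch) -E mulf_neq0 // (ev1_eq0 ch).
    exact: d0.
  - by exists r1, p1; rewrite -(ev1_eq0 ch).
  - by exists r2, p2; rewrite -(ev1_eq0 ch).
have /(chart_indep ch) H : (size (d *: 'X - s%:P)%R <= q)%N.
  rewrite (leq_trans (size_polyD _ _)) // geq_max size_polyN.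
  rewrite (leq_trans (size_scale_leq _ _)) ?size_polyX ?(ltnW (adm_gt2 aA)) //=.
  by rewrite (leq_trans (size_polyC_leq1 _)) // (adm_gt0 aA).
have /H : ev2 iota u v (d *: 'X - s%:P) = 0 by rewrite ev2B ev2Z ev2X ev2C mulrC E subrr.
move/(congr1 (fun P : {poly {poly k}} => P`_1)).
rewrite coefB coefZ coefX coefC /= mulr1 subr0 coef0.
by move/eqP; rewrite (negPf d0).
Qed.

Lemma birational_matrix : exists M : 'M[k]_4, M \in unitmx /\
  exists2 l : K, l != 0 & map_mx iota M *m segre x y = l *: segre x' y'.
Proof.
suff [M [l l0 E]] : exists M : 'M[k]_4, exists2 l : K, l != 0 &
    map_mx iota M *m segre x y = l *: segre x' y'.
  exists M; split; last by exists l.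
  (* A row vector annihilating [M] annihilates s(x', y'), whose entries are linearly independent
     over [k]. *)
  rewrite -row_free_unit; apply: inj_row_free => v vM.
  apply: (segre_indep aA aB c0 co'); apply: (scalerI l0).
  by rewrite scaler0 scalemxAr -E mulmxA -map_mxM vM map_mx0 mul0mx.
(* The scalar l is the product of the two denominators: each entry of l s(x', y') is then a
   polynomial of degree at most 1 in x times one in y. *)
have build (H1 H2 : nat -> {poly k}) l : l != 0 ->
    (forall i : 'I_4, [/\ (size (H1 i) <= 2)%N, (size (H2 i) <= 2)%N &
      ev1 iota x (H1 i) * ev1 iota y (H2 i) = l * [:: 1; x'; y'; x' * y']`_i]) ->
    exists M : 'M[k]_4, exists2 l : K, l != 0 &
      map_mx iota M *m segre x y = l *: segre x' y'.
  move=> l0 H; exists (tensor_mx H1 H2), l => //; apply/colP => i.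
  by have [s1 s2 e] := H i; rewrite tensor_mxE // e !mxE.
have swp := coordinates_swap aA c0 co.
have [p1 [r1 [sp1 sr1 H1]]] := fraction_moebius aA aB c0 co' aA aB c0 co.
have [p2 [r2 [sp2 sr2 H2]]] :=
  fraction_moebius aB aA c0 (coordinates_swap aA c0 co') aA aB c0 co.
case: H1 H2 => [[r10 e1]|[r10 e1]] [[r20 e2]|[r20 e2]].
- by case: (not_both_rational aA aB co r10 e1 r20 e2).
- apply: (build (nth 0 [:: r1; p1; r1; p1]) (nth 0 [:: r2; r2; p2; p2])
    (ev1 iota x r1 * ev1 iota y r2)); first by rewrite mulf_neq0.
  case=> -[|[|[|[|]]]] //= _; split=> //; rewrite -?e1 -?e2; ring.
- apply: (build (nth 0 [:: r2; r2; p2; p2]) (nth 0 [:: r1; p1; r1; p1])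
    (ev1 iota x r2 * ev1 iota y r1)); first by rewrite mulf_neq0.
  case=> -[|[|[|[|]]]] //= _; split=> //; rewrite -?e1 -?e2; ring.
- by case: (not_both_rational aB aA swp r10 e1 r20 e2).
Qed.

(** The identity over [K] is read at the points where [F0] and both the numerator and denominator of
    l are nonzero. *)
Lemma generic_matrix (M : 'M[k]_4) (l : K) (F0 F1 F2 : {poly {poly k}}) :
    l != 0 -> map_mx iota M *m segre x y = l *: segre x' y' ->
    ev2 iota x y F0 != 0 -> x' * ev2 iota x y F0 = ev2 iota x y F1 ->
    y' * ev2 iota x y F0 = ev2 iota x y F2 ->
  generic iota A B c x y (fun a b => forall a' b',
    a' * ev2 idfun a b F0 = ev2 idfun a b F1 ->
    b' * ev2 idfun a b F0 = ev2 idfun a b F2 ->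
    exists2 m, m != 0 & M *m segre a b = m *: segre a' b').
Proof.
move=> l0 E F00 e1 e2.
have [P [R [R0 lE]]] := generates_fraction l (coord_gen co).
have P0 : ev2 iota x y P != 0 by apply: contraNneq l0 => P0; rewrite lE P0 mul0r.
have := generic_and (generic_neq0 A B c F00)
  (generic_and (generic_neq0 A B c P0) (generic_neq0 A B c R0)).
apply: generic_imp => a b /(on_curve_chart A B c0) pt [Fab [Pab Rab]] a' b' ea eb.
have ch := coord_chart aA aB c0 co.
have hx' : has_value iota x y a b x' a' by exists F1, F0.
have hy' : has_value iota x y a b y' b' by exists F2, F0.
have hl : has_value iota x y a b l (ev2 idfun a b P / ev2 idfun a b R).
  by exists P, R; rewrite lE !divfK.
exists (ev2 idfun a b P / ev2 idfun a b R); first by rewrite mulf_neq0 // invr_neq0.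
have h1 : has_value iota x y a b 1 1.
  by have := value_const iota x y a b 1; rewrite rmorph1.
have hs u v w z (i : 'I_4) : has_value iota x y a b u w -> has_value iota x y a b v z ->
    has_value iota x y a b (segre u v i 0) (segre w z i 0).
  move=> hu hv; rewrite !mxE; case: i => -[|[|[|[|]]]] //= _.
  exact: valueM.
apply/colP => i; apply: (value_uniq ch pt (z := (map_mx iota M *m segre x y) i 0)).
  rewrite !mxE; elim/big_ind2: _ => [|z1 w1 z2 w2|j _].
  - by have := value_const iota x y a b 0; rewrite rmorph0.
  - exact: valueD.
  rewrite mxE; apply: valueM; first exact: value_const.
  by apply: hs; [exact: value_u|exact: value_v].
by rewrite E !scalemxE; apply: valueM => //; apply: hs.
Qed.

End BirationalMatrix.

(** * Geometry of the smooth model *)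

Section RelativelyOpen.
Variable k : fieldType.

(* Relative openness of the subset [P] of [Y], tested on basic open sets. *)
Definition relatively_open n (Y : set (pspace k n)) (P : Y -> Prop) :=
  forall y, P y -> exists d (G : {mpoly k[n.+1]}),
    [/\ G \is d.-homog, peval G (val y) != 0 &
        forall z : Y, peval G (val z) != 0 -> P z].

Lemma relatively_openI n (Y : set (pspace k n)) (P Q : Y -> Prop) :
  relatively_open P -> relatively_open Q -> relatively_open (fun y => P y /\ Q y).
Proof.
move=> oP oQ y [/oP[d [G [Gd Gy GP]]] /oQ[e [H [He Hy HQ]]]].
exists (d + e)%N, (G * H); split; first exact: dhomogM.
  by rewrite /peval mevalM mulf_neq0.
move=> z; rewrite /peval mevalM mulf_eq0 negb_or => /andP[Gz Hz].
by split; [apply: GP|apply: HQ].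
Qed.

Lemma relatively_open_zopen n (Y U : set (pspace k n)) : zopen U ->
  relatively_open (fun y : Y => U (val y)).
Proof.
move=> oU y Uy; have [d [G [Gd Gy GU]]] := zopen_basicP oU Uy.
by exists d, G; split=> // z; apply: GU.
Qed.

Lemma relatively_open_peval n (Y : set (pspace k n)) d (G : {mpoly k[n.+1]}) :
  G \is d.-homog -> relatively_open (fun y : Y => peval G (val y) != 0).
Proof. by move=> Gd y Gy; exists d, G. Qed.

Lemma relatively_open_sub n (Y U : set (pspace k n)) (P : (Y `&` U)%classic -> Prop) :
  zopen U -> relatively_open P ->
  relatively_open (fun y : Y => exists2 z : (Y `&` U)%classic, val z = val y & P z).
Proof.
move=> oU oP y [z zy /oP[d [G [Gd Gz GP]]]].
have Uy : U (val y) by rewrite -zy; have [] := set_mem (valP z).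
have [e [H [He Hy HU]]] := zopen_basicP oU Uy.
exists (d + e)%N, (G * H); split; first exact: dhomogM.
  by rewrite /peval mevalM mulf_neq0 // -/(peval G _) -zy.
move=> w; rewrite /peval mevalM mulf_eq0 negb_or => /andP[Gw Hw].
have YUw : (Y `&` U)%classic (val w) by split; [exact: set_mem (valP w)|exact: HU].
by exists (exist _ (val w) (mem_set YUw)) => //; apply: GP.
Qed.

Lemma regular_eq n m (Y : set (pspace k n)) (Z Z' : set (pspace k m))
    (f : Y -> Z) (f' : Y -> Z') :
  (forall y, val (f y) = val (f' y)) -> regular_map f -> regular_map f'.
Proof.
move=> ff' fr y; have [U [d [F [oU Uy Fd fE]]]] := fr y.
by exists U, d, F; split=> // z Uz; rewrite -ff'; apply: fE.
Qed.

Lemma regular_incl n (Y Z : set (pspace k n)) (f : Y -> Z) :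
  (forall y, val (f y) = val y) -> regular_map f.
Proof. by move=> fE; apply: (@regular_eq _ _ Y Y Z idfun f _ (@regular_id _ _ _)) => y. Qed.

Lemma relatively_open_preimage n m (Y : set (pspace k n)) (Z : set (pspace k m))
    (f : Y -> Z) (P : Z -> Prop) :
  regular_map f -> relatively_open P -> relatively_open (fun y => P (f y)).
Proof.
move=> fr oP y Py; have [U [d [F [oU Uy Fd fE]]]] := fr y.
have [e [G [Ge Gy GP]]] := oP _ Py.
have [b [H [Hb Hy HU]]] := zopen_basicP oU Uy.
pose G' := G \mPo [tuple F i | i < m.+1].
have G'E z : U (val z) -> exists2 a, a != 0 &
    peval G (val (f z)) = a ^+ e * peval G' (val z).
  move=> Uz; have [a a0 fz] := hcoordE (fE z Uz); exists a => //.
  rewrite /peval fz (mevalZ_homog _ _ Ge) comp_mpoly_meval; congr (_ * _).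
  by apply: meval_eq => i; rewrite mxE tnth_mktuple.
exists (d * e + b)%N, (G' * H); split.
- by apply: dhomogM => //; apply: dhomog_comp.
- rewrite /peval mevalM mulf_neq0 //; have [a a0 E] := G'E y Uy.
  by apply: contraNneq Gy => h; rewrite E /peval h mulr0.
move=> z; rewrite /peval mevalM mulf_eq0 negb_or => /andP[G'z Hz].
have [a a0 E] := G'E z (HU _ Hz).
by apply: GP; rewrite E mulf_neq0 // expf_neq0.
Qed.

Lemma relatively_open_meet n (Y : set (pspace k n)) (P Q : Y -> Prop) :
  zirreducible Y -> relatively_open P -> relatively_open Q ->
  (exists y, P y) -> (exists y, Q y) -> exists y, P y /\ Q y.
Proof.
move=> [_ irr] oP oQ [y1 /oP[d [G [Gd Gy GP]]]] [y2 /oQ[e [H [He Hy HQ]]]].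
have zc f (F : {mpoly k[n.+1]}) : F \is f.-homog ->
    zclosed [set P | peval F P = 0]%classic.
  move=> Ff; exists [set F]%classic; split; first by move=> _ ->; exists f.
  by apply/seteqP; split=> R /= => [h _ -> //|]; apply.
apply: contrapT => no.
have [w Yw|h|h] := irr _ _ (zc _ _ Gd) (zc _ _ He).
- have [Gw|Gw] := eqVneq (peval G w) 0; [by left|right].
  apply/eqP/negPn/negP => Hw; apply: no; exists (exist _ w (mem_set Yw)).
  by split; [apply: GP|apply: HQ].
- by move: Gy; rewrite (h _ (set_mem (valP y1))) eqxx.
- by move: Hy; rewrite (h _ (set_mem (valP y2))) eqxx.
Qed.

Lemma line_ofP n (u v : 'rV[k]_n.+1) : line_of u = line_of v -> exists a, u = a *: v.
Proof.
by move=> e; apply/vlineP; rewrite -/(line_of v) -e /line_of memv_line.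
Qed.

(** Two points of projective space differ exactly when some 2 x 2 minor F_i G_j - F_j G_i of their
    coordinates is nonzero, an open condition. *)
Lemma relatively_open_neq n m (Y : set (pspace k n)) (Z : set (pspace k m)) (f g : Y -> Z) :
  regular_map f -> regular_map g -> relatively_open (fun y => f y <> g y).
Proof.
move=> fr gr y fgy; have [U [d [F [oU Uy Fd fE]]]] := fr y.
have [V [e [G [oV Vy Ge gE]]]] := gr y.
have [b1 [H1 [Hb1 Hy1 HU]]] := zopen_basicP oU Uy.
have [b2 [H2 [Hb2 Hy2 HV]]] := zopen_basicP oV Vy.
pose D i j := F i * G j - F j * G i.
have [i [j Dy]] : exists i j, peval (D i j) (val y) != 0.
  apply: contrapT => no.
  have D0 i j : peval (F i) (val y) * peval (G j) (val y)
      = peval (F j) (val y) * peval (G i) (val y).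
    apply/eqP; rewrite -subr_eq0; apply/negPn/negP => Dij; apply: no; exists i, j.
    by rewrite /peval /D mevalB !mevalM.
  have Fn0 : (\row_i peval (F i) (val y)) != 0.
    apply: contraNneq (hcoord_neq0 (val (f y))) => F0.
    by have [a _ ->] := hcoordE (fE y Uy); rewrite F0 scaler0.
  have [j Gj] : exists j, peval (G j) (val y) != 0.
    apply: contrapT => noj; have := hcoord_neq0 (val (g y)).
    have [a _ ->] := hcoordE (gE y Vy).
    have -> : \row_i peval (G i) (val y) = 0.
      apply/rowP => l; rewrite !mxE; apply/eqP/negPn/negP => Gl.
      by apply: noj; exists l.
    by rewrite scaler0 eqxx.
  have FE : \row_i peval (F i) (val y) =
      (peval (F j) (val y) / peval (G j) (val y)) *: \row_i peval (G i) (val y).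
    apply/rowP => l; rewrite !mxE; apply: (mulIf Gj); rewrite D0.
    by rewrite mulrAC divfK.
  apply: fgy; apply: val_inj; apply: val_inj; rewrite fE // gE // FE line_ofZ //.
  by apply: contraNneq Fn0 => a0; rewrite FE a0 scale0r.
exists (d + e + (b1 + b2))%N, (D i j * (H1 * H2)); split.
- apply: dhomogM; last exact: dhomogM.
  by apply: rpredB; apply: dhomogM.
- by rewrite /peval !mevalM !mulf_neq0.
move=> z; rewrite /peval !mevalM !mulf_eq0 !negb_or => /andP[Dz /andP[H1z H2z]] fgz.
have := fE z (HU _ H1z); rewrite fgz gE; last exact: HV.
case/line_ofP => a /rowP GF; move: Dz; rewrite /D mevalB !mevalM.
have GFi l : (G l).@[hcoord (val z) 0] = a * (F l).@[hcoord (val z) 0].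
  by have := GF l; rewrite !mxE.
by rewrite !GFi mulrCA [X in _ - X]mulrCA [X in a * X]mulrC subrr eqxx.
Qed.

End RelativelyOpen.

Section AffineChart.
Variable k : fieldType.

Definition affine_row (a b : k) : 'rV[k]_3 := \row_(i < 3) [:: 1; a; b]`_i.

Lemma affine_row_neq0 a b : affine_row a b != 0.
Proof.
apply/eqP => /rowP/(_ 0); rewrite !mxE /= => /eqP; by rewrite oner_eq0.
Qed.

Lemma affine_point_subproof a b : \dim (line_of (affine_row a b)) == 1%N.
Proof. by rewrite dim_vline affine_row_neq0. Qed.

Definition affine_point a b : pspace k 2 :=
  exist (fun U : {vspace 'rV[k]_3} => \dim U == 1%N) (line_of (affine_row a b))
    (affine_point_subproof a b).

Lemma affine_row_inj a b a' b' : line_of (affine_row a b) = line_of (affine_row a' b') ->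
  a = a' /\ b = b'.
Proof.
case/line_ofP => l /rowP E; have := E 0; rewrite !mxE /= mulr1 => l1.
have := E 1; have := E (inord 2); rewrite !mxE !inordK //= -l1 !mul1r.
by move=> -> ->.
Qed.

Definition dehomogenize (F : {mpoly k[3]}) : {poly {poly k}} :=
  \sum_(m <- msupp F) (F@_m)%:P%:P * \prod_(i < 3) [:: 1; 'X%:P; 'X]`_i ^+ m i.

Lemma ev2_dehomogenize F a b : ev2 idfun a b (dehomogenize F) = F.@[affine_row a b 0].
Proof.
rewrite mevalE /dehomogenize (big_morph _ (ev2D idfun a b) (ev2_0 idfun a b)).
apply: eq_bigr => m _; rewrite ev2M ev2C ev1C; congr (_ * _).
rewrite (big_morph _ (ev2M idfun a b) (ev2_1 idfun a b)); apply: eq_bigr => i _.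
rewrite ev2Xn mxE; congr (_ ^+ _); case: i => -[|[|[|]]] //= _.
- by rewrite ev2_1.
- by rewrite ev2C ev1X.
- by rewrite ev2X.
Qed.

Lemma peval_affine d (F : {mpoly k[3]}) (P : pspace k 2) a b :
    F \is d.-homog -> val P = line_of (affine_row a b) ->
  exists2 l, l != 0 & peval F P = l ^+ d * ev2 idfun a b (dehomogenize F).
Proof.
move=> Fd /hcoordE[l l0 E]; exists l => //.
by rewrite /peval E (mevalZ_homog _ _ Fd) ev2_dehomogenize.
Qed.

Lemma peval_affine_neq0 d (F : {mpoly k[3]}) (P : pspace k 2) a b :
    F \is d.-homog -> val P = line_of (affine_row a b) ->
  (peval F P != 0) = (ev2 idfun a b (dehomogenize F) != 0).
Proof.
move=> Fd PE; have [l l0 ->] := peval_affine Fd PE.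
by rewrite mulf_eq0 expf_eq0 (negPf l0) andbF.
Qed.

End AffineChart.

(** * The action of automorphisms on the Segre coordinates *)

Section Automorphism.
Variables (k : closedFieldType) (K : fieldType) (iota : {rmorphism k -> K}) (q : nat).
Variables (A B : {poly k}) (c : k) (x y : K).
Hypotheses (aA : admissible q A) (aB : admissible q B) (c0 : c != 0).
Hypothesis co : coordinates iota A B c x y.

Let ch := coord_chart aA aB c0 co.

Local Notation C := (plane_curve (fun a b : k => A.[a] * B.[b] + c)).

Variables (n : nat) (X U : set (pspace k n)) (V : set (pspace k 2)).
Hypotheses (Xirr : zirreducible X) (oU : zopen U) (oV : zopen V).

Local Notation XU := (X `&` U)%classic.
Local Notation CV := (C `&` V)%classic.

Hypothesis XU0 : exists p, XU p.
Variables (phi : XU -> CV) (psi : CV -> XU).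
Hypotheses (phi_reg : regular_map phi) (psi_reg : regular_map psi).
Hypotheses (phiK : cancel phi psi) (psiK : cancel psi phi).

(* The point [u] of the smooth model lies over the point [(a, b)] of the plane curve. *)
Definition link a b (u : X) := exists y : CV,
  val (val y) = line_of (affine_row a b) /\ val (psi y) = val u.

Lemma CV_coords (z : CV) : exists a b,
  on_curve A B c a b /\ val (val z) = line_of (affine_row a b).
Proof. by have [[a [b [ab zE]]] _] := set_mem (valP z); exists a, b. Qed.

Lemma link_curve a b u : link a b u -> on_curve A B c a b.
Proof.
move=> [z [zE _]]; have [a' [b' [ab zE']]] := CV_coords z.
by move: zE; rewrite zE' => /affine_row_inj[<- <-].
Qed.

Lemma linkU a b u : link a b u -> U (val u).
Proof. by move=> [z [_ <-]]; have [] := set_mem (valP (psi z)). Qed.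

Lemma link_ex (u : X) : U (val u) -> exists a b, link a b u.
Proof.
move=> Uu; have XUu : XU (val u) by split=> //; exact: set_mem (valP u).
pose v : XU := exist _ (val u) (mem_set XUu).
have [a [b [_ vE]]] := CV_coords (phi v).
by exists a, b, (phi v); rewrite phiK.
Qed.

Lemma link_inj_l a b a' b' u : link a b u -> link a' b' u -> a = a' /\ b = b'.
Proof.
move=> [z [zE zu]] [z' [zE' z'u]]; apply: affine_row_inj; rewrite -zE -zE'.
have /(congr1 phi) : psi z = psi z' by apply: val_inj; rewrite zu z'u.
by rewrite !psiK => ->.
Qed.

Lemma link_inj_r a b u u' : link a b u -> link a b u' -> u = u'.
Proof.
move=> [z [zE zu]] [z' [zE' z'u]]; apply: val_inj; rewrite -zu -z'u.
by congr (val (psi _)); apply: val_inj; apply: val_inj; rewrite zE zE'.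
Qed.

Lemma XU_open : relatively_open (fun u : X => U (val u)).
Proof. exact: relatively_open_zopen. Qed.

Lemma XU_incl : exists f : XU -> X, forall v, val (f v) = val v.
Proof.
have /choice[f fE] : forall v : XU, exists u : X, val u = val v.
  by move=> v; have [Xv _] := set_mem (valP v); exists (exist _ (val v) (mem_set Xv)).
by exists f.
Qed.

(** By irreducibility the open set meets [U]. Pulled back to the plane curve it contains a basic
    open set, whose dehomogenised form is nonzero at one curve point and therefore nonzero in
    [K]. *)
Lemma open_generic (P : X -> Prop) : relatively_open P -> (exists u, P u) ->
  generic iota A B c x y (fun a b => exists u, link a b u /\ P u).
Proof.
move=> oP exP; have [incl inclE] := XU_incl.
have [u [Uu Pu]] : exists u : X, U (val u) /\ P u.
  apply: (relatively_open_meet Xirr XU_open oP _ exP).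
  by have [p [Xp Up]] := XU0; exists (exist _ p (mem_set Xp)).
have [a [b lab]] := link_ex Uu; have [z [zE zu]] := lab.
have oP' : relatively_open (fun z => P (incl (psi z))).
  apply: (relatively_open_preimage (f := incl \o psi)) => //.
  exact: regular_comp psi_reg (regular_incl inclE).
have Pz : P (incl (psi z)).
  by have -> : incl (psi z) = u by apply: val_inj; rewrite inclE.
have [d [G [Gd Gz GP]]] := oP' z Pz.
have Vz : V (val z) by have [] := set_mem (valP z).
have [e [H [He Hz HV]]] := zopen_basicP oV Vz.
exists (dehomogenize G * dehomogenize H); rewrite ev2M; split.
  have pt := iffLR (on_curve_chart A B c0 a b) (link_curve lab).
  rewrite mulf_neq0 //; apply: (ev2_point_neq0 ch pt).
    by rewrite -(peval_affine_neq0 Gd zE).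
  by rewrite -(peval_affine_neq0 He zE).
move=> a' b' ab'; rewrite ev2M mulf_eq0 negb_or => /andP[Gab Hab].
pose w := affine_point a' b'.
have wE : val w = line_of (affine_row a' b') by [].
have CVw : CV w.
  split; first by exists a', b'.
  by apply: HV; rewrite /= (peval_affine_neq0 He wE).
pose w' : CV := exist _ w (mem_set CVw).
exists (incl (psi w')); split; first by exists w'; rewrite inclE.
by apply: GP; rewrite /= (peval_affine_neq0 Gd wE).
Qed.

Definition forms_at (F0 F1 F2 : {poly {poly k}}) a b a' b' :=
  [/\ ev2 idfun a b F0 != 0, a' * ev2 idfun a b F0 = ev2 idfun a b F1 &
      b' * ev2 idfun a b F0 = ev2 idfun a b F2].

(** The forms are those of the regular map phi o g o psi near the point below [u], dehomogenised. *)
Lemma local_forms (g : X -> X) (u : X) : regular_map g -> U (val u) -> U (val (g u)) ->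
  exists (F0 F1 F2 : {poly {poly k}}) (P : X -> Prop), [/\ relatively_open P, P u &
    forall v, P v -> exists a b a' b',
      [/\ link a b v, link a' b' (g v) & forms_at F0 F1 F2 a b a' b']].
Proof.
move=> g_reg Uu Ugu; have [incl inclE] := XU_incl.
have XUu : XU (val u) by split=> //; exact: set_mem (valP u).
pose u' : XU := exist _ (val u) (mem_set XUu).
have incl_reg := regular_incl inclE.
have oR : relatively_open (fun z => U (val (g (incl (psi z))))).
  apply: (relatively_open_preimage (f := g \o (incl \o psi)) (P := fun u : X => U (val u))).
    by apply: regular_comp g_reg; exact: regular_comp psi_reg incl_reg.
  exact: XU_open.
have u'E : incl (psi (phi u')) = u by rewrite phiK; apply: val_inj; rewrite inclE.
have [d [H [Hd Hu HR]]] := oR (phi u') (eq_ind_r (fun v => U (val (g v))) Ugu u'E).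
(* The composite makes sense only where [g] stays in [U], which holds on this smaller open subset of
   the plane curve. *)
pose Y := (CV `&` [set p | peval H p != 0])%classic.
have /choice[j jE] : forall v : Y, exists z : CV, val z = val v.
  by move=> v; have [CVv _] := set_mem (valP v); exists (exist _ (val v) (mem_set CVv)).
have jH v : peval H (val (j v)) != 0.
  by rewrite jE; have [] := set_mem (valP v).
have /choice[h hE] : forall v : Y, exists z : XU, val z = val (g (incl (psi (j v)))).
  move=> v; have Xw := set_mem (valP (g (incl (psi (j v))))).
  have XUw : XU (val (g (incl (psi (j v))))) by split=> //; apply: (HR _ (jH v)).
  by exists (exist _ (val (g (incl (psi (j v))))) (mem_set XUw)).
have h_reg : regular_map h.
  apply: (regular_eq (f := g \o (incl \o (psi \o j)))) => [v|]; first by rewrite hE.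
  apply: regular_comp g_reg; apply: regular_comp incl_reg; apply: regular_comp psi_reg.
  exact: regular_incl.
have Yu : Y (val (phi u')) by split=> //; exact: set_mem (valP (phi u')).
have [W [e [F [oW Wu Fe fE]]]] := regular_comp h_reg phi_reg (exist _ (val (phi u')) (mem_set Yu)).
have [e' [H' [He' Hu' HW]]] := zopen_basicP oW Wu.
exists (dehomogenize (F 0)), (dehomogenize (F 1)), (dehomogenize (F (inord 2))).
exists (fun v => exists2 z : XU, val z = val v & peval (H * H') (val (phi z)) != 0); split.
- apply: (relatively_open_sub oU).
  apply: (relatively_open_preimage (P := fun z : CV => peval (H * H') (val z) != 0)) => //.
  exact: relatively_open_peval (dhomogM Hd He').
- by exists u' => //; rewrite /peval mevalM mulf_neq0.
move=> v [z zv]; rewrite /peval mevalM mulf_eq0 negb_or => /andP[Hz H'z].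
have Yz : Y (val (phi z)) by split=> //; exact: set_mem (valP (phi z)).
pose z' : Y := exist _ (val (phi z)) (mem_set Yz).
have jz : j z' = phi z by apply: val_inj; rewrite jE.
have [a [b [ab zE]]] := CV_coords (phi z).
have [a' [b' [ab' zE']]] := CV_coords (phi (h z')).
exists a, b, a', b'; split.
- by exists (phi z); rewrite phiK.
- exists (phi (h z')); rewrite phiK; split=> //; rewrite hE jz phiK.
  by congr (val (g _)); apply: val_inj; rewrite inclE.
have := fE z' (HW _ H'z); rewrite /= zE' => /esym/line_ofP[l /rowP E].
have [m m0 mE] := hcoordE zE.
have FE i : peval (F i) (val z') = m ^+ e * ev2 idfun a b (dehomogenize (F i)).
  by rewrite /peval /= mE (mevalZ_homog _ _ (Fe i)) ev2_dehomogenize.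
have me0 : m ^+ e != 0 by rewrite expf_neq0.
have Ei i : m ^+ e * ev2 idfun a b (dehomogenize (F i)) = l * [:: 1; a'; b']`_i.
  by rewrite -FE; have := E i; rewrite !mxE.
have E0 := Ei 0; have E1 := Ei 1; have E2 := Ei (inord 2).
rewrite /= ?inordK //= mulr1 in E0 E1 E2.
have l0 : l != 0.
  apply/eqP => l0; have := hcoord_neq0 (val (phi (h z'))).
  have [t _ ->] := hcoordE (fE z' (HW _ H'z)).
  suff -> : \row_i peval (F i) (val z') = 0 by rewrite scaler0 eqxx.
  by apply/rowP => i; have := E i; rewrite !mxE l0 mul0r => ->.
split.
- by apply: contraNneq l0 => F0; rewrite -E0 F0 mulr0.
- by apply: (mulfI me0); rewrite mulrCA E0 mulrC E1.
- by apply: (mulfI me0); rewrite mulrCA E0 mulrC E2.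
Qed.

Lemma U_meet (P : X -> Prop) : relatively_open P -> (exists u, P u) ->
  exists u, U (val u) /\ P u.
Proof.
move=> oP exP; apply: (relatively_open_meet Xirr XU_open oP _ exP).
by have [p [Xp Up]] := XU0; exists (exist _ p (mem_set Xp)).
Qed.

Lemma U_point : exists u : X, U (val u).
Proof. by have [p [Xp Up]] := XU0; exists (exist _ p (mem_set Xp)). Qed.

Lemma U_preimage_open (g : X -> X) : regular_map g ->
  relatively_open (fun u => U (val (g u))).
Proof. by move=> gr; apply: (relatively_open_preimage gr XU_open). Qed.

Definition represents (g : X -> X) (M : 'M[k]_4) :=
  forall u a b a' b', link a b u -> link a' b' (g u) ->
    exists2 m, m != 0 & M *m segre a b = m *: segre a' b'.

Lemma segre_neq0 (a b : k) : segre a b != 0.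
Proof. by apply/eqP => /matrixP/(_ 0 0); rewrite !mxE /= => /eqP; rewrite oner_eq0. Qed.

(* The 2x2 minors of the pair [M s(a,b)], [s(a',b')] are polynomials in [a] and [b] after
   clearing denominators, so that they vanish everywhere once they vanish generically. *)
Lemma represents_of_generic (g : X -> X) (M : 'M[k]_4) : regular_map g -> M \in unitmx ->
    generic iota A B c x y (fun a b => forall u a' b', link a b u -> link a' b' (g u) ->
      exists m, M *m segre a b = m *: segre a' b') ->
  represents g M.
Proof.
move=> g_reg uM gen u a b a' b' lab lab'.
have [F0 [F1 [F2 [P [oP Pu PF]]]]] := local_forms g_reg (linkU lab) (linkU lab').
have [S SE] : exists S : 'I_4 -> {poly {poly k}},
    forall i s t, ev2 idfun s t (S i) = (M *m segre s t) i 0.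
  exists (fun i => \sum_(j < 4) (M i j)%:P%:P * [:: 1; 'X%:P; 'X; 'X%:P * 'X]`_j) => i s t.
  rewrite (big_morph _ (ev2D idfun s t) (ev2_0 idfun s t)) mxE.
  apply: eq_bigr => j _; rewrite ev2M ev2C ev1C mxE; congr (_ * _).
  by case: j => -[|[|[|[|]]]] //= _; rewrite ?ev2_1 ?ev2M ?ev2C ?ev1X ?ev2X.
have [T TE] : exists T : 'I_4 -> {poly {poly k}},
    forall i s t s' t', forms_at F0 F1 F2 s t s' t' ->
    ev2 idfun s t (T i) = ev2 idfun s t F0 ^+ 2 * segre s' t' i 0.
  exists (fun i => [:: F0 ^+ 2; F1 * F0; F2 * F0; F1 * F2]`_i) => i s t s' t' [_ e1 e2].
  rewrite mxE; case: i => -[|[|[|[|]]]] //= _.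
  - by rewrite ev2Xn mulr1.
  - by rewrite ev2M -e1; ring.
  - by rewrite ev2M -e2; ring.
  - by rewrite ev2M -e1 -e2; ring.
have minors i j : ev2 iota x y (S i * T j - S j * T i) = 0.
  apply: (generic_eq0 aA aB c0 co).
  have := generic_and gen (open_generic oP (ex_intro _ u Pu)).
  apply: generic_imp => s t _ [H [v [lst Pv]]].
  have [s1 [t1 [s' [t' [lst1 lst' F]]]]] := PF v Pv.
  have [es et] := link_inj_l lst1 lst; rewrite es et in F.
  have [m E] := H v s' t' lst lst'.
  by rewrite ev2B !ev2M !SE !(TE _ _ _ _ _ F) E !scalemxE; ring.
have [a1 [b1 [a1' [b1' [l1 l1' F]]]]] := PF u Pu.
have [ea eb] := link_inj_l l1 lab; have [ea' eb'] := link_inj_l l1' lab'.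
rewrite ea eb ea' eb' in F; have [F00 _ _] := F.
have pt := iffLR (on_curve_chart A B c0 a b) (link_curve lab).
(* The first entry of s(a', b') is 1, so the minors involving row 0 suffice and the factor is the
   first entry of M s(a, b). *)
have E : M *m segre a b = (M *m segre a b) 0 0 *: segre a' b'.
  apply/colP => i; rewrite scalemxE.
  have := ev2_point_eq0 ch (minors 0 i) pt.
  rewrite ev2B !ev2M !SE !(TE _ _ _ _ _ F) [segre a' b' 0 0]mxE /= mulr1 => /eqP.
  have F2n : ev2 idfun a b F0 ^+ 2 != 0 by rewrite expf_neq0.
  rewrite subr_eq0 => /eqP e; apply: (mulIf F2n); rewrite -e; ring.
exists ((M *m segre a b) 0 0) => //; apply: contraNneq (segre_neq0 a b) => m0.
by rewrite -(mulKmx uM (segre a b)) E m0 scale0r mulmx0.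
Qed.

Lemma has_value_forms (x' y' : K) (F0 F1 F2 : {poly {poly k}}) a b a' b' :
    x' * ev2 iota x y F0 = ev2 iota x y F1 -> y' * ev2 iota x y F0 = ev2 iota x y F2 ->
    forms_at F0 F1 F2 a b a' b' ->
  has_value iota x y a b x' a' /\ has_value iota x y a b y' b'.
Proof. by move=> e1 e2 [F00 f1 f2]; split; [exists F1, F0|exists F2, F0]. Qed.

Lemma generic_value0 z : generic iota A B c x y (fun a b => has_value iota x y a b z 0) ->
  z = 0.
Proof.
move=> gz; have [P [Q [Q0 zE]]] := generates_fraction z (coord_gen co).
suff P0 : ev2 iota x y P = 0 by rewrite zE P0 mul0r.
apply: (generic_eq0 aA aB c0 co); apply: generic_imp gz => a b.
move/(on_curve_chart A B c0) => pt h.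
have := valueM h (value_ev2 iota x y a b Q); rewrite mul0r zE divfK // => hP.
exact: (value_uniq ch pt (value_ev2 iota x y a b P) hP).
Qed.

(** If x' were algebraic, it would be a constant, then so would y' by the equation, and [K] would be
    [k], against the transcendence of x. *)
Lemma coordinates_of_generates (x' y' : K) :
    ev1 iota x' A * ev1 iota y' B + iota c = 0 -> generates iota x' y' ->
  coordinates iota A B c x' y'.
Proof.
move=> e g; split=> // p px; apply/eqP/negPn/negP => p0.
have [a x'E] := ev1_root p0 px.
pose G := A.[a] *: B + c%:P.
have G0 : G != 0.
  have [b Bb] := adm_root aB; apply: contraNneq c0 => /(congr1 (horner^~ b)).
  by rewrite hornerD hornerZ Bb mulr0 add0r hornerC horner0 => ->.
have [|b y'E] := @ev1_root _ _ iota y' G G0.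
  by rewrite ev1D ev1Z ev1C -e x'E ev1_rmorph.
have [d xE] : exists d, x = iota d.
  apply: (g (fun z => exists d, z = iota d)); last by exists b.
    split.
    - by move=> d; exists d.
    - by move=> _ _ [d1 ->] [d2 ->]; exists (d1 + d2); rewrite rmorphD.
    - by move=> _ _ [d1 ->] [d2 ->]; exists (d1 * d2); rewrite rmorphM.
    - by move=> _ [d ->]; exists d^-1; rewrite fmorphV.
  by exists a.
have := coord_tr co (p := 'X - d%:P); rewrite ev1_XsubC xE subrr => /(_ erefl)/eqP.
by rewrite polyXsubC_eq0.
Qed.

(** Local forms of [g] define x' and y' in [K]; local forms of the inverse express x and y through
    x' and y', so these generate [K] and [birational_matrix] applies. *)
Lemma represents_exists (g g' : X -> X) :
    regular_map g -> regular_map g' -> cancel g g' -> cancel g' g ->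
  exists M, M \in unitmx /\ represents g M.
Proof.
move=> g_reg g'_reg gK g'K.
have [u [Uu Ugu]] : exists u, U (val u) /\ U (val (g u)).
  apply: U_meet; first exact: U_preimage_open.
  by have [v Uv] := U_point; exists (g' v); rewrite g'K.
have [F0 [F1 [F2 [P [oP Pu PF]]]]] := local_forms g_reg Uu Ugu.
have Ugu' : U (val (g' (g u))) by rewrite gK.
have [G0 [G1 [G2 [Q [oQ Qu QG]]]]] := local_forms g'_reg Ugu Ugu'.
have oD := relatively_openI oP (relatively_open_preimage g_reg oQ).
have gen := open_generic oD (ex_intro _ u (conj Pu Qu)).
have {}gen : generic iota A B c x y (fun a b => exists a' b',
    [/\ on_curve A B c a' b', forms_at F0 F1 F2 a b a' b' & forms_at G0 G1 G2 a' b' a b]).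
  apply: generic_imp gen => a b _ [v [lab [Pv Qv]]].
  have [a1 [b1 [a' [b' [l1 l' F]]]]] := PF v Pv.
  have [a2 [b2 [a3 [b3 [l2 l3 G]]]]] := QG _ Qv; rewrite gK in l3.
  have [e1 e2] := link_inj_l l1 lab; have [e3 e4] := link_inj_l l3 lab.
  have [e5 e6] := link_inj_l l2 l'.
  exists a', b'; rewrite e1 e2 in F; rewrite e3 e4 e5 e6 in G; split=> //.
  exact: link_curve l'.
have F00 : ev2 iota x y F0 != 0.
  have [a [b [ab [a' [b' [_ [F _ _] _]]]]]] := generic_ex aA aB c0 co gen.
  by apply: (ev2_point_neq0 ch _ F); apply/on_curve_chart.
pose x' := ev2 iota x y F1 / ev2 iota x y F0.
pose y' := ev2 iota x y F2 / ev2 iota x y F0.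
have e1 : x' * ev2 iota x y F0 = ev2 iota x y F1 by rewrite divfK.
have e2 : y' * ev2 iota x y F0 = ev2 iota x y F2 by rewrite divfK.
have G00 : ev2 iota x' y' G0 != 0.
  have [a [b [ab [a' [b' [_ F [G _ _]]]]]]] := generic_ex aA aB c0 co gen.
  have pt := iffLR (on_curve_chart A B c0 a b) ab.
  have [hx hy] := has_value_forms e1 e2 F.
  exact: (value_neq0 ch pt (value_ev2_comp G0 hx hy) G).
(* An element of [K] is determined by its values at generic points, so z is recognised as H / G0 at
   (x', y') from its values. *)
have cancel_forms (H : {poly {poly k}}) z : (forall a b a' b', forms_at G0 G1 G2 a' b' a b ->
      exists2 w, has_value iota x y a b z w & w * ev2 idfun a' b' G0 = ev2 idfun a' b' H) ->
    z = ev2 iota x' y' H / ev2 iota x' y' G0.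
  move=> zH; apply: (mulIf G00); rewrite divfK //; apply/eqP.
  rewrite -subr_eq0; apply/eqP/generic_value0.
  apply: generic_imp gen => a b ab [a' [b' [_ F G]]].
  have [hx hy] := has_value_forms e1 e2 F; have [w hz wE] := zH _ _ _ _ G.
  have hm : has_value iota x y a b (-1) (-1).
    by have := value_const iota x y a b (-1); rewrite rmorphN1.
  have := valueD (valueM hz (value_ev2_comp G0 hx hy)) (valueM hm (value_ev2_comp H hx hy)).
  by rewrite wE !mulN1r subrr.
have co' : coordinates iota A B c x' y'.
  apply: coordinates_of_generates.
    apply: generic_value0; apply: generic_imp gen => a b _ [a' [b' [ab' F _]]].
    have [hx hy] := has_value_forms e1 e2 F; rewrite -ab' -!(ev1_id a') -!(ev1_id b').
    have h := value_ev2_comp (A%:P * map_poly polyC B + c%:P%:P) hx hy.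
    by rewrite !ev2D !ev2M !ev2C !ev2_lift !ev1C in h.
  move=> S sS Sx' Sy'; apply: (coord_gen co sS).
    have -> : x = ev2 iota x' y' G1 / ev2 iota x' y' G0.
      apply: cancel_forms => a b a' b' [_ e _]; exists a => //; exact: value_u.
    apply: (subfieldM sS); last apply: (subfieldV sS); exact: (subfield_ev2 _ sS).
  have -> : y = ev2 iota x' y' G2 / ev2 iota x' y' G0.
    apply: cancel_forms => a b a' b' [_ _ e]; exists b => //; exact: value_v.
  apply: (subfieldM sS); last apply: (subfieldV sS); exact: (subfield_ev2 _ sS).
have [M [uM [l l0 ME]]] := birational_matrix aA aB c0 co co'.
exists M; split=> //; apply: represents_of_generic => //.
have genM := generic_matrix aA aB c0 co l0 ME F00 e1 e2.
have := generic_and genM (open_generic oP (ex_intro _ u Pu)).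
apply: generic_imp => a b _ [H [v [lv Pv]]] v' a' b' lab lab'.
have [a1 [b1 [a2 [b2 [l1 l2 [_ f1 f2]]]]]] := PF v Pv.
have ev := link_inj_r lab lv; rewrite ev in lab lab'.
have [ea eb] := link_inj_l l1 lab; have [ea' eb'] := link_inj_l l2 lab'.
rewrite ea eb ea' eb' in f1 f2.
by have [m _ E] := H _ _ f1 f2; exists m.
Qed.

(** At generic points s(a, b) is an eigenvector of L^-1 M N, which is therefore scalar; it is
    nonzero because the matrices are invertible. *)
Lemma represents_mul (g h : X -> X) M N L : regular_map g -> regular_map h ->
    bijective g -> bijective h -> M \in unitmx -> N \in unitmx -> L \in unitmx ->
    represents g M -> represents h N -> represents (g \o h) L ->
  exists2 nu, nu != 0 & M *m N = nu *: L.
Proof.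
move=> g_reg h_reg [g' gK g'K] [h' hK h'K] uM uN uL rM rN rL.
have gh_reg : regular_map (g \o h) := regular_comp h_reg g_reg.
have oD := relatively_openI (U_preimage_open h_reg) (U_preimage_open gh_reg).
have exD : exists u, U (val (h u)) /\ U (val ((g \o h) u)).
  apply: (relatively_open_meet Xirr (U_preimage_open h_reg) (U_preimage_open gh_reg)).
    by have [v Uv] := U_point; exists (h' v); rewrite h'K.
  by have [v Uv] := U_point; exists (h' (g' v)); rewrite /= h'K g'K.
have [nu E] : exists nu, invmx L *m (M *m N) = nu%:M.
  apply: (generic_eigen_scalar aA aB c0 co).
  apply: generic_imp (open_generic oD exD) => a b _ [u [lab [Uh Ugh]]].
  have [a1 [b1 l1]] := link_ex Uh; have [a2 [b2 l2]] := link_ex Ugh.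
  have [m1 _ E1] := rN _ _ _ _ _ lab l1; have [m2 _ E2] := rM _ _ _ _ _ l1 l2.
  have [m3 m30 E3] := rL _ _ _ _ _ lab l2.
  exists (m1 * m2 / m3); rewrite -!mulmxA E1 -scalemxAr E2 scalerA.
  rewrite -scalerA -[in RHS](mulKmx uL (segre a b)) E3 -!scalemxAr !scalerA.
  by rewrite divfK.
have E' : M *m N = nu *: L.
  by rewrite -[LHS](mulKVmx uL) E mul_mx_scalar.
exists nu => //; apply: contraTneq (unitmx1 k 4) => nu0.
have : M *m N \in unitmx by rewrite unitmx_mul uM uN.
by rewrite E' nu0 scale0r unitmxE det0 unitr0.
Qed.

(** The locus where g and h differ is open. If nonempty, it would contain a point whose images under
    both lie in [U]; their Segre vectors would be proportional, hence equal, as the first entries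
    are 1. *)
Lemma represents_inj (g h : X -> X) M N (nu : k) : regular_map g -> regular_map h ->
    bijective g -> bijective h -> nu != 0 -> M = nu *: N ->
    represents g M -> represents h N -> g =1 h.
Proof.
move=> g_reg h_reg [g' gK g'K] [h' hK h'K] nu0 E rM rN u.
apply: contrapT => gh.
have oD := relatively_openI (U_preimage_open g_reg) (relatively_open_neq g_reg h_reg).
have [v [[Uh Uv] [Ug ne]]] : exists v,
    (U (val (h v)) /\ U (val v)) /\ (U (val (g v)) /\ g v <> h v).
  apply: (relatively_open_meet Xirr) => //.
  - exact: relatively_openI (U_preimage_open h_reg) XU_open.
  - apply: (relatively_open_meet Xirr (U_preimage_open h_reg) XU_open).
      by have [v Uv] := U_point; exists (h' v); rewrite h'K.
    exact: U_point.
  apply: (relatively_open_meet Xirr (U_preimage_open g_reg) (relatively_open_neq g_reg h_reg)).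
    by have [v Uv] := U_point; exists (g' v); rewrite g'K.
  by exists u.
have [a [b lab]] := link_ex Uv; have [a1 [b1 l1]] := link_ex Ug.
have [a2 [b2 l2]] := link_ex Uh.
have [m1 m10 E1] := rM _ _ _ _ _ lab l1; have [m2 m20 E2] := rN _ _ _ _ _ lab l2.
apply: ne; move: E1; rewrite E -scalemxAl E2 scalerA => /matrixP E3.
have e i : nu * m2 * segre a2 b2 i 0 = m1 * segre a1 b1 i 0.
  by have := E3 i 0; rewrite !scalemxE.
have := e 0; rewrite !mxE /= !mulr1 => em.
have ea := e (inord 1); have eb := e (inord 2).
rewrite !mxE !inordK //= em in ea eb.
move/(mulfI m10): ea => ea; move/(mulfI m10): eb => eb.
by rewrite ea eb in l2; apply: (link_inj_r l1 l2).
Qed.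

End Automorphism.

(** * Additive polynomials *)

Lemma coef_additive_poly (k : fieldType) p e (a : 'I_e.+1 -> k) i :
  (additive_poly p a)`_i = \sum_(j < e.+1) a j * (i == p ^ j)%N%:R.
Proof.
by rewrite /additive_poly coef_sum; apply: eq_bigr => j _; rewrite coefZ coefXn.
Qed.

Lemma additive_admissible (k : fieldType) p e (a : 'I_e.+1 -> k) :
    p \in [pchar k] -> (1 <= e)%N -> (2 < p ^ e)%N -> a ord_max * a ord0 != 0 ->
  admissible (p ^ e) (additive_poly p a).
Proof.
move=> pk e1 pe2; rewrite mulf_eq0 negb_or => /andP[am a0].
have pp : prime p := pcharf_prime pk; have p1 := prime_gt1 pp.
have coef_top : (additive_poly p a)`_(p ^ e) = a ord_max.
  rewrite coef_additive_poly (bigD1 ord_max) //= eqxx mulr1 big1 ?addr0 // => j jm.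
  rewrite eqn_exp2l // gtn_eqF ?mulr0 // ltn_neqAle -ltnS ltn_ord andbT.
  by apply: contra jm => /eqP je; apply/eqP/val_inj.
have size_top : size (additive_poly p a) = (p ^ e).+1.
  apply/eqP; rewrite eqn_leq; apply/andP; split.
    apply/leq_sizeP => i ei; rewrite coef_additive_poly big1 // => j _.
    rewrite gtn_eqF ?mulr0 // (leq_ltn_trans _ ei) // leq_exp2l //.
    by rewrite -ltnS ltn_ord.
  rewrite ltnNge; apply: contraL am => /leq_sizeP/(_ _ (leqnn _)).
  by rewrite coef_top => ->; rewrite eqxx.
split=> //; last first.
  (* If p^e - 1 = p^j, then p divides p^j + 1, so j = 0 and p^e = 2, which is excluded. *)
  rewrite coef_additive_poly big1 // => j _; case: eqP => [E|_]; last by rewrite mulr0.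
  have pqe : (p ^ e = (p ^ j).+1)%N by rewrite -E prednK // (leq_trans _ pe2).
  have : (p %| (p ^ j).+1)%N by rewrite -pqe -{1}[p]expn1 dvdn_exp2l.
  case: (nat_of_ord j) pqe => [|l] pqe.
    by move: pe2; rewrite pqe expn0.
  rewrite -addn1 dvdn_addr ?dvdn1; last by rewrite expnS dvdn_mulr.
  by move/eqP => p1'; move: p1; rewrite p1'.
(* In characteristic p the derivative of X^(p^j) is zero for j > 0, and only the linear term
   contributes. *)
exists (a ord0) => //; rewrite /additive_poly raddf_sum /= (bigD1 ord0) //=.
rewrite derivZ derivXn expn0 expr0 big1 ?addr0 ?mulr1n ?alg_polyC // => j j0.
rewrite derivZ derivXn -scaler_nat natrX (pcharf0 pk) expr0n.
have -> : (j == 0 :> nat) = false by apply: contra_neqF j0 => /eqP j0; apply: val_inj.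
by rewrite scale0r scaler0.
Qed.

Theorem corollary2
    (k : closedFieldType) (p : nat) (p_char : p \in [pchar k])
    (e : nat) (e_ge1 : (1 <= e)%N) (pe_gt2 : (2 < p ^ e)%N)
    (c : k) (c_neq0 : c != 0)
    (alpha1 alpha2 : 'I_e.+1 -> k)
    (alpha1_neq0 : alpha1 ord_max * alpha1 ord0 != 0)
    (alpha2_neq0 : alpha2 ord_max * alpha2 ord0 != 0)
    (n : nat) (X : set (pspace k n))
    (X_model : smooth_model X
       (plane_curve (fun x y : k =>
          (additive_poly p alpha1).[x] * (additive_poly p alpha2).[y] + c))) :
  exists Phi : {multiplicative Aut X -> PGL 4 k}, injective Phi.
Proof.
have aA := additive_admissible p_char e_ge1 pe_gt2 alpha1_neq0.
have aB := additive_admissible p_char e_ge1 pe_gt2 alpha2_neq0.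
set A := additive_poly p alpha1 in aA X_model.
set B := additive_poly p alpha2 in aB X_model.
have [[_ Xirr _ _] [U [V [oU oV XU0 _ [phi [psi [phi_reg psi_reg phiK psiK]]]]]]] := X_model.
have [K [iota [x [y co]]]] := function_field_exists c aA aB.
have bij (g : Aut X) : bijective g.
  by have [_ [g' [_ gK g'K]]] := autP g; exists g'.
have reg (g : Aut X) : regular_map g by have [] := autP g.
(* The matrices are chosen independently for each automorphism; the resulting scalar ambiguity
   disappears in the projective group. *)
have /choice[M MP] : forall g : Aut X, exists M : GL 4 k, represents psi g (val M).
  move=> g; have [g_reg [g' [g'_reg gK g'K]]] := autP g.
  have [M [uM rM]] := represents_exists aA aB c_neq0 co Xirr oU oV XU0 phi_reg psi_reg
    phiK psiK g_reg g'_reg gK g'K.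
  by exists (mkGL uM).
pose f g := to_PGL (M g).
have fM : {morph f : g h / (g * h)%g}.
  move=> g h; rewrite [(f g * f h)%g]pgl_mulE; apply/esym/eqP/to_PGLP.
  have [nu nu0 E] := represents_mul aA aB c_neq0 co Xirr oU oV XU0 psi_reg phiK
    (reg g) (reg h) (bij g) (bij h) (valP (M g)) (valP (M h)) (valP (M (g * h)%g))
    (MP g) (MP h) (MP (g * h)%g).
  by exists nu.
pose fm := isMultiplicative.Build (Aut X) (PGL 4 k) f fM.
pose Phi : {multiplicative Aut X -> PGL 4 k} := HB.pack f fm.
exists Phi => g h /eqP/to_PGLP[nu nu0 E]; apply: aut_ext.
exact: (represents_inj Xirr oU XU0 phiK (reg g) (reg h) (bij g) (bij h) nu0 E
  (MP g) (MP h)).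
Qed.
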